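(* Let $k\in\mathbb N$ and let $f\in\mathcal W_s(g_k)$ be close enough to $g_k$ (see context). For each $p\ge0$ let $\rho_p$ be the spectral radius of the Lindeberg--Lyapunov operator $\mathcal K_p=\mathcal K_{f,p}$ on $H^r(\overline{D_k})$. Then: (S1) For each $p\ge0$, $$(\lambda_f^{-1}f'(1))^p<\rho_p<(\lambda_f^{-1}f'(1))^p+(-\lambda_f)^{-p}.$$ In particular, if $f=g_k$ then $$1<\lambda_k^{2kp}\rho_p<1+(-\lambda_k)^{(2k-1)p}.$$ (S2) For $p\ge0$, the map $p\mapsto\rho_p$ is strictly increasing and strictly log-convex. (S3) The map $p\mapsto \log[\rho_p]/p$ is strictly decreasing.
   Context: Period doubling. $I=[-1,1]$. $\mathcal P$ is the set of analytic even maps $f:I\to I$ such that (P1) $f(0)=1$; (P2) $xf'(x)<0$ for $x\ne0$; (P3) $Sf(x)<0$ for $x\neq0$, where $Sf=\frac{f'''}{f'}-\frac32\big(\frac{f''}{f'}\big)^2$; and, with $\lambda_f=f(1)$, $b_f=f(\lambda_f)$, (P4) $0<|\lambda_f|<b_f$; (P5) $0<f(b_f)<|\lambda_f|$ (so $\lambda_f<0$). $Tf(x)=\lambda_f^{-1}f(f(\lambda_f x))$ on $\mathcal P$. For each $k\in\mathbb N$ there is a known fixed point $g_k\in\mathcal P$, $Tg_k=g_k$, $g_k(x)=\phi_k(x^{2k})$ with $\phi_k$ analytic, $g_k$ concave on $I$ with $g_k''(x)<0$ for $x\ne0$, $g_k$ analytic on a bounded open domain $D_k\subset\mathbb C$ with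 $D_k\supset[-1,1]$, $\partial D_k$ smooth, $\overline{\lambda_kD_k}\subset D_k$, $\overline{g_k(\lambda_kD_k)}\subset D_k$, where $\lambda_k=g_k(1)$. Let $\mathcal G_k$ be the Banach space (sup norm) of functions $z^{2k}\hat f(z)$ with $\hat f$ analytic on $D_k$ and continuous on $\overline{D_k}$. $\mathcal W_s(g_k)$ is the invariant stable manifold of $T$ at $g_k$ in $(1+\mathcal G_k)\cap\mathcal P$; for $f\in\mathcal W_s(g_k)$ all $T^nf$ are defined and $\|T^nf-g_k\|_{C(\overline{D_k})}=O(\omega_k^n)$, $0<\omega_k<1$ universal. $H^r(\overline{D_k})$ is the space (sup norm) of bounded analytic functions on $D_k$, continuous on $\overline{D_k}$, real on the reals. For $f\in\mathcal W_s(g_k)$, $p\ge0$, $$\mathcal K_{f,p}h(z)=\frac1{(-\lambda_f)^p}\Big[\big(-f'(f(\lambda_fz))\big)^ph(\lambda_fz)+h(f(\lambda_fz))\Big],$$ with powers defined by the branch of the logarithm on $\mathbb C\setminus(-\infty,0]$ real on the positive reals. For real $p$, $\lambda_k^{2kp}$ means $(\lambda_k^{2k})^p$.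
   Formalization: In (S1) both strict upper bounds are proved for p>0 and only as ≤ at p=0, where ρ_0=2 gives equality; g_k is assumed to have φ_k'(0)≠0 (critical order exactly 2k), without which the g_k form of (S1) fails; (S3) is for p>0. *)

(* Defs.v *)
From Stdlib Require Import Reals Lra.
From Coquelicot Require Import Coquelicot.
Open Scope R_scope.

Definition closure (A : C -> Prop) (z : C) : Prop :=
  forall eps : R, 0 < eps -> exists w, A w /\ Cmod (w - z)%C < eps.

Definition boundary (A : C -> Prop) (z : C) : Prop :=
  closure A z /\ closure (fun w => ~ A w) z.

Definition included (A B : C -> Prop) : Prop := forall z, A z -> B z.

Definition image (f : C -> C) (A : C -> Prop) (w : C) : Prop :=
  exists z, A z /\ w = f z.

Definition bounded_set (A : C -> Prop) : Prop :=
  exists M : R, forall z, A z -> Cmod z <= M.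

(* This is connectedness for open [A]. *)
Definition connected_open (A : C -> Prop) : Prop :=
  forall U V : C -> Prop, open U -> open V ->
    (forall z, A z -> U z \/ V z) ->
    (exists z, A z /\ U z) -> (exists z, A z /\ V z) ->
    exists z, A z /\ U z /\ V z.

(* Near each boundary point [A] is, after a rotation by the unit number [u],
   the region above the graph of a C^infinity function [gam]. *)
Definition smooth_boundary (A : C -> Prop) : Prop :=
  forall z0, boundary A z0 ->
    exists (u : C) (gam : R -> R) (r : R),
      Cmod u = 1 /\ 0 < r /\
      (forall (n : nat) (x : R), ex_derive_n gam n x) /\
      forall z, Cmod (z - z0)%C < r ->
        (A z <-> gam (Re ((z - z0) * Cconj u)%C) < Im ((z - z0) * Cconj u)%C).

Definition eq_on (A : C -> Prop) (f g : C -> C) : Prop :=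
  forall z, A z -> f z = g z.

Definition sup_norm (A : C -> Prop) (h : C -> C) : R :=
  real (Lub_Rbar (fun r => exists z, A z /\ r = Cmod (h z))).

Definition analytic_at_R (f : R -> R) (x0 : R) : Prop :=
  exists (a : nat -> R) (r : R), 0 < r /\
    forall x, Rabs (x - x0) < r -> is_pseries a (x - x0) (f x).

Definition analytic_at_C (f : C -> C) (z0 : C) : Prop :=
  exists (a : nat -> C) (r : R), 0 < r /\
    forall z, Cmod (z - z0)%C < r -> is_pseries a (z - z0)%C (f z).

Definition analytic_on (A : C -> Prop) (f : C -> C) : Prop :=
  forall z, A z -> analytic_at_C f z.

Definition in_I (x : R) : Prop := -1 <= x <= 1.

Definition schwarzian (f : R -> R) (x : R) : R :=
  Derive_n f 3 x / Derive_n f 1 x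
  - 3 / 2 * (Derive_n f 2 x / Derive_n f 1 x) ^ 2.

Definition lam (f : R -> R) : R := f 1.
Definition bpt (f : R -> R) : R := f (lam f).

(* An analytic map of the closed interval is represented by a function on R
   that is analytic on a neighbourhood of [-1,1], so that derivatives at the
   endpoints make sense; all other conditions only look at [-1,1]. *)
Definition class_P (f : R -> R) : Prop :=
  (forall x, in_I x -> analytic_at_R f x) /\
  (forall x, in_I x -> f (- x) = f x) /\
  (forall x, in_I x -> in_I (f x)) /\
  f 0 = 1 /\
  (forall x, in_I x -> x <> 0 -> x * Derive f x < 0) /\
  (forall x, in_I x -> x <> 0 -> schwarzian f x < 0) /\
  0 < Rabs (lam f) < bpt f /\
  0 < f (bpt f) < Rabs (lam f).

Definition doubling (f : R -> R) (x : R) : R := / lam f * f (f (lam f * x)).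

(* The real trace of a function that is real on the reals. *)
Definition trace (f : C -> C) (x : R) : R := Re (f (RtoC x)).

Definition lamC (f : C -> C) : R := lam (trace f).

(* H^r; functions matter only through their values on [closure D]. *)
Definition Hr (D : C -> Prop) (h : C -> C) : Prop :=
  analytic_on D h /\
  (exists M : R, forall z, D z -> Cmod (h z) <= M) /\
  continuous_on (T := C_UniformSpace) (U := C_UniformSpace) (closure D) h /\
  (forall x : R, closure D (RtoC x) -> Im (h (RtoC x)) = 0).

(* 1 + G_k, where G_k = z^(2k) H^r: as its members are to lie in P, the
   functions of G_k are taken real on the reals. *)
Definition one_plus_G (D : C -> Prop) (k : nat) (f : C -> C) : Prop :=
  exists h, Hr D h /\
    forall z, closure D z -> f z = (1 + Cpow z (2 * k) * h z)%C.

Definition in_GP (D : C -> Prop) (k : nat) (f : C -> C) : Prop :=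
  one_plus_G D k f /\ class_P (trace f).

Definition slit_plane (z : C) : Prop := ~ (Im z = 0 /\ Re z <= 0).

(* Half-angle formula for the argument in (-PI, PI), valid on [slit_plane]. *)
Definition Carg (z : C) : R := 2 * atan (Im z / (Cmod z + Re z)).

(* exp (p * Log z), with Log z = ln |z| + i Carg z. *)
Definition Cpower (z : C) (p : R) : C :=
  (RtoC (Rpower (Cmod z) p) * (cos (p * Carg z), sin (p * Carg z)))%C.

(* [g] is the fixed point of doubling whose critical point has order exactly
   2k, and [D] is its domain.  The condition [Derive phi 0 <> 0] says that the
   order is not a proper multiple of 2k.  The last clause says that the powers
   occurring in the Lindeberg-Lyapunov operators at [g] are defined. *)
Definition doubling_fixed_point (k : nat) (D : C -> Prop) (g : C -> C) : Prop :=
  in_GP D k g /\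
  (forall x, in_I x -> doubling (trace g) x = trace g x) /\
  (exists phi : R -> R,
     (forall t, 0 <= t <= 1 -> analytic_at_R phi t) /\
     Derive phi 0 <> 0 /\
     forall x, in_I x -> trace g x = phi (x ^ (2 * k))) /\
  (forall x y t, in_I x -> in_I y -> 0 <= t <= 1 ->
     t * trace g x + (1 - t) * trace g y <= trace g (t * x + (1 - t) * y)) /\
  (forall x, in_I x -> x <> 0 -> Derive_n (trace g) 2 x < 0) /\
  analytic_on D g /\
  open D /\ connected_open D /\ bounded_set D /\
  (forall x, in_I x -> D (RtoC x)) /\
  smooth_boundary D /\
  included (closure (image (fun z => (RtoC (lamC g) * z)%C) D)) D /\
  included (closure (image (fun z => g (RtoC (lamC g) * z)%C) D)) D /\
  (forall z, closure D z ->
     slit_plane (- C_derive g (g (RtoC (lamC g) * z)))%C).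

(* The stable manifold of [g] for contraction rate [omega]: all iterates T^n f
   are defined in (1 + G_k) /\ P and converge to [g] like omega^n.  Here [F n]
   is T^n f; the recursion on [-1,1] determines it on [closure D]. *)
Definition stable_manifold (k : nat) (D : C -> Prop) (g : C -> C) (omega : R)
    (f : C -> C) : Prop :=
  exists F : nat -> C -> C,
    F 0%nat = f /\
    (forall n, in_GP D k (F n)) /\
    (forall n x, in_I x -> trace (F (S n)) x = doubling (trace (F n)) x) /\
    exists M : R, forall n,
      sup_norm (closure D) (fun z => F n z - g z)%C <= M * omega ^ n.

Definition LL_op (f : C -> C) (p : R) (h : C -> C) (z : C) : C :=
  let l := RtoC (lamC f) in
  (RtoC (/ Rpower (- lamC f) p) *
    (Cpower (- C_derive f (f (l * z))) p * h (l * z) + h (f (l * z))))%C.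

(* Spectral theory on the real space H^r is that of the complexified operator:
   a pair (u, v) stands for u + i v, and [solves] expresses
   (mu - K) (u + i v) = a + i b. *)
Definition solves (D : C -> Prop) (K : (C -> C) -> C -> C) (mu : C)
    (u v a b : C -> C) : Prop :=
  forall z, closure D z ->
    (RtoC (Re mu) * u z - RtoC (Im mu) * v z - K u z)%C = a z /\
    (RtoC (Im mu) * u z + RtoC (Re mu) * v z - K v z)%C = b z.

Definition resolvent_set (D : C -> Prop) (K : (C -> C) -> C -> C) (mu : C)
    : Prop :=
  let N := sup_norm (closure D) in
  exists M : R, forall a b, Hr D a -> Hr D b ->
    exists u v, Hr D u /\ Hr D v /\ solves D K mu u v a b /\
      N u + N v <= M * (N a + N b) /\
      forall u' v', Hr D u' -> Hr D v' -> solves D K mu u' v' a b ->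
        eq_on (closure D) u' u /\ eq_on (closure D) v' v.

Definition spectrum (D : C -> Prop) (K : (C -> C) -> C -> C) (mu : C) : Prop :=
  ~ resolvent_set D K mu.

Definition spectral_radius (D : C -> Prop) (K : (C -> C) -> C -> C) : R :=
  real (Lub_Rbar (fun r => exists mu, spectrum D K mu /\ r = Cmod mu)).

(* Main.v *)
Require Import Defs.
From Stdlib Require Import Reals Lra Lia List.
From Stdlib Require Import Classical ClassicalEpsilon FunctionalExtensionality.
From Coquelicot Require Import Coquelicot.
Import ListNotations.
Open Scope R_scope.

(** Write [l = lam f < 0].  The operator is a weighted composition operator,
    [K_p h = G1 (h o psi1) + G2 (h o psi2)], with branches [psi1 z = l z] and
    [psi2 z = f (l z)] and coefficients whose moduli are the [p]-th powers of
    [w1 z = |f' (f (l z))| / |l|] and [w2 = 1 / |l|].  Both coefficients are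
    positive on the reals, and both branches map [I = [-1, 1]] into itself.  The
    spectral radius is identified with the leading eigenvalue of a positive
    operator, and all inequalities then follow from the maximum principle on
    [I].

    Perturbation.  Closeness of [f] to [g] is used for four facts
    ([near_fixed_point_tame]): both branches map [closure D] well into [D]; the
    powers are defined; [f' < -1] on [[b_f, 1]]; and [f'' < 0] there.  For [g]
    they hold by hypothesis and by concavity, and Cauchy's estimates carry them
    over to [f].

    Distortion.  A map of [D] well into itself contracts the Caratheodory metric
    ([Earle_Hamilton]).  Hence the weights of all words in the two branches have
    uniformly bounded distortion on small discs ([local_distortion]), and, since
    [D] is connected and the branches are compactly contained in it, on all of
    [closure D] ([weight_Harnack]).

    Spectral radius.  By bounded distortion the positive operator with weights
    [w1^p] and [w2^p] has an eigenfunction [h] on [closure D], bounded and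
    bounded away from 0, with some eigenvalue [r > 0] ([transfer_eigenfunction]).
    In the norm [sup |u / h|] the operator [K_p] has norm at most [r], so the
    Neumann series inverts [mu - K_p] for [|mu| > r]; and [(r - K_p) u = 1] has no
    solution that is real on the reals, by looking at the infimum of [u / h].
    Hence [rho_p = r] ([wco_spectral_radius]), although [h] is not claimed to be
    analytic.

    Inequalities.  Let [h_p] be the eigenfunction on [I]; note that
    [w1 x < w1 0 = a] for [x <> 0], and [1 < w2 < w1].  Evaluating at the fixed
    point 0 of [psi1] gives [a^p < rho_p], and comparing with the constant 1 gives
    the upper bound.  Since the weights exceed 1, [rho_p] increases.  Testing the
    exponent [q] on [h_p^(q/p)] shows that [rho_p^(1/p)] decreases.  Hoelder's
    inequality for [h_p^t h_q^(1-t)] gives log-convexity; equality would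
    propagate along the orbit of 0 and contradict [w2 < a] ([eig_log_convex]).
    For [f = g] the multiplier is [a = lam^(-2k)], by comparing leading
    coefficients in the fixed point equation ([fixed_point_multiplier]).

    The underlying complex analysis is developed from the definition by local
    power series: a power series is differentiable, Cauchy's formula on circles
    follows by contracting the circle to a point, and it yields Taylor
    expansions, Cauchy's estimates and the analyticity of uniform limits. *)

(** * Complex differentiability *)

(** Limits along a filter, so that points, pairs of points and sequences share
    one set of rules. *)
Definition tendsto {T} (F : (T -> Prop) -> Prop) (f : T -> C) (l : C) : Prop :=
  forall eps, 0 < eps -> F (fun x => Cmod (f x - l) < eps).

Definition near (z : C) (P : C -> Prop) : Prop :=
  exists del, 0 < del /\ forall w, Cmod (w - z) < del -> P w.

Definition ccont (f : C -> C) (z : C) : Prop := tendsto (near z) f (f z).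

(** Caratheodory's form of differentiability: the difference quotient extends
    continuously.  It turns the differentiation rules into algebra. *)
Definition cderiv (f : C -> C) (z d : C) : Prop :=
  exists q, ccont q z /\ q z = d /\ forall w, f w = (f z + q w * (w - z))%C.

Lemma positive_lower_bound (l : list R) : List.Forall (Rlt 0) l -> exists e, 0 < e /\ List.Forall (Rle e) l.
Proof.
  induction 1 as [|x l Hx _ [e [He H]]]. exists 1; split; [lra|constructor].
  exists (Rmin x e). split; [apply Rmin_pos; auto|]. constructor; [apply Rmin_l|].
  eapply Forall_impl; [|apply H]. intros y Hy. eapply Rle_trans; [apply Rmin_r|exact Hy].
Qed.

Lemma Cmod_sub_sym z w : Cmod (z - w) = Cmod (w - z).
Proof. rewrite <- Cmod_opp; f_equal; ring. Qed.

Lemma Cmod_sub_diag z : Cmod (z - z) = 0.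
Proof. replace (z - z)%C with (RtoC 0) by ring. apply Cmod_0. Qed.

Lemma Csub_neq_0 (w z : C) : w <> z -> (w - z)%C <> RtoC 0.
Proof. intros H E. apply H. transitivity (w - z + z)%C; [ring|rewrite E; ring]. Qed.

Lemma Cmod_sub_trans x y z : Cmod (x - z) <= Cmod (x - y) + Cmod (y - z).
Proof. replace (x - z)%C with ((x - y) + (y - z))%C by ring. apply Cmod_triangle. Qed.

Lemma Cmod_sub_lower x y : Cmod x - Cmod y <= Cmod (x - y).
Proof.
  pose proof (Cmod_triangle (x - y) y). replace (x - y + y)%C with x in H by ring. lra.
Qed.

Lemma Cmod_sub_upper x y : Cmod (x - y) <= Cmod x + Cmod y.
Proof. unfold Cminus. rewrite <- (Cmod_opp y). apply Cmod_triangle. Qed.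

#[global] Instance near_filter z : Filter (near z).
Proof.
  constructor.
  - exists 1; split; [lra|auto].
  - intros P Q [d [Hd K]] [d' [Hd' K']]. exists (Rmin d d'). split; [apply Rmin_pos; auto|].
    intros w Hw. split; [apply K|apply K'].
    eapply Rlt_le_trans; [apply Hw|apply Rmin_l]. eapply Rlt_le_trans; [apply Hw|apply Rmin_r].
  - intros P Q H [d [Hd K]]. exists d; auto.
Qed.

Lemma tendsto_ext {T} F {FF : Filter F} (f g : T -> C) l :
  (forall x, f x = g x) -> tendsto F f l -> tendsto F g l.
Proof. intros E H e He. generalize (H e He). apply filter_imp. intros x; rewrite E; auto. Qed.

Lemma tendsto_const {T} F {FF : Filter F} c : tendsto F (fun _ : T => c) c.
Proof. intros e He. apply filter_forall. intros _. rewrite Cmod_sub_diag; auto. Qed.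

Lemma tendsto_plus {T} F {FF : Filter F} (f g : T -> C) a b :
  tendsto F f a -> tendsto F g b -> tendsto F (fun x => f x + g x)%C (a + b)%C.
Proof.
  intros Hf Hg e He.
  generalize (filter_and (F := F) _ _ (Hf (e/2) ltac:(lra)) (Hg (e/2) ltac:(lra))).
  apply filter_imp. intros x [H1 H2].
  replace (f x + g x - (a + b))%C with ((f x - a) + (g x - b))%C by ring.
  eapply Rle_lt_trans; [apply Cmod_triangle|lra].
Qed.

Lemma tendsto_mult {T} F {FF : Filter F} (f g : T -> C) a b :
  tendsto F f a -> tendsto F g b -> tendsto F (fun x => f x * g x)%C (a * b)%C.
Proof.
  intros Hf Hg e He.
  set (A := Cmod a + 1). set (B := Cmod b + 1).
  assert (HA : 0 < A) by (unfold A; pose proof (Cmod_ge_0 a); lra).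
  assert (HB : 0 < B) by (unfold B; pose proof (Cmod_ge_0 b); lra).
  assert (HeB : 0 < e/(2*B)) by (apply Rdiv_lt_0_compat; lra).
  assert (HeA : 0 < Rmin 1 (e/(2*A))) by (apply Rmin_pos; [lra|apply Rdiv_lt_0_compat; lra]).
  generalize (filter_and (F := F) _ _ (Hf _ HeB) (Hg _ HeA)). apply filter_imp. intros x [H1 H2].
  assert (H3 := Rlt_le_trans _ _ _ H2 (Rmin_l _ _)).
  assert (H4 := Rlt_le_trans _ _ _ H2 (Rmin_r _ _)).
  replace (f x * g x - a * b)%C with ((f x - a) * g x + a * (g x - b))%C by ring.
  eapply Rle_lt_trans; [apply Cmod_triangle|]. rewrite !Cmod_mult.
  assert (Cmod (g x) <= B) by (pose proof (Cmod_sub_lower (g x) b); unfold B; lra).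
  assert (Cmod (f x - a) * Cmod (g x) <= e/2).
  { apply Rle_trans with (e/(2*B) * B).
    apply Rmult_le_compat; try apply Cmod_ge_0; lra. right; field; lra. }
  assert (Cmod a * Cmod (g x - b) < e/2).
  { apply Rle_lt_trans with (Cmod a * (e/(2*A))).
    apply Rmult_le_compat_l; [apply Cmod_ge_0|lra].
    apply Rlt_le_trans with (A * (e/(2*A))). apply Rmult_lt_compat_r.
    apply Rdiv_lt_0_compat; lra. unfold A; lra. right; field; lra. }
  lra.
Qed.

Lemma tendsto_comp {T} F {FF : Filter F} (f : C -> C) (g : T -> C) a :
  tendsto F g a -> ccont f a -> tendsto F (fun x => f (g x)) (f a).
Proof.
  intros Hg Hf e He. destruct (Hf e He) as [d [Hd K]].
  generalize (Hg d Hd). apply filter_imp. auto.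
Qed.

Lemma ccont_const c z : ccont (fun _ => c) z.
Proof. intros e He; exists 1; split; [lra|]. intros. rewrite Cmod_sub_diag; auto. Qed.

Lemma ccont_id z : ccont (fun w => w) z.
Proof. intros e He; exists e; auto. Qed.

Lemma ccont_ext_loc f g z r : 0 < r ->
  (forall w, Cmod (w - z) < r -> f w = g w) -> ccont f z -> ccont g z.
Proof.
  intros Hr E H e He. destruct (H e He) as [d [Hd K]].
  exists (Rmin d r). split; [apply Rmin_pos; auto|]. intros w Hw.
  rewrite <- !E. apply K. eapply Rlt_le_trans; [apply Hw|apply Rmin_l].
  rewrite Cmod_sub_diag; auto.
  eapply Rlt_le_trans; [apply Hw|apply Rmin_r].
Qed.

Lemma ccont_comp f g z : ccont g z -> ccont f (g z) -> ccont (fun w => f (g w)) z.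
Proof. intros Hg Hf. apply (tendsto_comp (near z) f g (g z)); auto. Qed.

Lemma ccont_plus f g z : ccont f z -> ccont g z -> ccont (fun w => f w + g w)%C z.
Proof. apply tendsto_plus, near_filter. Qed.

Lemma ccont_mult f g z : ccont f z -> ccont g z -> ccont (fun w => f w * g w)%C z.
Proof. apply tendsto_mult, near_filter. Qed.

Lemma ccont_inv z : z <> RtoC 0 -> ccont Cinv z.
Proof.
  intros Hz e He. apply Cmod_gt_0 in Hz. set (m := Cmod z) in *.
  exists (Rmin (m/2) (e*m*m/2)). split.
  { apply Rmin_pos; [lra|]. repeat apply Rmult_lt_0_compat; lra. }
  intros w Hw.
  assert (H1 := Rlt_le_trans _ _ _ Hw (Rmin_l _ _)).
  assert (H2 := Rlt_le_trans _ _ _ Hw (Rmin_r _ _)).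
  assert (H3 : m/2 < Cmod w).
  { pose proof (Cmod_sub_lower z w). rewrite Cmod_sub_sym in H. fold m in H. lra. }
  assert (w <> RtoC 0) by (apply Cmod_gt_0; lra).
  assert (z <> RtoC 0) by (apply Cmod_gt_0; fold m; lra).
  replace (/ w - / z)%C with ((z - w) * / (w * z))%C by (field; auto).
  rewrite Cmod_mult, Cmod_inv, Cmod_mult, Cmod_sub_sym by (apply Cmult_neq_0; auto).
  fold m. apply Rmult_lt_reg_r with (Cmod w * m). apply Rmult_lt_0_compat; lra.
  rewrite Rmult_assoc, Rinv_l by (apply Rmult_integral_contrapositive; lra).
  apply Rlt_le_trans with (e*m*m/2). lra.
  replace (e*m*m/2) with (e * ((m/2) * m)) by field.
  apply Rmult_le_compat_l; [lra|]. apply Rmult_le_compat_r; lra.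
Qed.

Lemma ccont_opp f z : ccont f z -> ccont (fun w => - f w)%C z.
Proof.
  intros H. apply ccont_ext_loc with (fun w => (RtoC (-1)) * f w)%C 1; [lra| |].
  intros; ring. apply ccont_mult; auto using ccont_const.
Qed.

Lemma cderiv_cont f z d : cderiv f z d -> ccont f z.
Proof.
  intros [q [Hq [_ E]]].
  apply ccont_ext_loc with (fun w => f z + q w * (w + - z))%C 1; [lra| |].
  { intros; symmetry; apply E. }
  apply ccont_plus; [apply ccont_const|]. apply ccont_mult; auto.
  apply ccont_plus; [apply ccont_id|apply ccont_const].
Qed.

Lemma cderiv_const c z : cderiv (fun _ => c) z (RtoC 0).
Proof. exists (fun _ => RtoC 0). repeat split; [apply ccont_const|]. intros; ring. Qed.

Lemma cderiv_id z : cderiv (fun w => w) z (RtoC 1).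
Proof. exists (fun _ => RtoC 1). repeat split; [apply ccont_const|]. intros; ring. Qed.

Lemma cderiv_plus f g z a b : cderiv f z a -> cderiv g z b ->
  cderiv (fun w => f w + g w)%C z (a + b)%C.
Proof.
  intros [p [Hp [P0 P]]] [q [Hq [Q0 Q]]]. exists (fun w => p w + q w)%C.
  split; [apply ccont_plus; auto|]. split; [congruence|].
  intros w; rewrite (P w), (Q w); ring.
Qed.

Lemma cderiv_mult f g z a b : cderiv f z a -> cderiv g z b ->
  cderiv (fun w => f w * g w)%C z (a * g z + f z * b)%C.
Proof.
  intros Hf [q [Hq [Q0 Q]]]. assert (Cf := cderiv_cont _ _ _ Hf).
  destruct Hf as [p [Hp [P0 P]]]. exists (fun w => p w * g z + f w * q w)%C.
  split. { apply ccont_plus; apply ccont_mult; auto using ccont_const. }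
  split; [congruence|]. intros w; rewrite (Q w), (P w); ring.
Qed.

Lemma cderiv_comp f g z a b : cderiv g z b -> cderiv f (g z) a ->
  cderiv (fun w => f (g w)) z (a * b)%C.
Proof.
  intros Hg [p [Hp [P0 P]]]. assert (Cg := cderiv_cont _ _ _ Hg).
  destruct Hg as [q [Hq [Q0 Q]]]. exists (fun w => p (g w) * q w)%C.
  split. { apply ccont_mult; auto. apply (ccont_comp p g); auto. }
  split; [congruence|]. intros w; rewrite (P (g w)). rewrite (Q w) at 2. ring.
Qed.

Lemma cderiv_inv z : z <> RtoC 0 -> cderiv Cinv z (- / (z * z))%C.
Proof.
  intros Hz.
  exists (fun w => if excluded_middle_informative (w = RtoC 0) then (/ w - / z) * / (w - z) else - / (w * z))%C.
  split.
  { apply ccont_ext_loc with (fun w => - / (w * z))%C (Cmod z). apply Cmod_gt_0; auto.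
    intros w Hw. destruct excluded_middle_informative; auto. subst.
    exfalso. replace (RtoC 0 - z)%C with (- z)%C in Hw by ring. rewrite Cmod_opp in Hw. lra.
    apply ccont_opp. apply (ccont_comp Cinv (fun w => w * z)%C).
    apply ccont_mult; [apply ccont_id|apply ccont_const]. apply ccont_inv.
    apply Cmult_neq_0; auto. }
  split. { destruct excluded_middle_informative; [contradiction|auto]. }
  intros w. destruct excluded_middle_informative.
  - subst. generalize (/ RtoC 0)%C. intros c. field. intro E. apply Hz.
    transitivity (- (RtoC 0 - z))%C; [ring|rewrite E; ring].
  - field; auto.
Qed.

Lemma cderiv_ext_loc f g z d r : 0 < r ->
  (forall w, Cmod (w - z) < r -> f w = g w) -> cderiv f z d -> cderiv g z d.
Proof.
  intros Hr E [q [Hq [Q0 Q]]].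
  assert (Ez : f z = g z) by (apply E; rewrite Cmod_sub_diag; auto).
  exists (fun w => if Rlt_dec (Cmod (w - z)) r then q w else (g w - g z) / (w - z))%C.
  split. { apply ccont_ext_loc with q r; auto. intros w Hw. destruct Rlt_dec; tauto. }
  split. { rewrite Cmod_sub_diag. destruct Rlt_dec; tauto. }
  intros w. destruct Rlt_dec.
  - rewrite <- E, <- Ez; auto.
  - field. intro K. apply n. rewrite K, Cmod_0. auto.
Qed.

Lemma cderiv_eq f z d d' : d = d' -> cderiv f z d -> cderiv f z d'.
Proof. intros ->; auto. Qed.

(** The form in which power series and the exponential are differentiated. *)
Lemma cderiv_intro f z d :
  (forall eps, 0 < eps -> exists del, 0 < del /\ forall w, Cmod (w - z) < del ->
     Cmod (f w - f z - d * (w - z)) <= eps * Cmod (w - z)) -> cderiv f z d.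
Proof.
  intros H.
  exists (fun w => if excluded_middle_informative (w = z) then d else (f w - f z) / (w - z))%C.
  split; [|split].
  - intros e He. destruct (H (e/2)) as [del [Hd K]]; [lra|]. exists del; split; auto.
    intros w Hw. destruct (excluded_middle_informative (z = z)); [|tauto].
    destruct excluded_middle_informative. rewrite Cmod_sub_diag; auto.
    assert (N : (w - z)%C <> RtoC 0).
    { apply Csub_neq_0, n. }
    replace ((f w - f z) / (w - z) - d)%C with ((f w - f z - d * (w - z)) / (w - z))%C by (field; auto).
    rewrite Cmod_div by auto. specialize (K w Hw).
    apply Cmod_gt_0 in N. apply Rle_lt_trans with (e/2); [|lra].
    apply Rmult_le_reg_r with (Cmod (w - z)); auto. unfold Rdiv at 1. rewrite Rmult_assoc, Rinv_l; lra.
  - destruct excluded_middle_informative; tauto.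
  - intros w. destruct excluded_middle_informative. subst; ring.
    field. apply Csub_neq_0, n.
Qed.

(** ** Real and imaginary parts *)

(** Integrals over a real parameter, and the mean value theorem, are only used
    for the two real components of a complex function; quantifying over them
    keeps one proof for both. *)
Definition component (P : C -> R) : Prop := P = Re \/ P = Im.

Lemma component_Re : component Re. Proof. left; auto. Qed.
Lemma component_Im : component Im. Proof. right; auto. Qed.

Lemma component_plus P a b : component P -> P (a + b)%C = P a + P b.
Proof. intros [-> | ->]; reflexivity. Qed.

Lemma component_minus P a b : component P -> P (a - b)%C = P a - P b.
Proof. intros [-> | ->]; reflexivity. Qed.

Lemma component_scal P a (t : R) : component P -> P (RtoC t * a)%C = t * P a.
Proof. intros [-> | ->]; destruct a; unfold Re, Im; simpl; ring. Qed.

Lemma component_le P a : component P -> Rabs (P a) <= Cmod a.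
Proof. intros [-> | ->]; (eapply Rle_trans; [|apply Rmax_Cmod]); [apply Rmax_l|apply Rmax_r]. Qed.

Lemma component_lt P a b e : component P -> Cmod (a - b) < e -> Rabs (P a - P b) < e.
Proof. intros HP H. rewrite <- component_minus by auto. eapply Rle_lt_trans; [apply component_le|]; auto. Qed.

Lemma component_ext a b : (forall P, component P -> P a = P b) -> a = b.
Proof. intros H. apply injective_projections; [apply (H Re component_Re)|apply (H Im component_Im)]. Qed.

Lemma Cmod_le_components z : Cmod z <= Rabs (Re z) + Rabs (Im z).
Proof.
  destruct z as [x y]. unfold Re, Im; simpl.
  replace (x, y) with (RtoC x + Ci * RtoC y)%C by (apply injective_projections; simpl; ring).
  eapply Rle_trans; [apply Cmod_triangle|]. rewrite Cmod_mult, Cmod_Ci, !Cmod_R. lra.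
Qed.

Lemma Cmod_le_2 z M : (forall P, component P -> Rabs (P z) <= M) -> Cmod z <= 2 * M.
Proof.
  intros H. eapply Rle_trans; [apply Cmod_le_components|].
  pose proof (H Re component_Re). pose proof (H Im component_Im). lra.
Qed.

Lemma cderiv_component P f (x : R) d : component P -> cderiv f (RtoC x) d ->
  is_derive (fun s => P (f (RtoC s))) x (P d).
Proof.
  intros HP [q [Hq [<- Q]]]. apply is_derive_Reals. intros e He.
  destruct (Hq e He) as [del [Hd K]]. exists (mkposreal del Hd). simpl. intros h Hh Hhd.
  assert (E : (RtoC (x + h) - RtoC x)%C = RtoC h) by (rewrite RtoC_plus; ring).
  rewrite (Q (RtoC (x + h))), E, component_plus, Cmult_comm, component_scal by auto.
  replace (_ / h - _) with (P (q (RtoC (x + h))) - P (q (RtoC x))) by (field; auto).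
  apply component_lt; auto. apply K. rewrite E, Cmod_R; auto.
Qed.

Lemma ccont_component P f (t : R) : component P -> ccont f (RtoC t) ->
  continuous (fun s => P (f (RtoC s))) t.
Proof.
  intros HP H. apply filterlim_locally. intros eps. destruct (H eps (cond_pos eps)) as [d [Hd K]].
  exists (mkposreal d Hd). intros s Hs. apply component_lt; auto. apply K. rewrite <- RtoC_minus, Cmod_R. auto.
Qed.

Lemma near_locally (z : C) (P : C -> Prop) :
  near z P <-> locally (T := C_UniformSpace) z P.
Proof.
  split.
  - intros [del [Hd K]]. exists (mkposreal (del/2) ltac:(lra)). intros w Hw. apply K.
    apply C_NormedModule_mixin_compat2 in Hw. simpl in Hw.
    eapply Rlt_le_trans. apply Hw.
    assert (sqrt 2 <= 2). { rewrite <- (sqrt_square 2) at 2 by lra. apply sqrt_le_1_alt; lra. }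
    nra.
  - intros [del K]. exists del. split; [apply cond_pos|]. intros w Hw. apply K.
    apply C_NormedModule_mixin_compat1; auto.
Qed.

Lemma cderiv_C_derive f z d : cderiv f z d -> C_derive f z = d.
Proof.
  intros [q [Hq [<- Q]]]. unfold C_derive. apply is_C_lim_unique.
  intros P HP. apply near_locally in HP. destruct HP as [e [He HP]].
  destruct (Hq e He) as [del [Hd K]].
  change (locally (T := C_UniformSpace) z (fun w => w <> z -> P ((f w - f z) / (w - z))%C)).
  apply near_locally. exists del; split; auto. intros w Hw Hn. apply HP.
  rewrite (Q w).
  replace ((f z + q w * (w - z) - f z) / (w - z))%C with (q w). auto.
  field. apply Csub_neq_0, Hn.
Qed.

(** * Power series *)

Fixpoint csum (u : nat -> C) (n : nat) : C :=
  match n with O => RtoC 0 | S n => (csum u n + u n)%C end.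

Definition clim (u : nat -> C) (l : C) : Prop := tendsto eventually u l.

Lemma is_series_clim (u : nat -> C) (l : C) :
  is_series (V := C_NormedModule) u l <-> clim (csum u) l.
Proof.
  assert (E : forall n, sum_n (G := C_AbelianMonoid) u n = csum u (S n)).
  { induction n. rewrite sum_O; simpl. ring.
    rewrite sum_Sn, IHn. reflexivity. }
  split.
  - intros H e He.
    assert (L : locally (T := C_UniformSpace) l (fun w => Cmod (w - l) < e)).
    { apply near_locally. exists e; auto. }
    destruct (H _ L) as [N K]. exists (S N). intros n Hn. destruct n; [lia|].
    rewrite <- E. apply K. lia.
  - intros H P HP. apply near_locally in HP. destruct HP as [e [He HP]].
    destruct (H e He) as [N K]. exists N. intros n Hn. apply HP.
    change (Cmod (sum_n (G := C_AbelianMonoid) u n - l) < e). rewrite E. apply K. lia.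
Qed.

Lemma pow_n_C (x : C) n : pow_n (K := C_Ring) x n = Cpow x n.
Proof. induction n; [reflexivity|]. simpl. rewrite IHn. reflexivity. Qed.

Lemma clim_ext u v l : (forall n, u n = v n) -> clim u l -> clim v l.
Proof. apply (tendsto_ext eventually). Qed.

Lemma csum_ext u v n : (forall k, (k < n)%nat -> u k = v k) -> csum u n = csum v n.
Proof. induction n; simpl; auto. intros H. rewrite IHn, H; auto. Qed.

Lemma is_pseries_clim (a : nat -> C) (x l : C) :
  is_pseries (K := C_AbsRing) (V := C_NormedModule) a x l <->
  clim (csum (fun k => a k * Cpow x k)%C) l.
Proof.
  unfold is_pseries. rewrite is_series_clim.
  assert (E : forall n, csum (fun k => scal (pow_n (K := C_AbsRing) x k) (a k)) n
                 = csum (fun k => a k * Cpow x k)%C n).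
  { intros n. apply csum_ext. intros k _.
    change (pow_n (K := C_Ring) x k * a k = a k * Cpow x k)%C. rewrite pow_n_C. ring. }
  split; apply clim_ext; auto.
Qed.

Lemma clim_le u l M : clim u l -> (exists N, forall n, (N <= n)%nat -> Cmod (u n) <= M) ->
  Cmod l <= M.
Proof.
  intros H [N K]. apply Rnot_lt_le; intros L.
  destruct (H (Cmod l - M)) as [N' K']; [lra|].
  specialize (K (max N N') ltac:(lia)). specialize (K' (max N N') ltac:(lia)).
  pose proof (Cmod_sub_lower l (u (max N N'))). rewrite Cmod_sub_sym in H0. lra.
Qed.

Lemma clim_plus u v l m : clim u l -> clim v m -> clim (fun n => u n + v n)%C (l + m)%C.
Proof. apply (tendsto_plus eventually). Qed.

Lemma clim_scal c u l : clim u l -> clim (fun n => c * u n)%C (c * l)%C.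
Proof. intros H. apply (tendsto_mult eventually); auto. apply tendsto_const, _. Qed.

Lemma clim_shift u l : clim u l <-> clim (fun n => u (S n)) l.
Proof.
  split; intros H e He; destruct (H e He) as [N K].
  - exists N. intros; apply K; lia.
  - exists (S N). intros n Hn. destruct n; [lia|]. apply K; lia.
Qed.

Lemma clim_unique u l m : clim u l -> clim u m -> l = m.
Proof.
  intros H K. destruct (classic (l = m)) as [|N]; auto. exfalso.
  apply Csub_neq_0, Cmod_gt_0 in N.
  assert (L := clim_plus _ _ _ _ H (clim_scal (RtoC (-1)) _ _ K)).
  assert (Cmod (l + RtoC (-1) * m) <= 0).
  { eapply clim_le; [apply L|]. exists 0%nat. intros. replace (u n + RtoC (-1) * u n)%C with (RtoC 0) by ring.
    rewrite Cmod_0; lra. }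
  replace (l + RtoC (-1) * m)%C with (l - m)%C in H0 by ring. lra.
Qed.

Lemma csum_plus u v n : csum (fun k => u k + v k)%C n = (csum u n + csum v n)%C.
Proof. induction n; simpl; [ring|]. rewrite IHn; ring. Qed.

Lemma csum_scal c u n : csum (fun k => c * u k)%C n = (c * csum u n)%C.
Proof. induction n; simpl; [ring|]. rewrite IHn; ring. Qed.

Fixpoint rsum (u : nat -> R) (n : nat) : R :=
  match n with O => 0 | S n => rsum u n + u n end.

Lemma rsum_sum_n u n : sum_n u n = rsum u (S n).
Proof. induction n. rewrite sum_O; symmetry; apply Rplus_0_l. rewrite sum_Sn, IHn; reflexivity. Qed.

Lemma Cmod_csum_le u b n : (forall k, (k < n)%nat -> Cmod (u k) <= b k) ->
  Cmod (csum u n) <= rsum b n.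
Proof.
  induction n; simpl; intros H. rewrite Cmod_0; lra.
  eapply Rle_trans; [apply Cmod_triangle|]. specialize (IHn ltac:(auto)). specialize (H n ltac:(lia)). lra.
Qed.

Lemma clim_abs u (b : nat -> R) : (forall n, Cmod (u n) <= b n) -> ex_series b -> exists l, clim (csum u) l.
Proof.
  intros H E.
  destruct (ex_series_le (K := C_AbsRing) (V := C_CompleteNormedModule) u b) as [l L]; auto.
  exists l. apply is_series_clim. auto.
Qed.

Lemma rsum_bounded (b : nat -> R) : (forall n, 0 <= b n) -> ex_series b -> exists B, forall n, rsum b n <= B.
Proof.
  intros P [l L]. exists l. intros n.
  assert (forall n, rsum b n <= rsum b (S n)) by (intros; simpl; specialize (P n0); lra).
  assert (M : forall n k, rsum b n <= rsum b (n + k)).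
  { intros m k. induction k. rewrite Nat.add_0_r; lra. rewrite Nat.add_succ_r.
    eapply Rle_trans; [apply IHk|auto]. }
  assert (L' : is_lim_seq (fun n => rsum b (S n)) l).
  { eapply is_lim_seq_ext; [apply rsum_sum_n|]. apply L. }
  apply (is_lim_seq_incr_1 (rsum b)), (is_lim_seq_incr_n (rsum b) n) in L'.
  apply (is_lim_seq_le (fun _ => rsum b n) (fun k => rsum b (k + n)) (rsum b n) l); auto.
  { intros k. rewrite Nat.add_comm. apply M. }
  apply is_lim_seq_const.
Qed.

Lemma ex_series_sq_geom q : 0 < q < 1 -> ex_series (fun n => (INR n + 1) ^ 2 * q ^ n).
Proof.
  intros Hq.
  assert (P : forall n, 0 < (INR n + 1) ^ 2 * q ^ n).
  { intros n. pose proof (pos_INR n). apply Rmult_lt_0_compat; apply pow_lt; lra. }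
  eapply ex_series_ext; [|apply (ex_series_DAlembert (fun n => (INR n + 1) ^ 2 * q ^ n) q)].
  - intros n; simpl. apply Rabs_pos_eq. left; apply P.
  - lra.
  - intros n. apply Rgt_not_eq, P.
  - apply is_lim_seq_ext with (fun n => q * ((1 + / (INR n + 1)) * (1 + / (INR n + 1)))).
    { intros n. pose proof (pos_INR n). pose proof (P (S n)). pose proof (P n).
      rewrite Rabs_pos_eq. rewrite S_INR. simpl. field.
      split; [|lra]. apply pow_nonzero; lra.
      left; apply Rdiv_lt_0_compat; auto. }
    replace (Finite q) with (Finite (q * ((1 + 0) * (1 + 0)))) by (f_equal; ring).
    assert (I : is_lim_seq (fun n => / (INR n + 1)) 0).
    { apply is_lim_seq_ext with (fun n => / INR (S n)). intros; rewrite S_INR; auto.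
      apply (is_lim_seq_incr_1 (fun n => / INR n)).
      replace (Finite 0) with (Rbar_inv p_infty) by auto.
      apply is_lim_seq_inv; [apply is_lim_seq_INR|discriminate]. }
    assert (J : is_lim_seq (fun n => 1 + / (INR n + 1)) (1 + 0)).
    { apply is_lim_seq_plus'; [apply is_lim_seq_const|auto]. }
    apply is_lim_seq_mult'; [apply is_lim_seq_const|]. apply is_lim_seq_mult'; auto.
Qed.

Lemma Cmod_RtoC_pos x : 0 <= x -> Cmod (RtoC x) = x.
Proof. intros; rewrite Cmod_R; apply Rabs_pos_eq; auto. Qed.

(** Induction on [n], from
    [w^(n+1) - z^(n+1) - (n+1) z^n (w - z)
     = w (w^n - z^n - n z^(n-1) (w - z)) + n z^(n-1) (w - z)^2].
    The factor [rho^2] stands for the exponent [n - 2] on the right. *)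
Lemma Cpow_taylor rho z w n : 0 <= rho -> Cmod z <= rho -> Cmod w <= rho ->
  rho ^ 2 * Cmod (Cpow w n - Cpow z n - RtoC (INR n) * Cpow z (pred n) * (w - z))
    <= INR n ^ 2 * rho ^ n * Cmod (w - z) ^ 2.
Proof.
  intros Hr Hz Hw. induction n.
  - simpl. replace (RtoC 1 - RtoC 1 - RtoC 0 * RtoC 1 * (w - z))%C with (RtoC 0) by ring.
    rewrite Cmod_0. lra.
  - assert (E : (RtoC (INR n) * (z * Cpow z (pred n)) = RtoC (INR n) * Cpow z n)%C).
    { destruct n; simpl; ring. }
    replace (Cpow w (S n) - Cpow z (S n) - RtoC (INR (S n)) * Cpow z (pred (S n)) * (w - z))%C
      with (w * (Cpow w n - Cpow z n - RtoC (INR n) * Cpow z (pred n) * (w - z))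
            + RtoC (INR n) * Cpow z (pred n) * (w - z) * (w - z))%C.
    2:{ rewrite S_INR, RtoC_plus. simpl pred.
        change (Cpow w (S n)) with (w * Cpow w n)%C. change (Cpow z (S n)) with (z * Cpow z n)%C.
        transitivity (w * Cpow w n - w * Cpow z n - (RtoC (INR n) * (z * Cpow z (pred n))) * (w - z))%C.
        ring. rewrite E. ring. }
    set (A := Cmod (Cpow w n - Cpow z n - RtoC (INR n) * Cpow z (pred n) * (w - z))) in *.
    assert (T : Cmod (w * (Cpow w n - Cpow z n - RtoC (INR n) * Cpow z (pred n) * (w - z))
            + RtoC (INR n) * Cpow z (pred n) * (w - z) * (w - z))%C
            <= rho * A + INR n * Cmod (Cpow z (pred n)) * Cmod (w - z) ^ 2).
    { eapply Rle_trans; [apply Cmod_triangle|]. rewrite !Cmod_mult. fold A.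
      rewrite (Cmod_RtoC_pos (INR n)) by apply pos_INR.
      apply Rplus_le_compat. apply Rmult_le_compat_r; auto. apply Cmod_ge_0. right; ring. }
    assert (S1 : rho ^ 2 * (INR n * Cmod (Cpow z (pred n))) <= INR n * rho ^ S n).
    { destruct n. simpl; lra. change (pred (S n)) with n. rewrite Cmod_pow.
      replace (rho ^ S (S n)) with (rho ^ 2 * rho ^ n) by (simpl; ring).
      assert (Cmod z ^ n <= rho ^ n) by (apply pow_incr; split; [apply Cmod_ge_0|auto]).
      pose proof (pos_INR (S n)). pose proof (pow2_ge_0 rho).
      replace (rho ^ 2 * (INR (S n) * Cmod z ^ n)) with ((INR (S n) * rho ^ 2) * Cmod z ^ n) by ring.
      replace (INR (S n) * (rho ^ 2 * rho ^ n)) with ((INR (S n) * rho ^ 2) * rho ^ n) by ring.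
      apply Rmult_le_compat_l; auto. apply Rmult_le_pos; auto. }
    pose proof (pow2_ge_0 (Cmod (w - z))). set (d2 := Cmod (w - z) ^ 2) in *.
    pose proof (pow2_ge_0 rho). pose proof (pos_INR n). pose proof (pow_le rho (S n) Hr).
    rewrite S_INR.
    apply Rle_trans with (rho ^ 2 * (rho * A + INR n * Cmod (Cpow z (pred n)) * d2)).
    apply Rmult_le_compat_l; auto.
    apply Rle_trans with (rho * (INR n ^ 2 * rho ^ n * d2) + INR n * rho ^ S n * d2).
    { replace (rho ^ 2 * (rho * A + INR n * Cmod (Cpow z (pred n)) * d2)) with
       (rho * (rho ^ 2 * A) + rho ^ 2 * (INR n * Cmod (Cpow z (pred n))) * d2) by ring.
      apply Rplus_le_compat. apply Rmult_le_compat_l; auto. apply Rmult_le_compat_r; auto. }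
    replace (rho * (INR n ^ 2 * rho ^ n * d2) + INR n * rho ^ S n * d2)
      with ((INR n ^ 2 + INR n) * (rho ^ S n * d2)) by (simpl; ring).
    rewrite Rmult_assoc. apply Rmult_le_compat_r. apply Rmult_le_pos; auto. simpl; nra.
Qed.

Definition pser (a : nat -> C) (z0 : C) (r : R) (f : C -> C) : Prop :=
  forall w, Cmod (w - z0) < r -> clim (csum (fun k => a k * Cpow (w - z0) k)%C) (f w).

Lemma analytic_at_C_pser f z0 :
  analytic_at_C f z0 <-> exists a r, 0 < r /\ pser a z0 r f.
Proof.
  split; intros [a [r [Hr H]]]; exists a, r; split; auto; intros w Hw.
  apply is_pseries_clim; auto. apply is_pseries_clim; auto.
Qed.

Lemma clim_bounded u l : clim u l -> exists M, forall n, Cmod (u n) <= M.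
Proof.
  intros H. destruct (H 1) as [N K]; [lra|].
  assert (G : forall N, exists M, forall n, (n < N)%nat -> Cmod (u n) <= M).
  { induction N0. exists 0. intros; lia. destruct IHN0 as [M HM].
    exists (Rmax M (Cmod (u N0))). intros n Hn. destruct (Nat.eq_dec n N0). subst; apply Rmax_r.
    eapply Rle_trans; [apply HM; lia|apply Rmax_l]. }
  destruct (G N) as [M HM]. exists (Rmax M (Cmod l + 1)). intros n.
  destruct (Nat.lt_ge_cases n N). eapply Rle_trans; [apply HM; auto|apply Rmax_l].
  eapply Rle_trans; [|apply Rmax_r]. specialize (K n H0).
  pose proof (Cmod_sub_lower (u n) l). lra.
Qed.

Lemma pser_coeff_bound a z0 r f r1 : pser a z0 r f -> 0 <= r1 < r ->
  exists M, 0 <= M /\ forall n, Cmod (a n) * r1 ^ n <= M.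
Proof.
  intros H Hr. specialize (H (z0 + RtoC r1)%C).
  replace (z0 + RtoC r1 - z0)%C with (RtoC r1) in H by ring.
  rewrite (Cmod_RtoC_pos r1) in H by lra. specialize (H ltac:(lra)).
  destruct (clim_bounded _ _ H) as [M HM]. exists (2 * M). split.
  { specialize (HM 0%nat). simpl in HM. rewrite Cmod_0 in HM. lra. }
  intros n. pose proof (HM n). pose proof (HM (S n)). simpl in H1.
  set (s := csum (fun k : nat => (a k * RtoC r1 ^ k)%C) n) in *.
  replace (Cmod (a n) * r1 ^ n) with (Cmod (a n * Cpow (RtoC r1) n)).
  2:{ rewrite Cmod_mult, Cmod_pow, Cmod_RtoC_pos; lra. }
  replace (a n * Cpow (RtoC r1) n)%C with ((s + a n * Cpow (RtoC r1) n) - s)%C by ring.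
  eapply Rle_trans; [apply Cmod_sub_upper|]. lra.
Qed.

Lemma csum_diff_shift a x n :
  csum (fun k => a k * (RtoC (INR k) * Cpow x (pred k)))%C (S n) =
  csum (fun k => (RtoC (INR (S k)) * a (S k)) * Cpow x k)%C n.
Proof.
  induction n. simpl. ring.
  change (csum (fun k => a k * (RtoC (INR k) * Cpow x (pred k)))%C (S (S n))) with
    (csum (fun k => a k * (RtoC (INR k) * Cpow x (pred k)))%C (S n)
     + a (S n) * (RtoC (INR (S n)) * Cpow x (pred (S n))))%C.
  rewrite IHn. simpl pred.
  change (csum (fun k => RtoC (INR (S k)) * a (S k) * Cpow x k)%C (S n)) with
    (csum (fun k => RtoC (INR (S k)) * a (S k) * Cpow x k)%C n + RtoC (INR (S n)) * a (S n) * Cpow x n)%C.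
  ring.
Qed.

(** The series that dominates the second order remainders of the terms of a
    power series, uniformly on a smaller disc. *)
Lemma sq_series_bounded a z0 r f rho : pser a z0 r f -> 0 < rho < r ->
  exists b : nat -> R, ex_series b /\ (forall n, 0 <= b n) /\
    forall n, (INR n + 1) ^ 2 * Cmod (a n) * rho ^ n <= b n.
Proof.
  intros H Hr. set (r1 := (rho + r) / 2).
  destruct (pser_coeff_bound a z0 r f r1 H) as [M [HM K]]. unfold r1; lra.
  assert (Hr1 : rho < r1) by (unfold r1; lra).
  assert (Q : 0 < rho / r1 < 1).
  { split. apply Rdiv_lt_0_compat; lra. apply Rmult_lt_reg_r with r1; [lra|].
    unfold Rdiv; rewrite Rmult_assoc, Rinv_l; lra. }
  exists (fun n => M * ((INR n + 1) ^ 2 * (rho / r1) ^ n)). split; [|split].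
  - apply ex_series_ext with (fun n => scal M ((INR n + 1) ^ 2 * (rho / r1) ^ n)). reflexivity.
    apply (ex_series_scal (K := R_AbsRing) (V := R_NormedModule)). apply ex_series_sq_geom; auto.
  - intros n. apply Rmult_le_pos; auto. apply Rmult_le_pos. apply pow2_ge_0. apply pow_le; lra.
  - intros n. pose proof (pow2_ge_0 (INR n + 1)).
    replace ((INR n + 1) ^ 2 * Cmod (a n) * rho ^ n) with
      ((INR n + 1) ^ 2 * (rho / r1) ^ n * (Cmod (a n) * r1 ^ n)).
    rewrite (Rmult_comm M). apply Rmult_le_compat_l; auto.
    apply Rmult_le_pos; auto. apply pow_le; lra.
    unfold Rdiv. rewrite Rpow_mult_distr, pow_inv. field. apply pow_nonzero. lra.
Qed.

(** The second order remainders of the terms add up to [O(|w - z|^2)], so that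
    differentiation is termwise. *)
Lemma pser_cderiv a z0 r f : pser a z0 r f ->
  exists f', pser (fun k => RtoC (INR (S k)) * a (S k))%C z0 r f' /\
    forall z, Cmod (z - z0) < r -> cderiv f z (f' z).
Proof.
  intros H.
  assert (EX : forall z, exists l, Cmod (z - z0) < r ->
     clim (csum (fun k => (RtoC (INR (S k)) * a (S k)) * Cpow (z - z0) k)%C) l).
  { intros z. destruct (Rlt_dec (Cmod (z - z0)) r) as [Hz|]; [|exists (RtoC 0); tauto].
    set (rho := (Cmod (z - z0) + r) / 2). pose proof (Cmod_ge_0 (z - z0)).
    destruct (sq_series_bounded a z0 r f rho H) as [b [Eb [Pb Bb]]]. unfold rho; lra.
    assert (Hrho : Cmod (z - z0) < rho) by (unfold rho; lra).
    destruct (clim_abs (fun k => a k * (RtoC (INR k) * Cpow (z - z0) (pred k)))%C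
      (fun n => / rho * b n)) as [l L].
    - intros n. rewrite !Cmod_mult, Cmod_pow, Cmod_RtoC_pos by apply pos_INR.
      apply Rmult_le_reg_l with rho; [lra|].
      replace (rho * (/ rho * b n)) with (b n) by (field; lra).
      eapply Rle_trans; [|apply Bb].
      assert (INR n * (rho * Cmod (z - z0) ^ pred n) <= INR n * rho ^ n).
      { destruct n. simpl; lra. simpl pred. apply Rmult_le_compat_l. apply pos_INR.
        simpl. apply Rmult_le_compat_l; [lra|]. apply pow_incr; lra. }
      pose proof (pos_INR n). pose proof (Cmod_ge_0 (a n)). pose proof (pow_le rho n ltac:(lra)).
      apply Rle_trans with (Cmod (a n) * (INR n * rho ^ n)).
      replace (rho * (Cmod (a n) * (INR n * Cmod (z - z0) ^ pred n))) with
       (Cmod (a n) * (INR n * (rho * Cmod (z - z0) ^ pred n))) by ring.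
      apply Rmult_le_compat_l; auto.
      replace ((INR n + 1) ^ 2 * Cmod (a n) * rho ^ n) with (Cmod (a n) * ((INR n + 1) ^ 2 * rho ^ n)) by ring.
      apply Rmult_le_compat_l; auto. apply Rmult_le_compat_r; auto. simpl; nra.
    - apply (ex_series_scal (K := R_AbsRing) (V := R_NormedModule)); auto.
    - exists l. intros _. apply clim_shift in L. eapply clim_ext; [|apply L].
      intros n; apply csum_diff_shift. }
  set (f' := fun z => proj1_sig (constructive_indefinite_description _ (EX z))).
  assert (Hf' : pser (fun k => RtoC (INR (S k)) * a (S k))%C z0 r f').
  { intros z Hz. unfold f'. destruct (constructive_indefinite_description _ (EX z)); simpl; auto. }
  exists f'. split; auto. intros z Hz. apply cderiv_intro.
  set (rho := (Cmod (z - z0) + r) / 2). pose proof (Cmod_ge_0 (z - z0)).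
  assert (Hrho : Cmod (z - z0) < rho < r) by (unfold rho; lra).
  destruct (sq_series_bounded a z0 r f rho H) as [b [Eb [Pb Bb]]]. lra.
  destruct (rsum_bounded b Pb Eb) as [B HB].
  assert (B0 : 0 <= B) by (specialize (HB 0%nat); simpl in HB; auto).
  assert (EST : forall w, Cmod (w - z0) < rho ->
    Cmod (f w - f z - f' z * (w - z)) <= B / rho ^ 2 * Cmod (w - z) ^ 2).
  { intros w Hw.
    assert (L : clim (fun n => (csum (fun k => a k * Cpow (w - z0) k)%C (S n)
        + RtoC (-1) * csum (fun k => a k * Cpow (z - z0) k)%C (S n)
        + (z - w) * csum (fun k => a k * (RtoC (INR k) * Cpow (z - z0) (pred k)))%C (S n))%C)
        (f w + RtoC (-1) * f z + (z - w) * f' z)%C).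
    { apply clim_plus; [apply clim_plus|].
      apply (clim_shift (csum _)), H; lra.
      apply clim_scal, (clim_shift (csum _)), H; lra.
      apply clim_scal. eapply clim_ext; [|apply Hf'; lra]. intros n; symmetry; apply csum_diff_shift. }
    replace (f w - f z - f' z * (w - z))%C with (f w + RtoC (-1) * f z + (z - w) * f' z)%C by ring.
    eapply clim_le; [apply L|]. exists 0%nat. intros n _.
    rewrite <- !csum_scal, <- !csum_plus.
    apply Rle_trans with (rsum b (S n) * (/ rho ^ 2 * Cmod (w - z) ^ 2)).
    2:{ unfold Rdiv. rewrite Rmult_assoc. apply Rmult_le_compat_r; auto.
        apply Rmult_le_pos; [|apply pow2_ge_0]. left; apply Rinv_0_lt_compat, pow_lt; lra. }
    assert (RS : forall c m, rsum b m * c = rsum (fun k => b k * c) m).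
    { intros c m; induction m; simpl; [ring|]. rewrite <- IHm; ring. }
    rewrite RS. apply Cmod_csum_le. intros k _.
    replace (a k * (w - z0) ^ k + RtoC (-1) * (a k * (z - z0) ^ k) +
       (z - w) * (a k * (RtoC (INR k) * (z - z0) ^ pred k)))%C with
      (a k * (Cpow (w - z0) k - Cpow (z - z0) k - RtoC (INR k) * Cpow (z - z0) (pred k) * ((w - z0) - (z - z0))))%C by ring.
    rewrite Cmod_mult.
    pose proof (Cpow_taylor rho (z - z0) (w - z0) k ltac:(lra) ltac:(lra) ltac:(lra)) as T.
    replace (Cmod (w - z0 - (z - z0))) with (Cmod (w - z)) in T by (f_equal; ring).
    set (X := Cmod ((w - z0) ^ k - (z - z0) ^ k - RtoC (INR k) * (z - z0) ^ pred k * (w - z0 - (z - z0)))) in *.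
    assert (P2 : 0 < rho ^ 2) by (apply pow_lt; lra).
    apply Rmult_le_reg_l with (rho ^ 2); auto.
    replace (rho ^ 2 * (b k * (/ rho ^ 2 * Cmod (w - z) ^ 2))) with (b k * Cmod (w - z) ^ 2) by (field; lra).
    specialize (Bb k). pose proof (pow2_ge_0 (Cmod (w - z))).
    eapply Rle_trans; [|apply Rmult_le_compat_r; [auto|apply Bb]].
    replace (rho ^ 2 * (Cmod (a k) * X)) with (Cmod (a k) * (rho ^ 2 * X)) by ring.
    replace ((INR k + 1) ^ 2 * Cmod (a k) * rho ^ k * Cmod (w - z) ^ 2) with
      (Cmod (a k) * ((INR k + 1) ^ 2 * rho ^ k * Cmod (w - z) ^ 2)) by ring.
    apply Rmult_le_compat_l; [apply Cmod_ge_0|].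
    eapply Rle_trans; [apply T|]. apply Rmult_le_compat_r; auto. apply Rmult_le_compat_r.
    apply pow_le; lra. pose proof (pos_INR k). apply pow_incr; lra. }
  intros eps He.
  assert (P2 : 0 < rho ^ 2) by (apply pow_lt; lra).
  assert (BR : 0 <= B / rho ^ 2) by (apply Rmult_le_pos; [auto|left; apply Rinv_0_lt_compat; auto]).
  exists (Rmin (rho - Cmod (z - z0)) (eps / (B / rho ^ 2 + 1))).
  split. { apply Rmin_pos; [lra|apply Rdiv_lt_0_compat; lra]. }
  intros w Hw.
  assert (W1 := Rlt_le_trans _ _ _ Hw (Rmin_l _ _)).
  assert (W2 := Rlt_le_trans _ _ _ Hw (Rmin_r _ _)).
  eapply Rle_trans; [apply EST|].
  { pose proof (Cmod_sub_trans w z z0). lra. }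
  replace (B / rho ^ 2 * Cmod (w - z) ^ 2) with ((B / rho ^ 2 * Cmod (w - z)) * Cmod (w - z)) by ring.
  apply Rmult_le_compat_r; [apply Cmod_ge_0|].
  apply Rle_trans with ((B / rho ^ 2 + 1) * Cmod (w - z)).
  apply Rmult_le_compat_r; [apply Cmod_ge_0|lra].
  apply Rle_trans with ((B / rho ^ 2 + 1) * (eps / (B / rho ^ 2 + 1))).
  apply Rmult_le_compat_l; lra. right; field. split; [lra|]. nra.
Qed.

(** * The exponential and the circle *)

Definition Cexp (z : C) : C := (RtoC (exp (Re z)) * (cos (Im z), sin (Im z)))%C.

Lemma Cexp_plus z w : Cexp (z + w) = (Cexp z * Cexp w)%C.
Proof.
  destruct z as [a b], w as [c d]. unfold Cexp, Re, Im. simpl.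
  rewrite exp_plus, cos_plus, sin_plus.
  apply injective_projections; simpl; ring.
Qed.

Lemma Cmod_Cexp z : Cmod (Cexp z) = exp (Re z).
Proof.
  unfold Cexp. rewrite Cmod_mult, Cmod_RtoC_pos by (left; apply exp_pos).
  unfold Cmod. simpl fst; simpl snd.
  replace (cos (Im z) ^ 2 + sin (Im z) ^ 2) with 1.
  rewrite sqrt_1; ring. pose proof (sin2_cos2 (Im z)). unfold Rsqr in H. simpl; lra.
Qed.

Lemma derivable_pt_lim_0_bound f l : derivable_pt_lim f 0 l -> forall eps, 0 < eps ->
  exists del, 0 < del /\ forall h, Rabs h < del -> Rabs (f h - f 0 - l * h) <= eps * Rabs h.
Proof.
  intros H e He. destruct (H e He) as [[d Hd] K]. exists d; split; auto. intros h Hh.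
  destruct (Req_dec h 0) as [->|N].
  { replace (f 0 - f 0 - l * 0) with 0 by ring. rewrite Rabs_R0. lra. }
  specialize (K h N Hh). rewrite Rplus_0_l in K.
  replace (f h - f 0 - l * h) with (((f h - f 0) / h - l) * h) by (field; auto).
  rewrite Rabs_mult. apply Rmult_le_compat_r. apply Rabs_pos. lra.
Qed.

Lemma cderiv_Cexp z : cderiv Cexp z (Cexp z).
Proof.
  assert (Z : cderiv Cexp (RtoC 0) (RtoC 1)).
  { apply cderiv_intro. intros e' He'.
    set (e := Rmin 1 (e' / 20)). assert (He : 0 < e) by (apply Rmin_pos; lra).
    assert (e <= 1 /\ e <= e' / 20) by (split; [apply Rmin_l|apply Rmin_r]).
    pose proof (derivable_pt_lim_exp 0) as DE. rewrite exp_0 in DE.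
    pose proof (derivable_pt_lim_sin 0) as DS. rewrite cos_0 in DS.
    destruct (derivable_pt_lim_0_bound _ _ DE e He) as [d1 [D1 K1]].
    destruct (derivable_pt_lim_0_bound _ _ DS e He) as [d2 [D2 K2]].
    destruct (derivable_pt_lim_0_bound _ _ derivable_pt_lim_cos_0 e He) as [d3 [D3 K3]].
    destruct (positive_lower_bound [e; d1; d2; d3]) as [d [Hd Hl]]; [repeat constructor; auto|].
    rewrite !Forall_cons_iff in Hl. exists d. split; auto.
    intros w Hw. replace (w - RtoC 0)%C with w in * by ring.
    pose proof (component_le Re w component_Re) as HR. pose proof (component_le Im w component_Im) as HI.
    destruct w as [x y]. unfold Re, Im in *; simpl fst in *; simpl snd in *.
    specialize (K1 x ltac:(lra)). specialize (K2 y ltac:(lra)). specialize (K3 y ltac:(lra)).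
    rewrite exp_0 in K1. rewrite sin_0 in K2. rewrite cos_0 in K3.
    set (m := Cmod (x, y)) in *.
    replace (exp x - 1 - 1 * x) with (exp x - 1 - x) in K1 by ring.
    replace (sin y - 0 - 1 * y) with (sin y - y) in K2 by ring.
    replace (cos y - 1 - 0 * y) with (cos y - 1) in K3 by ring.
    assert (Hx : 0 <= Rabs x) by apply Rabs_pos. assert (Hy : 0 <= Rabs y) by apply Rabs_pos.
    assert (E1 : Rabs (exp x - 1) <= 2 * Rabs x).
    { replace (exp x - 1) with ((exp x - 1 - x) + x) by ring.
      eapply Rle_trans; [apply Rabs_triang|]. nra. }
    assert (E3 : Rabs (exp x) <= 3).
    { replace (exp x) with ((exp x - 1) + 1) by ring.
      eapply Rle_trans; [apply Rabs_triang|]. rewrite Rabs_R1. lra. }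
    eapply Rle_trans; [apply Cmod_le_components|].
    assert (RE : Rabs (Re (Cexp (x, y) - Cexp (RtoC 0) - RtoC 1 * (x, y))) <= 4 * e * m).
    { unfold Cexp, Re, Im; simpl. rewrite exp_0, cos_0, sin_0.
      replace (_ - _ * _ + - _ + - _) with ((exp x - 1 - x) + exp x * (cos y - 1)) by ring.
      eapply Rle_trans; [apply Rabs_triang|]. rewrite Rabs_mult.
      assert (Rabs (exp x) * Rabs (cos y - 1) <= 3 * (e * Rabs y)).
      { apply Rmult_le_compat; auto; apply Rabs_pos. }
      nra. }
    assert (IM : Rabs (Im (Cexp (x, y) - Cexp (RtoC 0) - RtoC 1 * (x, y))) <= 5 * e * m).
    { unfold Cexp, Re, Im; simpl. rewrite exp_0, cos_0, sin_0.
      replace (exp x * sin y + 0 * cos y + - (1 * 0 + 0 * 1) + - (1 * y + 0 * x))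
         with (exp x * (sin y - y) + (exp x - 1) * y) by ring.
      eapply Rle_trans; [apply Rabs_triang|]. rewrite !Rabs_mult.
      assert (Rabs (exp x) * Rabs (sin y - y) <= 3 * (e * Rabs y)).
      { apply Rmult_le_compat; auto; apply Rabs_pos. }
      assert (Rabs (exp x - 1) * Rabs y <= (2 * e) * Rabs y).
      { apply Rmult_le_compat_r; auto. lra. }
      nra. }
    assert (Hm : 0 <= m) by apply Cmod_ge_0. nra. }
  apply cderiv_ext_loc with (fun w => Cexp z * Cexp (w + - z))%C 1; [lra| |].
  { intros w _. rewrite <- Cexp_plus. f_equal; ring. }
  apply cderiv_eq with (RtoC 0 * Cexp (z + - z) + Cexp z * (RtoC 1 * (RtoC 1 + RtoC 0)))%C; [ring|].
  apply (cderiv_mult (fun _ => Cexp z) (fun w => Cexp (w + - z)%C)); [apply cderiv_const|].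
  apply (cderiv_comp Cexp (fun w => w + - z)%C z (RtoC 1) (RtoC 1 + RtoC 0)%C).
  apply cderiv_plus; [apply cderiv_id|apply cderiv_const].
  replace (z + - z)%C with (RtoC 0) by ring. auto.
Qed.

(** The circle of radius [rho], extended to complex parameters so that the rules
    for complex derivatives apply to its real parameter as well. *)
Definition circ (rho : R) (s : C) : C := (RtoC rho * Cexp (Ci * s))%C.

Lemma cderiv_circ rho s : cderiv (circ rho) s (Ci * circ rho s)%C.
Proof.
  unfold circ.
  apply cderiv_eq with (RtoC 0 * Cexp (Ci * s) + RtoC rho * (Cexp (Ci * s) * (RtoC 0 * s + Ci * RtoC 1)))%C; [ring|].
  apply (cderiv_mult (fun _ => RtoC rho) (fun s => Cexp (Ci * s)%C)); [apply cderiv_const|].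
  apply (cderiv_comp Cexp (fun s => Ci * s)%C); [|apply cderiv_Cexp].
  apply (cderiv_mult (fun _ => Ci) (fun s => s)); [apply cderiv_const|apply cderiv_id].
Qed.

Lemma Cmod_circ rho (t : R) : 0 <= rho -> Cmod (circ rho (RtoC t)) = rho.
Proof.
  intros H. unfold circ. rewrite Cmod_mult, Cmod_RtoC_pos, Cmod_Cexp by auto.
  replace (Re (Ci * RtoC t)) with 0. rewrite exp_0; ring.
  unfold Re; simpl; ring.
Qed.

Lemma circ_periodic rho : circ rho (RtoC 0) = circ rho (RtoC (2 * PI)).
Proof.
  unfold circ, Cexp, Re, Im. simpl.
  replace (0 * 0 - 1 * 0) with 0 by ring. replace (0 * 0 + 1 * 0) with 0 by ring.
  replace (0 * (2 * PI) - 1 * 0) with 0 by ring. replace (0 * 0 + 1 * (2 * PI)) with (2 * PI) by ring.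
  rewrite sin_2PI, cos_2PI, sin_0, cos_0. auto.
Qed.

(** * Cauchy's formula on a circle *)

Definition is_CI (f : R -> C) (l : C) : Prop :=
  forall P, component P -> is_RInt (fun t => P (f t)) 0 (2 * PI) (P l).

Lemma two_PI_pos : 0 < 2 * PI.
Proof. pose proof PI_RGT_0; lra. Qed.

Lemma is_CI_ext f g l : (forall t, f t = g t) -> is_CI f l -> is_CI g l.
Proof. intros E H P HP. eapply is_RInt_ext; [|apply H; auto]. intros; simpl; rewrite E; auto. Qed.

Lemma is_CI_plus f g l m : is_CI f l -> is_CI g m -> is_CI (fun t => f t + g t)%C (l + m)%C.
Proof. intros H K P HP. destruct (HP) as [-> | ->]; exact (is_RInt_plus _ _ _ _ _ _ (H _ HP) (K _ HP)). Qed.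

Lemma is_CI_scal c f l : is_CI f l -> is_CI (fun t => c * f t)%C (c * l)%C.
Proof.
  destruct c as [a b]. intros H P [-> | ->];
    pose proof (H Re component_Re) as HR; pose proof (H Im component_Im) as HI.
  - exact (is_RInt_minus _ _ _ _ _ _ (is_RInt_scal _ _ _ a _ HR) (is_RInt_scal _ _ _ b _ HI)).
  - exact (is_RInt_plus _ _ _ _ _ _ (is_RInt_scal _ _ _ a _ HI) (is_RInt_scal _ _ _ b _ HR)).
Qed.

(** The factor is [4 PI] instead of [2 PI] because the components are estimated
    separately; all later uses need only the order of magnitude. *)
Lemma is_CI_bound f l M : is_CI f l -> (forall t, Cmod (f t) <= M) -> Cmod l <= 4 * PI * M.
Proof.
  intros H B. replace (4 * PI * M) with (2 * ((2 * PI - 0) * M)) by ring. pose proof two_PI_pos.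
  apply Cmod_le_2. intros P HP.
  apply (norm_RInt_le_const (V := R_NormedModule) (fun t => P (f t)) 0 (2 * PI)); auto; [lra|].
  intros; eapply Rle_trans; [apply component_le|]; auto.
Qed.

Lemma is_CI_const c : is_CI (fun _ => c) (RtoC (2 * PI) * c)%C.
Proof.
  intros P HP. rewrite component_scal by auto. replace (2 * PI * P c) with (scal (2 * PI - 0) (P c)).
  apply (is_RInt_const (V := R_NormedModule)). unfold scal; simpl; unfold mult; simpl; ring.
Qed.

Lemma ex_CI f : (forall t : R, ccont f (RtoC t)) -> exists l, is_CI (fun t => f (RtoC t)) l.
Proof.
  intros H.
  exists (RInt (fun t => Re (f (RtoC t))) 0 (2 * PI), RInt (fun t => Im (f (RtoC t))) 0 (2 * PI)).
  intros P HP. assert (K : ex_RInt (fun t => P (f (RtoC t))) 0 (2 * PI)).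
  { apply (ex_RInt_continuous (V := R_CompleteNormedModule)). intros; apply ccont_component; auto. }
  apply (RInt_correct (V := R_CompleteNormedModule)) in K. destruct HP as [-> | ->]; auto.
Qed.

Definition near2 (x y : R) (P : R * R -> Prop) : Prop := locally_2d (fun u v => P (u, v)) x y.

#[global] Instance near2_filter x y : Filter (near2 x y).
Proof.
  constructor.
  - apply locally_2d_forall. auto.
  - intros P Q H K. apply locally_2d_and; auto.
  - intros P Q H K. eapply locally_2d_impl; [|apply K]. apply locally_2d_forall. auto.
Qed.

(** Differentiation under the integral sign: the derivative of the integral of
    [G t] is the integral of the [s]-derivative of the periodic function [H t]. *)
Lemma homotopy_CI (G Gt H : C -> C -> C) d l : 0 < d ->
  (forall t s : R, - d < t < 1 + d -> cderiv (fun u => G u (RtoC s)) (RtoC t) (Gt (RtoC t) (RtoC s))) ->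
  (forall t s : R, - d < t < 1 + d -> tendsto (near2 t s) (fun p => Gt (RtoC (fst p)) (RtoC (snd p))) (Gt (RtoC t) (RtoC s))) ->
  (forall t s : R, - d < t < 1 + d -> cderiv (H (RtoC t)) (RtoC s) (Gt (RtoC t) (RtoC s))) ->
  (forall t s : R, - d < t < 1 + d -> ccont (G (RtoC t)) (RtoC s)) ->
  (forall t : R, - d < t < 1 + d -> H (RtoC t) (RtoC 0) = H (RtoC t) (RtoC (2 * PI))) ->
  is_CI (fun s => G (RtoC 0) (RtoC s)) l -> is_CI (fun s => G (RtoC 1) (RtoC s)) l.
Proof.
  intros Hd DG CGt DH CG PH I0. destruct (ex_CI (G (RtoC 1))) as [m I1].
  { intros t. apply CG. lra. }
  replace l with m; auto. apply component_ext. intros P HP. specialize (I0 P HP). specialize (I1 P HP).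
  set (g := fun t s : R => P (G (RtoC t) (RtoC s))). set (gt := fun t s : R => P (Gt (RtoC t) (RtoC s))).
  assert (Dg : forall t s, - d < t < 1 + d -> is_derive (fun u => g u s) t (gt t s)).
  { intros t s Ht. apply (cderiv_component P (fun u => G u (RtoC s))); auto. }
  assert (Cg : forall t, - d < t < 1 + d -> ex_RInt (g t) 0 (2 * PI)).
  { intros t Ht. apply (ex_RInt_continuous (V := R_CompleteNormedModule)). intros s _.
    apply (ccont_component P (G (RtoC t))); auto. }
  assert (Cgt : forall t s, - d < t < 1 + d -> continuity_2d_pt gt t s).
  { intros t s Ht eps. destruct (CGt t s Ht eps (cond_pos eps)) as [del K]. exists del.
    intros u v Hu Hv. apply component_lt; auto. apply (K u v Hu Hv). }
  rewrite <- (is_RInt_unique (V := R_CompleteNormedModule) _ _ _ _ I0).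
  rewrite <- (is_RInt_unique (V := R_CompleteNormedModule) _ _ _ _ I1). symmetry.
  apply (eq_is_derive (V := R_NormedModule) (fun t => RInt (g t) 0 (2 * PI))); [|lra].
  intros t Ht.
  assert (Loc : locally t (fun u => - d < u < 1 + d)).
  { exists (mkposreal d Hd). intros u Hu. apply Rabs_def2 in Hu. unfold minus, plus, opp in Hu. simpl in Hu. lra. }
  assert (Z : RInt (fun s => Derive (fun u => g u s) t) 0 (2 * PI) = 0).
  { rewrite (RInt_ext _ (gt t)). 2:{ intros s _. apply is_derive_unique, Dg. lra. }
    apply (is_RInt_unique (V := R_CompleteNormedModule)).
    replace 0 with (minus (P (H (RtoC t) (RtoC (2 * PI)))) (P (H (RtoC t) (RtoC 0)))) at 2.
    2:{ rewrite <- PH by lra. unfold minus, plus, opp; simpl; ring. }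
    apply (is_RInt_derive (V := R_CompleteNormedModule) (fun s => P (H (RtoC t) (RtoC s)))); intros s _.
    - apply (cderiv_component P (H (RtoC t))); auto. apply DH. lra.
    - apply filterlim_locally. intros eps. destruct (Cgt t s ltac:(lra) eps) as [del K]. exists del.
      intros v Hv. apply (K t v); auto. rewrite Rminus_diag, Rabs_R0. apply cond_pos. }
  cut (is_derive (fun t => RInt (g t) 0 (2 * PI)) t (RInt (fun s => Derive (fun u => g u s) t) 0 (2 * PI))).
  { rewrite Z. auto. }
  apply is_derive_RInt_param.
  - generalize Loc. apply filter_imp. intros u Hu s _. exists (gt u s). apply Dg; auto.
  - intros s _. apply continuity_2d_pt_ext_loc with gt; [|apply Cgt; lra].
    exists (mkposreal d Hd). intros u v Hu _. apply Rabs_def2 in Hu. simpl in Hu. symmetry.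
    apply is_derive_unique, Dg. lra.
  - generalize Loc. apply filter_imp. auto.
Qed.

Lemma cderiv_div f g z a b : cderiv f z a -> cderiv g z b -> g z <> RtoC 0 ->
  cderiv (fun w => f w / g w)%C z ((a * g z - f z * b) / (g z * g z))%C.
Proof.
  intros Hf Hg N. eapply cderiv_eq.
  2:{ apply (cderiv_mult f (fun w => / g w)%C); [apply Hf|].
      apply (cderiv_comp Cinv g); [apply Hg|apply cderiv_inv; auto]. }
  cbv beta. field. auto.
Qed.

Lemma tendsto_fst t s : tendsto (near2 t s) (fun p => RtoC (fst p)) (RtoC t).
Proof.
  intros e He. exists (mkposreal e He). intros u v Hu _. simpl.
  rewrite <- RtoC_minus, Cmod_R. auto.
Qed.

Lemma tendsto_snd t s : tendsto (near2 t s) (fun p => RtoC (snd p)) (RtoC s).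
Proof.
  intros e He. exists (mkposreal e He). intros u v _ Hv. simpl.
  rewrite <- RtoC_minus, Cmod_R. auto.
Qed.

Lemma tendsto_circ rho t s : tendsto (near2 t s) (fun p => circ rho (RtoC (snd p))) (circ rho (RtoC s)).
Proof.
  apply (tendsto_comp (near2 t s) (circ rho) (fun p => RtoC (snd p))).
  apply tendsto_snd. eapply cderiv_cont, cderiv_circ.
Qed.

Lemma Cmod_mult_R (t : R) z : Cmod (RtoC t * z) = Rabs t * Cmod z.
Proof. rewrite Cmod_mult, Cmod_R. auto. Qed.

(** Moving [c] to the centre of the circle along a segment makes the integrand
    constant. *)
Lemma CI_kernel rho c : Cmod c < rho ->
  is_CI (fun s => circ rho (RtoC s) / (circ rho (RtoC s) - c))%C (RtoC (2 * PI)).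
Proof.
  intros Hc. pose proof (Cmod_ge_0 c).
  set (d := (rho - Cmod c) / (2 * rho)).
  assert (Hd : 0 < d) by (apply Rdiv_lt_0_compat; lra).
  assert (Hd1 : d <= 1 / 2).
  { unfold d. apply Rmult_le_reg_r with (2 * rho); [lra|]. unfold Rdiv. rewrite Rmult_assoc, Rinv_l; lra. }
  assert (NZ : forall t s : R, - d < t < 1 + d -> (circ rho (RtoC s) - RtoC t * c)%C <> RtoC 0).
  { intros t s Ht E.
    assert (Cmod (circ rho (RtoC s) - RtoC t * c) = 0) by (rewrite E; apply Cmod_0).
    pose proof (Cmod_sub_lower (circ rho (RtoC s)) (RtoC t * c)).
    rewrite Cmod_mult_R, Cmod_circ in H1 by lra.
    assert (Rabs t * Cmod c <= (1 + d) * Cmod c).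
    { apply Rmult_le_compat_r; auto. apply Rabs_le. lra. }
    assert (d * Cmod c <= d * rho) by (apply Rmult_le_compat_l; lra).
    assert (d * rho = (rho - Cmod c) / 2) by (unfold d; field; lra). lra. }
  assert (NZ0 : forall s : R, circ rho (RtoC s) <> RtoC 0).
  { intros s. apply Cmod_gt_0. rewrite Cmod_circ; lra. }
  assert (DD : forall u s, cderiv (fun s => circ rho s - u * c)%C s (Ci * circ rho s)%C).
  { intros u s. apply cderiv_eq with (Ci * circ rho s + RtoC 0)%C; [ring|].
    apply (cderiv_plus (circ rho) (fun _ => - (u * c))%C); [apply cderiv_circ|apply cderiv_const]. }
  apply is_CI_ext with (fun s => circ rho (RtoC s) / (circ rho (RtoC s) - RtoC 1 * c))%C.
  { intros t. do 2 f_equal. ring. }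
  apply (homotopy_CI (fun u s => circ rho s / (circ rho s - u * c))%C
    (fun u s => (circ rho s * c) / ((circ rho s - u * c) * (circ rho s - u * c)))%C
    (fun u s => (Ci * c) / (circ rho s - u * c))%C d); auto.
  - intros t s Ht.
    eapply cderiv_eq; [|apply (cderiv_div (fun _ => circ rho (RtoC s)) (fun u => circ rho (RtoC s) - u * c)%C)].
    2: apply cderiv_const.
    2:{ apply (cderiv_plus (fun _ => circ rho (RtoC s)) (fun u => - (u * c))%C); [apply cderiv_const|].
        apply cderiv_ext_loc with (fun u => u * (- c))%C 1; [lra|intros; ring|].
        apply (cderiv_mult (fun u => u) (fun _ => - c)%C); [apply cderiv_id|apply cderiv_const]. }
    2: apply NZ, Ht. cbv beta. field. apply NZ, Ht.
  - intros t s Ht. unfold Cdiv.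
    pose proof (tendsto_circ rho t s) as TC.
    assert (TD : tendsto (near2 t s) (fun p => circ rho (RtoC (snd p)) - RtoC (fst p) * c)%C (circ rho (RtoC s) - RtoC t * c)%C).
    { apply (tendsto_plus (near2 t s)); auto.
      apply (tendsto_comp (near2 t s) Copp (fun p => RtoC (fst p) * c)%C).
      apply (tendsto_mult (near2 t s)); [apply tendsto_fst|apply tendsto_const, _].
      apply (ccont_opp (fun w => w)), ccont_id. }
    apply (tendsto_mult (near2 t s)).
    apply (tendsto_mult (near2 t s)); auto. apply tendsto_const, _.
    apply (tendsto_comp (near2 t s) Cinv). apply (tendsto_mult (near2 t s)); auto.
    apply ccont_inv. apply Cmult_neq_0; apply NZ, Ht.
  - intros t s Ht. eapply cderiv_eq; [|apply (cderiv_div (fun _ => Ci * c)%C (fun s => circ rho s - RtoC t * c)%C)].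
    2: apply cderiv_const. 2: apply DD. 2: apply NZ, Ht.
    cbv beta. replace (RtoC 0 * (circ rho (RtoC s) - RtoC t * c) - Ci * c * (Ci * circ rho (RtoC s)))%C
      with (circ rho (RtoC s) * c)%C. auto.
    replace (Ci * c * (Ci * circ rho (RtoC s)))%C with ((Ci * Ci) * c * circ rho (RtoC s))%C by ring.
    replace (Ci * Ci)%C with (- RtoC 1)%C. ring. apply injective_projections; simpl; ring.
  - intros t s Ht. eapply cderiv_cont. apply (cderiv_div (circ rho) (fun s => circ rho s - RtoC t * c)%C).
    apply cderiv_circ. apply DD. apply NZ, Ht.
  - intros t Ht. rewrite circ_periodic. auto.
  - apply is_CI_ext with (fun _ => RtoC 1).
    { intros s. replace (circ rho (RtoC s) - RtoC 0 * c)%C with (circ rho (RtoC s)) by ring.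
      field. apply NZ0. }
    rewrite <- (Cmult_1_r (RtoC (2 * PI))). apply is_CI_const.
Qed.

Definition holo_disc (F : C -> C) (z0 : C) (r : R) : Prop :=
  forall w, Cmod (w - z0) < r -> cderiv F w (C_derive F w) /\ ccont (C_derive F) w.

(** Contracting the circle to the point [z]: at [t = 0] only the integral of the
    kernel is left. *)
Theorem Cauchy_formula F z0 r rho z : holo_disc F z0 r -> 0 < rho < r -> Cmod (z - z0) < rho ->
  is_CI (fun s => F (z0 + circ rho (RtoC s)) * (circ rho (RtoC s) / (circ rho (RtoC s) - (z - z0))))%C
    (RtoC (2 * PI) * F z)%C.
Proof.
  intros HF Hr Hz. pose proof (Cmod_ge_0 (z - z0)).
  set (d := (r - rho) / (4 * rho)).
  assert (Hd : 0 < d) by (apply Rdiv_lt_0_compat; lra).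
  set (k := fun s => (circ rho s / (circ rho s - (z - z0)))%C).
  set (zeta := fun s => (z0 + circ rho s)%C).
  assert (IN : forall t s : R, - d < t < 1 + d -> Cmod (z + RtoC t * (zeta (RtoC s) - z) - z0) < r).
  { intros t s Ht. unfold zeta.
    replace (z + RtoC t * (z0 + circ rho (RtoC s) - z) - z0)%C with
      (RtoC (1 - t) * (z - z0) + RtoC t * circ rho (RtoC s))%C.
    2:{ rewrite RtoC_minus. ring. }
    eapply Rle_lt_trans; [apply Cmod_triangle|]. rewrite !Cmod_mult_R, Cmod_circ by lra.
    assert (A : Rabs (1 - t) + Rabs t <= 1 + 2 * d).
    { unfold Rabs; destruct (Rcase_abs (1 - t)), (Rcase_abs t); lra. }
    pose proof (Rabs_pos (1 - t)).
    assert (Rabs (1 - t) * Cmod (z - z0) <= Rabs (1 - t) * rho) by (apply Rmult_le_compat_l; lra).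
    assert (d * rho = (r - rho) / 4) by (unfold d; field; lra). nra. }
  assert (NZ : forall s : R, (circ rho (RtoC s) - (z - z0))%C <> RtoC 0).
  { intros s E. assert (Cmod (circ rho (RtoC s) - (z - z0)) = 0) by (rewrite E; apply Cmod_0).
    pose proof (Cmod_sub_lower (circ rho (RtoC s)) (z - z0)). rewrite Cmod_circ in H1; lra. }
  assert (CIn : Ci <> RtoC 0). { apply Cmod_gt_0. rewrite Cmod_Ci; lra. }
  assert (CI2 : (Ci * / Ci)%C = RtoC 1) by (apply Cinv_r; auto).
  assert (Dk : forall s : R, ccont k (RtoC s)).
  { intros s. eapply cderiv_cont. apply (cderiv_div (circ rho) (fun s => circ rho s - (z - z0))%C).
    apply cderiv_circ. apply (cderiv_plus (circ rho) (fun _ => - (z - z0))%C); [apply cderiv_circ|apply cderiv_const].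
    apply NZ. }
  assert (Dz : forall (t : C) (s : C), cderiv (fun s => z + t * (zeta s - z))%C s (t * (Ci * circ rho s))%C).
  { intros t s. unfold zeta. eapply cderiv_eq; [|apply (cderiv_plus (fun _ => z)); [apply cderiv_const|]].
    2:{ apply (cderiv_mult (fun _ => t)); [apply cderiv_const|].
        apply (cderiv_plus (fun s => z0 + circ rho s)%C (fun _ => - z)%C); [|apply cderiv_const].
        apply (cderiv_plus (fun _ => z0)); [apply cderiv_const|apply cderiv_circ]. }
    ring. }
  assert (Du : forall (s t : C), cderiv (fun u => z + u * (zeta s - z))%C t (zeta s - z)%C).
  { intros s t. eapply cderiv_eq; [|apply (cderiv_plus (fun _ => z) (fun u => u * (zeta s - z))%C); [apply cderiv_const|]].
    2:{ apply (cderiv_mult (fun u => u) (fun _ => (zeta s - z)%C)); [apply cderiv_id|apply cderiv_const]. }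
    cbv beta. ring. }
  apply is_CI_ext with (fun s => F (z + RtoC 1 * (zeta (RtoC s) - z)) * k (RtoC s))%C.
  { intros s. unfold k. f_equal. f_equal. unfold zeta. ring. }
  apply (homotopy_CI (fun u s => F (z + u * (zeta s - z)) * k s)%C
    (fun u s => C_derive F (z + u * (zeta s - z)) * circ rho s)%C
    (fun u s => if excluded_middle_informative (u = RtoC 0) then C_derive F z * (circ rho s / Ci)
                else F (z + u * (zeta s - z)) / (Ci * u))%C d); auto.
  - intros t s Ht.
    eapply cderiv_eq; [|apply (cderiv_mult (fun u => F (z + u * (zeta (RtoC s) - z))%C) (fun _ => k (RtoC s)))].
    3: apply cderiv_const.
    2:{ apply (cderiv_comp F (fun u => z + u * (zeta (RtoC s) - z))%C); [apply Du|]. apply HF, IN, Ht. }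
    cbv beta. unfold k, zeta. field. apply NZ.
  - intros t s Ht. apply (tendsto_mult (near2 t s)); [|apply tendsto_circ].
    apply (tendsto_comp (near2 t s) (C_derive F) (fun p => z + RtoC (fst p) * (zeta (RtoC (snd p)) - z))%C).
    2: apply HF, IN, Ht.
    apply (tendsto_plus (near2 t s)); [apply tendsto_const, _|].
    apply (tendsto_mult (near2 t s)); [apply tendsto_fst|].
    apply (tendsto_plus (near2 t s)); [|apply tendsto_const, _].
    apply (tendsto_plus (near2 t s)); [apply tendsto_const, _|apply tendsto_circ].
  - intros t s Ht. destruct (excluded_middle_informative (RtoC t = RtoC 0)) as [E|N].
    + rewrite E. replace (z + RtoC 0 * (zeta (RtoC s) - z))%C with z by ring.
      eapply cderiv_eq; [|apply (cderiv_mult (fun _ => C_derive F z) (fun s => circ rho s / Ci)%C); [apply cderiv_const|]].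
      2:{ apply (cderiv_mult (circ rho) (fun _ => / Ci)%C); [apply cderiv_circ|apply cderiv_const]. }
      cbv beta. field. auto.
    + eapply cderiv_eq.
      2:{ apply (cderiv_mult (fun s => F (z + RtoC t * (zeta s - z))%C) (fun _ => / (Ci * RtoC t))%C); [|apply cderiv_const].
          apply (cderiv_comp F (fun s => z + RtoC t * (zeta s - z))%C); [apply Dz|]. apply HF, IN, Ht. }
      cbv beta. field. auto.
  - intros t s Ht. apply ccont_mult; [|apply Dk].
    apply (ccont_comp F (fun s => z + RtoC t * (zeta s - z))%C). eapply cderiv_cont, Dz.
    eapply cderiv_cont, HF, IN, Ht.
  - intros t Ht. unfold zeta. rewrite circ_periodic. auto.
  - apply is_CI_ext with (fun s => F z * (circ rho (RtoC s) / (circ rho (RtoC s) - (z - z0))))%C.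
    { intros s. unfold k. f_equal. f_equal. ring. }
    replace (RtoC (2 * PI) * F z)%C with (F z * RtoC (2 * PI))%C by ring.
    apply is_CI_scal, CI_kernel. auto.
Qed.

(** ** Consequences of Cauchy's formula *)

Lemma csum_geom x y n : y <> RtoC 0 -> (y - x)%C <> RtoC 0 ->
  (y / (y - x))%C = (csum (Cpow (x / y)) n + Cpow (x / y) n * (y / (y - x)))%C.
Proof.
  intros Hy Hxy. induction n. simpl. ring.
  rewrite IHn at 1. simpl.
  replace (csum (Cpow (x / y)) n + Cpow (x / y) n + x / y * Cpow (x / y) n * (y / (y - x)))%C
   with (csum (Cpow (x / y)) n + Cpow (x / y) n * (RtoC 1 + x / y * (y / (y - x))))%C by ring.
  f_equal. f_equal. field. auto.
Qed.

Lemma is_CI_csum (g : nat -> R -> C) (l : nat -> C) n :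
  (forall k, is_CI (g k) (l k)) -> is_CI (fun s => csum (fun k => g k s) n) (csum l n).
Proof.
  intros H. induction n; simpl.
  - pose proof (is_CI_const (RtoC 0)) as K. rewrite Cmult_0_r in K. exact K.
  - apply (is_CI_plus _ (g n)); auto.
Qed.

Lemma pow_lt_1_small q B eps : 0 <= q < 1 -> 0 < eps -> exists N, forall n, (N <= n)%nat -> B * q ^ n < eps.
Proof.
  intros Hq He. destruct (pow_lt_1_zero q) with (y := eps / (Rabs B + 1)) as [N K].
  rewrite Rabs_pos_eq; lra. pose proof (Rabs_pos B). apply Rdiv_lt_0_compat; lra.
  exists N. intros n Hn. specialize (K n ltac:(lia)).
  pose proof (Rabs_pos B). pose proof (Rle_abs B). pose proof (pow_le q n ltac:(lra)).
  rewrite Rabs_pos_eq in K by auto.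
  apply Rle_lt_trans with ((Rabs B + 1) * q ^ n). apply Rmult_le_compat_r; lra.
  apply Rlt_le_trans with ((Rabs B + 1) * (eps / (Rabs B + 1))).
  apply Rmult_lt_compat_l; lra. right; field; lra.
Qed.

(** Expanding the kernel in a geometric series.  The hypothesis is the formula
    itself because it is the formula that survives uniform limits. *)
Lemma pser_of_Cauchy F z0 rho M : 0 < rho ->
  (forall s : R, ccont F (z0 + circ rho (RtoC s))%C) ->
  (forall s : R, Cmod (F (z0 + circ rho (RtoC s))%C) <= M) ->
  (forall z, Cmod (z - z0) < rho ->
    is_CI (fun s => F (z0 + circ rho (RtoC s)) * (circ rho (RtoC s) / (circ rho (RtoC s) - (z - z0))))%C
    (RtoC (2 * PI) * F z)%C) ->
  exists a, pser a z0 rho F /\ forall n, Cmod (a n) * rho ^ n <= 2 * M.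
Proof.
  intros Hr CF BF HC. pose proof two_PI_pos as P2.
  assert (CN : RtoC (2 * PI) <> RtoC 0). { apply Cmod_gt_0. rewrite Cmod_RtoC_pos; lra. }
  assert (CZ : forall s : R, circ rho (RtoC s) <> RtoC 0).
  { intros s. apply Cmod_gt_0. rewrite Cmod_circ; lra. }
  assert (M0 : 0 <= M). { pose proof (Cmod_ge_0 (F (z0 + circ rho (RtoC 0))%C)). specialize (BF 0). lra. }
  assert (CInv : forall n (s : R), ccont (fun s => Cpow (/ circ rho s) n)%C (RtoC s)).
  { intros n s. induction n. apply (ccont_const (RtoC 1)).
    apply (ccont_mult (fun s => / circ rho s)%C (fun s => Cpow (/ circ rho s) n)%C); auto.
    apply (ccont_comp Cinv (circ rho)). eapply cderiv_cont, cderiv_circ. apply ccont_inv, CZ. }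
  assert (EX : forall n, exists l, is_CI (fun s => F (z0 + circ rho (RtoC s)) * Cpow (/ circ rho (RtoC s)) n)%C (RtoC (2 * PI) * l)%C).
  { intros n. destruct (ex_CI (fun s => F (z0 + circ rho s) * Cpow (/ circ rho s) n)%C) as [l L].
    - intros t. apply ccont_mult; auto. apply (ccont_comp F (fun s => z0 + circ rho s)%C); auto.
      apply ccont_plus; [apply ccont_const|]. eapply cderiv_cont, cderiv_circ.
    - exists (l / RtoC (2 * PI))%C. replace (RtoC (2 * PI) * (l / RtoC (2 * PI)))%C with l by (field; auto). auto. }
  destruct (choice _ EX) as [a Ha]. exists a. split.
  - intros z Hz e He. specialize (HC z Hz).
    set (c := (z - z0)%C) in *. pose proof (Cmod_ge_0 c) as Hc.
    set (q := Cmod c / rho).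
    assert (Hq : 0 <= q < 1).
    { unfold q; split. apply Rmult_le_pos; auto. left; apply Rinv_0_lt_compat; lra.
      apply Rmult_lt_reg_r with rho; auto. unfold Rdiv. rewrite Rmult_assoc, Rinv_l; lra. }
    destruct (pow_lt_1_small q (2 * (M * (rho / (rho - Cmod c)))) e Hq He) as [N K].
    exists N. intros n Hn. eapply Rle_lt_trans; [|apply (K n Hn)].
    assert (NZ : forall s : R, (circ rho (RtoC s) - c)%C <> RtoC 0).
    { intros s E. assert (Cmod (circ rho (RtoC s) - c) = 0) by (rewrite E; apply Cmod_0).
      pose proof (Cmod_sub_lower (circ rho (RtoC s)) c). rewrite Cmod_circ in H0; lra. }
    assert (S : is_CI (fun s => csum (fun k => Cpow c k * (F (z0 + circ rho (RtoC s)) * Cpow (/ circ rho (RtoC s)) k))%C n)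
       (csum (fun k => Cpow c k * (RtoC (2 * PI) * a k))%C n)).
    { apply (is_CI_csum (fun k s => Cpow c k * (F (z0 + circ rho (RtoC s)) * Cpow (/ circ rho (RtoC s)) k))%C).
      intros k. apply is_CI_scal, Ha. }
    assert (D := is_CI_plus _ _ _ _ S (is_CI_scal (RtoC (-1)) _ _ HC)).
    assert (B := fun H => is_CI_bound _ _ (M * (q ^ n * (rho / (rho - Cmod c)))) D H).
    assert (E1 : (csum (fun k => Cpow c k * (RtoC (2 * PI) * a k)) n + RtoC (-1) * (RtoC (2 * PI) * F z))%C =
      (RtoC (2 * PI) * (csum (fun k => a k * Cpow c k) n - F z))%C).
    { rewrite (csum_ext _ (fun k => RtoC (2 * PI) * (a k * Cpow c k))%C) by (intros; ring).
      rewrite csum_scal. ring. }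
    rewrite E1, Cmod_mult_R, Rabs_pos_eq in B by lra.
    apply Rmult_le_reg_l with (2 * PI); auto. eapply Rle_trans; [apply B|right; ring].
    intros s.
    rewrite (csum_ext _ (fun k => F (z0 + circ rho (RtoC s)) * Cpow (c / circ rho (RtoC s)) k)%C).
    2:{ intros k _. unfold Cdiv. rewrite Cpow_mult_l. ring. }
    rewrite csum_scal.
    rewrite (csum_geom c (circ rho (RtoC s)) n) by auto.
    match goal with |- Cmod ?x <= _ => replace x with
      (RtoC (-1) * (F (z0 + circ rho (RtoC s)) * (Cpow (c / circ rho (RtoC s)) n * (circ rho (RtoC s) / (circ rho (RtoC s) - c)))))%C by ring end.
    rewrite !Cmod_mult, Cmod_R, Cmod_pow, !Cmod_div, Cmod_circ by (auto; lra).
    replace (Rabs (-1)) with 1 by (rewrite Rabs_left; lra). rewrite Rmult_1_l. fold q.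
    pose proof (pow_le q n ltac:(lra)).
    assert (Rh : rho / Cmod (circ rho (RtoC s) - c) <= rho / (rho - Cmod c)).
    { apply Rmult_le_compat_l; [lra|]. apply Rinv_le_contravar; [lra|].
      pose proof (Cmod_sub_lower (circ rho (RtoC s)) c). rewrite Cmod_circ in H0; lra. }
    assert (0 <= rho / Cmod (circ rho (RtoC s) - c)).
    { apply Rmult_le_pos; [lra|]. left; apply Rinv_0_lt_compat. apply Cmod_gt_0, NZ. }
    apply Rmult_le_compat; auto. apply Cmod_ge_0. apply Rmult_le_pos; auto. apply Rmult_le_compat_l; auto.
  - intros n. specialize (Ha n). pose proof (is_CI_bound _ _ (M * / rho ^ n) Ha) as B.
    rewrite Cmod_mult_R, Rabs_pos_eq in B by lra.
    assert (Pn : 0 < rho ^ n) by (apply pow_lt; auto).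
    apply Rmult_le_reg_l with (2 * PI * / rho ^ n). apply Rmult_lt_0_compat; auto. apply Rinv_0_lt_compat; auto.
    replace (2 * PI * / rho ^ n * (Cmod (a n) * rho ^ n)) with (2 * PI * Cmod (a n)) by (field; lra).
    eapply Rle_trans; [apply B|right; ring].
    intros s. rewrite Cmod_mult, Cmod_pow, Cmod_inv, Cmod_circ, pow_inv by (auto; lra).
    apply Rmult_le_compat_r; auto. left; apply Rinv_0_lt_compat; auto.
Qed.

Lemma pser_center a z0 r f : 0 < r -> pser a z0 r f -> f z0 = a 0%nat.
Proof.
  intros Hr H. specialize (H z0). rewrite Cmod_sub_diag in H. specialize (H Hr).
  apply clim_shift in H. eapply clim_unique; [apply H|].
  apply (clim_ext (fun _ => a 0%nat)). 2: apply tendsto_const, _.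
  intros n. induction n. simpl; ring.
  change (a 0%nat = csum (fun k => a k * Cpow (z0 - z0) k)%C (S n) + a (S n) * Cpow (z0 - z0) (S n))%C.
  rewrite <- IHn. simpl. ring.
Qed.

Lemma pser_C_derive a z0 r f : pser a z0 r f ->
  pser (fun k => RtoC (INR (S k)) * a (S k))%C z0 r (C_derive f) /\
  forall z, Cmod (z - z0) < r -> cderiv f z (C_derive f z).
Proof.
  intros H. destruct (pser_cderiv a z0 r f H) as [f' [P D]].
  assert (E : forall z, Cmod (z - z0) < r -> C_derive f z = f' z) by (intros; apply cderiv_C_derive; auto).
  split.
  - intros w Hw. rewrite E; auto.
  - intros z Hz. rewrite E; auto.
Qed.

Lemma pser_holo_disc a z0 r f : pser a z0 r f -> holo_disc f z0 r.
Proof.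
  intros H w Hw. destruct (pser_C_derive _ _ _ _ H) as [P D]. split; auto.
  apply pser_C_derive in P. destruct P as [_ D']. eapply cderiv_cont. apply D'; auto.
Qed.

Lemma holo_disc_sub f z r w r' : holo_disc f z r -> Cmod (w - z) + r' <= r -> holo_disc f w r'.
Proof.
  intros H K v Hv. apply H. pose proof (Cmod_sub_trans v w z). lra.
Qed.

Lemma holo_disc_intro f f' z r :
  (forall w, Cmod (w - z) < r -> cderiv f w (f' w) /\ ccont f' w) -> holo_disc f z r.
Proof.
  intros H w Hw.
  assert (E : forall w, Cmod (w - z) < r -> C_derive f w = f' w) by (intros; apply cderiv_C_derive, H; auto).
  split. rewrite E; auto. apply H; auto.
  apply ccont_ext_loc with f' (r - Cmod (w - z)). lra.
  intros v Hv. symmetry. apply E. pose proof (Cmod_sub_trans v w z). lra. apply H; auto.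
Qed.

Lemma Cmod_circ_center z0 rho s : 0 <= rho -> Cmod (z0 + circ rho (RtoC s) - z0) = rho.
Proof. intros. replace (z0 + circ rho (RtoC s) - z0)%C with (circ rho (RtoC s)) by ring. apply Cmod_circ; auto. Qed.

Lemma holo_disc_pser F z0 r rho M : holo_disc F z0 r -> 0 < rho < r ->
  (forall w, Cmod (w - z0) < r -> Cmod (F w) <= M) ->
  exists a, pser a z0 rho F /\ forall n, Cmod (a n) * rho ^ n <= 2 * M.
Proof.
  intros H Hr B. apply pser_of_Cauchy; [lra| | |].
  - intros s. eapply cderiv_cont, H. rewrite Cmod_circ_center; lra.
  - intros s. apply B. rewrite Cmod_circ_center; lra.
  - intros z Hz. apply (Cauchy_formula F z0 r rho z); auto.
Qed.

Lemma Cauchy_estimate F z0 r M : 0 < r -> holo_disc F z0 r ->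
  (forall w, Cmod (w - z0) < r -> Cmod (F w) <= M) -> Cmod (C_derive F z0) <= 4 * M / r.
Proof.
  intros Hr H B. destruct (holo_disc_pser F z0 r (r / 2) M H) as [a [P Ba]]; [lra|auto|].
  apply pser_C_derive in P. destruct P as [P _]. apply pser_center in P; [|lra]. rewrite P.
  specialize (Ba 1%nat). rewrite Cmod_mult. simpl INR. rewrite Cmod_1, Rmult_1_l.
  apply Rmult_le_reg_r with (r / 2); [lra|]. simpl in Ba. rewrite Rmult_1_r in Ba.
  eapply Rle_trans; [apply Ba|right; field; lra].
Qed.

(** The bridge between the definition by power series of unknown radius and
    complex differentiability, which is stable under all operations below. *)
Lemma analytic_holo f z : analytic_at_C f z <-> exists r, 0 < r /\ holo_disc f z r.
Proof.
  rewrite analytic_at_C_pser. split.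
  - intros [a [r [Hr H]]]. exists r. split; auto. apply pser_holo_disc with a; auto.
  - intros [r [Hr H]].
    assert (C0 : ccont f z) by (eapply cderiv_cont, H; rewrite Cmod_sub_diag; auto).
    destruct (C0 1) as [d [Hd K]]; [lra|].
    set (r' := Rmin r d). assert (0 < r') by (apply Rmin_pos; auto).
    assert (r' <= r /\ r' <= d) by (split; [apply Rmin_l|apply Rmin_r]).
    destruct (holo_disc_pser f z r' (r' / 2) (Cmod (f z) + 1)) as [a [P _]].
    + apply holo_disc_sub with z r; auto. rewrite Cmod_sub_diag. lra.
    + lra.
    + intros w Hw. specialize (K w ltac:(lra)). pose proof (Cmod_sub_lower (f w) (f z)). lra.
    + exists a, (r' / 2). split; auto. lra.
Qed.

Lemma holo_disc_analytic f z r w : holo_disc f z r -> Cmod (w - z) < r -> analytic_at_C f w.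
Proof.
  intros H Hw. apply analytic_holo. exists (r - Cmod (w - z)). split; [lra|].
  apply holo_disc_sub with z r; auto. lra.
Qed.

Lemma analytic_cderiv f z : analytic_at_C f z -> cderiv f z (C_derive f z).
Proof. intros H. apply analytic_holo in H. destruct H as [r [Hr H]]. apply H. rewrite Cmod_sub_diag; auto. Qed.

Lemma analytic_ccont f z : analytic_at_C f z -> ccont f z.
Proof. intros H. eapply cderiv_cont, analytic_cderiv, H. Qed.

Lemma analytic_C_derive f z : analytic_at_C f z -> analytic_at_C (C_derive f) z.
Proof.
  rewrite !analytic_at_C_pser. intros [a [r [Hr H]]].
  eexists _, r. split; auto. apply pser_C_derive, H.
Qed.

Lemma analytic_nearby f z : analytic_at_C f z -> near z (fun w => analytic_at_C f w).
Proof.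
  intros H. apply analytic_holo in H. destruct H as [r [Hr H]]. exists r. split; auto.
  intros w Hw. eapply holo_disc_analytic; eauto.
Qed.

Lemma analytic_intro f f' z :
  near z (fun w => cderiv f w (f' w) /\ ccont f' w) -> analytic_at_C f z.
Proof.
  intros [r [Hr H]]. apply analytic_holo. exists r; split; auto. apply holo_disc_intro with f'; auto.
Qed.

Lemma analytic_const c z : analytic_at_C (fun _ => c) z.
Proof.
  apply analytic_intro with (fun _ => RtoC 0). exists 1; split; [lra|]. intros w _.
  split; [apply cderiv_const|apply ccont_const].
Qed.

Lemma analytic_id z : analytic_at_C (fun w => w) z.
Proof.
  apply analytic_intro with (fun _ => RtoC 1). exists 1; split; [lra|]. intros w _.
  split; [apply cderiv_id|apply ccont_const].
Qed.

Lemma analytic_plus f g z : analytic_at_C f z -> analytic_at_C g z ->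
  analytic_at_C (fun w => f w + g w)%C z.
Proof.
  intros Hf Hg. apply analytic_intro with (fun w => C_derive f w + C_derive g w)%C.
  generalize (filter_and (F := near z) _ _ (analytic_nearby _ _ Hf) (analytic_nearby _ _ Hg)).
  apply filter_imp. intros w [F G]. split.
  - apply cderiv_plus; apply analytic_cderiv; auto.
  - apply ccont_plus; apply analytic_ccont, analytic_C_derive; auto.
Qed.

Lemma analytic_mult f g z : analytic_at_C f z -> analytic_at_C g z ->
  analytic_at_C (fun w => f w * g w)%C z.
Proof.
  intros Hf Hg. apply analytic_intro with (fun w => C_derive f w * g w + f w * C_derive g w)%C.
  generalize (filter_and (F := near z) _ _ (analytic_nearby _ _ Hf) (analytic_nearby _ _ Hg)).
  apply filter_imp. intros w [F G]. split.
  - apply cderiv_mult; apply analytic_cderiv; auto.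
  - apply ccont_plus; apply ccont_mult; apply analytic_ccont; auto; apply analytic_C_derive; auto.
Qed.

Lemma analytic_comp f g z : analytic_at_C g z -> analytic_at_C f (g z) ->
  analytic_at_C (fun w => f (g w)) z.
Proof.
  intros Hg Hf. apply analytic_intro with (fun w => C_derive f (g w) * C_derive g w)%C.
  assert (N : near z (fun w => analytic_at_C f (g w))).
  { destruct (analytic_nearby _ _ Hf) as [r [Hr K]].
    destruct (analytic_ccont _ _ Hg r Hr) as [d [Hd K']]. exists d; split; auto. }
  generalize (filter_and (F := near z) _ _ N (analytic_nearby _ _ Hg)).
  apply filter_imp. intros w [F G]. split.
  - apply (cderiv_comp f g); apply analytic_cderiv; auto.
  - apply ccont_mult. apply (ccont_comp (C_derive f) g); apply analytic_ccont; auto. apply analytic_C_derive; auto.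
    apply analytic_ccont, analytic_C_derive; auto.
Qed.

Lemma analytic_scal c f z : analytic_at_C f z -> analytic_at_C (fun w => c * f w)%C z.
Proof. intros; apply (analytic_mult (fun _ => c)); auto using analytic_const. Qed.

Lemma analytic_minus f g z : analytic_at_C f z -> analytic_at_C g z ->
  analytic_at_C (fun w => f w - g w)%C z.
Proof.
  intros Hf Hg. apply (analytic_plus f (fun w => - g w)%C); auto.
  apply (analytic_comp Copp g); auto.
  apply analytic_intro with (fun _ => RtoC (-1)). exists 1; split; [lra|]. intros w _. split; [|apply ccont_const].
  apply cderiv_ext_loc with (fun u => RtoC (-1) * u)%C 1; [lra|intros; ring|].
  apply cderiv_eq with (RtoC 0 * w + RtoC (-1) * RtoC 1)%C; [ring|].
  apply (cderiv_mult (fun _ => RtoC (-1)) (fun u => u)); [apply cderiv_const|apply cderiv_id].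
Qed.

Lemma analytic_ext f g z : near z (fun w => f w = g w) -> analytic_at_C f z -> analytic_at_C g z.
Proof.
  intros [d [Hd E]] H. apply analytic_at_C_pser in H. destruct H as [a [r [Hr H]]].
  apply analytic_at_C_pser. exists a, (Rmin r d). split. apply Rmin_pos; auto.
  intros w Hw. rewrite <- E. apply H. eapply Rlt_le_trans; [apply Hw|apply Rmin_l].
  eapply Rlt_le_trans; [apply Hw|apply Rmin_r].
Qed.

(** Both sides of Cauchy's formula pass to the uniform limit. *)
Lemma analytic_uniform_limit (u : nat -> C -> C) F z0 r M : 0 < r ->
  (forall n, holo_disc (u n) z0 r) -> (forall w, Cmod (w - z0) < r -> Cmod (F w) <= M) ->
  (forall eps, 0 < eps -> exists n, forall w, Cmod (w - z0) < r -> Cmod (u n w - F w) < eps) ->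
  analytic_at_C F z0.
Proof.
  intros Hr H B L.
  assert (CF : forall w, Cmod (w - z0) < r -> ccont F w).
  { intros w Hw e He. destruct (L (e/3)) as [n K]; [lra|].
    assert (Cu : ccont (u n) w) by (eapply cderiv_cont, H; auto).
    destruct (Cu (e/3)) as [d [Hd K']]; [lra|].
    exists (Rmin d (r - Cmod (w - z0))). split. apply Rmin_pos; lra. intros v Hv.
    assert (V1 := Rlt_le_trans _ _ _ Hv (Rmin_l _ _)).
    assert (V2 := Rlt_le_trans _ _ _ Hv (Rmin_r _ _)).
    assert (V3 : Cmod (v - z0) < r) by (pose proof (Cmod_sub_trans v w z0); lra).
    pose proof (K v V3). pose proof (K w Hw). pose proof (K' v V1).
    rewrite Cmod_sub_sym in H0.
    pose proof (Cmod_sub_trans (F v) (u n v) (F w)). pose proof (Cmod_sub_trans (u n v) (u n w) (F w)). lra. }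
  apply analytic_at_C_pser. set (rho := r / 2).
  assert (Hrho : 0 < rho < r) by (unfold rho; lra).
  destruct (pser_of_Cauchy F z0 rho M) as [a [P _]]; [lra| | | |exists a, rho; split; [lra|auto]].
  - intros s. apply CF. rewrite Cmod_circ_center; lra.
  - intros s. apply B. rewrite Cmod_circ_center; lra.
  - intros z Hz. pose proof (Cmod_ge_0 (z - z0)).
    set (k := fun s : R => (circ rho (RtoC s) / (circ rho (RtoC s) - (z - z0)))%C).
    assert (NL : forall s : R, rho - Cmod (z - z0) <= Cmod (circ rho (RtoC s) - (z - z0))).
    { intros s. pose proof (Cmod_sub_lower (circ rho (RtoC s)) (z - z0)). rewrite Cmod_circ in H1; lra. }
    assert (NZ : forall s : R, (circ rho (RtoC s) - (z - z0))%C <> RtoC 0).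
    { intros s. apply Cmod_gt_0. specialize (NL s). lra. }
    set (Bk := rho / (rho - Cmod (z - z0))).
    assert (Bk0 : 0 < Bk) by (apply Rdiv_lt_0_compat; lra).
    assert (Kb : forall s, Cmod (k s) <= Bk).
    { intros s. unfold k. rewrite Cmod_div, Cmod_circ by (auto; lra).
      apply Rmult_le_compat_l; [lra|]. apply Rinv_le_contravar; [lra|auto]. }
    destruct (ex_CI (fun s => F (z0 + circ rho s) * (circ rho s / (circ rho s - (z - z0))))%C) as [l Hl].
    { intros s. apply ccont_mult.
      - apply (ccont_comp F (fun s => z0 + circ rho s)%C). apply ccont_plus; [apply ccont_const|].
        eapply cderiv_cont, cderiv_circ. apply CF. rewrite Cmod_circ_center; lra.
      - eapply cderiv_cont. apply (cderiv_div (circ rho) (fun s => circ rho s - (z - z0))%C).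
        apply cderiv_circ. apply (cderiv_plus (circ rho) (fun _ => - (z - z0))%C); [apply cderiv_circ|apply cderiv_const].
        apply NZ. }
    change (is_CI (fun s => F (z0 + circ rho (RtoC s)) * k s)%C l) in Hl.
    replace (RtoC (2 * PI) * F z)%C with l; auto.
    pose proof two_PI_pos.
    destruct (classic (l = (RtoC (2 * PI) * F z)%C)) as [|N]; auto. exfalso.
    apply Csub_neq_0, Cmod_gt_0 in N. set (D := Cmod (l - RtoC (2 * PI) * F z)) in *.
    set (e := D / (4 * (2 * PI) * (Bk + 1))).
    assert (He : 0 < e). { apply Rdiv_lt_0_compat; auto. apply Rmult_lt_0_compat; lra. }
    destruct (L e He) as [n K].
    assert (Hn := Cauchy_formula (u n) z0 r rho z (H n) Hrho Hz). fold k in Hn.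
    assert (DI := is_CI_plus _ _ _ _ Hl (is_CI_scal (RtoC (-1)) _ _ Hn)).
    apply is_CI_bound with (M := e * Bk) in DI.
    2:{ intros s.
        replace (F (z0 + circ rho (RtoC s)) * k s + RtoC (-1) * (u n (z0 + circ rho (RtoC s)) *
          (circ rho (RtoC s) / (circ rho (RtoC s) - (z - z0)))))%C with
          ((F (z0 + circ rho (RtoC s)) - u n (z0 + circ rho (RtoC s))) * k s)%C by (unfold k; ring).
        rewrite Cmod_mult. apply Rmult_le_compat; try apply Cmod_ge_0; auto.
        rewrite Cmod_sub_sym. left; apply K. rewrite Cmod_circ_center; lra. }
    assert (Kz : Cmod (u n z - F z) < e) by (apply K; lra).
    assert (T : D <= 4 * PI * (e * Bk) + 2 * PI * e).
    { unfold D. replace (l - RtoC (2 * PI) * F z)%C with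
        ((l + RtoC (-1) * (RtoC (2 * PI) * u n z)) + RtoC (2 * PI) * (u n z - F z))%C by ring.
      eapply Rle_trans; [apply Cmod_triangle|]. rewrite (Cmod_mult_R (2 * PI)), Rabs_pos_eq by lra.
      apply Rplus_le_compat; auto. apply Rmult_le_compat_l; lra. }
    assert (DE : D = e * (4 * (2 * PI) * (Bk + 1))).
    { unfold e. field. split; lra. }
    assert (0 < PI * e) by (apply Rmult_lt_0_compat; lra).
    assert (0 < PI * e * Bk) by (apply Rmult_lt_0_compat; lra).
    lra.
Qed.

(** * Powers on the slit plane *)

Definition Clog (z : C) : C := (ln (Cmod z), Carg z).

(** Continuity of real functions on the plane, reduced to that of complex ones. *)
Definition rcont (f : C -> R) (z : C) : Prop := ccont (fun w => RtoC (f w)) z.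

Lemma rcont_elim f z : rcont f z -> forall e, 0 < e -> near z (fun w => Rabs (f w - f z) < e).
Proof. intros H e He. destruct (H e He) as [d [Hd K]]. exists d; split; auto. intros w Hw.
  specialize (K w Hw). rewrite <- RtoC_minus, Cmod_R in K. auto. Qed.

Lemma rcont_intro f z : (forall e, 0 < e -> near z (fun w => Rabs (f w - f z) < e)) -> rcont f z.
Proof. intros H e He. destruct (H e He) as [d [Hd K]]. exists d; split; auto. intros w Hw.
  rewrite <- RtoC_minus, Cmod_R. auto. Qed.

Lemma rcont_comp (phi : R -> R) f z : continuity_pt phi (f z) -> rcont f z -> rcont (fun w => phi (f w)) z.
Proof.
  intros Hp Hf. apply rcont_intro. intros e He. destruct (Hp e He) as [d [Hd K]].
  generalize (rcont_elim _ _ Hf d Hd). apply filter_imp. intros w Hw.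
  destruct (Req_dec (f z) (f w)) as [E|N]. rewrite E, Rminus_diag, Rabs_R0; auto.
  apply (K (f w)). split. split; auto. exact I. apply Hw.
Qed.

Lemma rcont_Cmod f z : ccont f z -> rcont (fun w => Cmod (f w)) z.
Proof.
  intros H. apply rcont_intro. intros e He. generalize (H e He). apply filter_imp. intros w Hw.
  eapply Rle_lt_trans; [|apply Hw]. pose proof (Cmod_sub_lower (f w) (f z)). pose proof (Cmod_sub_lower (f z) (f w)).
  rewrite (Cmod_sub_sym (f z)) in H1. apply Rabs_le. lra.
Qed.

Lemma rcont_component P f z : component P -> ccont f z -> rcont (fun w => P (f w)) z.
Proof.
  intros HP H. apply rcont_intro. intros e He. generalize (H e He). apply filter_imp. intros w Hw.
  apply component_lt; auto.
Qed.

Lemma rcont_plus f g z : rcont f z -> rcont g z -> rcont (fun w => f w + g w) z.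
Proof.
  intros Hf Hg. unfold rcont. apply ccont_ext_loc with (fun w => RtoC (f w) + RtoC (g w))%C 1; [lra| |].
  intros; rewrite RtoC_plus; auto. apply ccont_plus; auto.
Qed.

Lemma rcont_mult f g z : rcont f z -> rcont g z -> rcont (fun w => f w * g w) z.
Proof.
  intros Hf Hg. unfold rcont. apply ccont_ext_loc with (fun w => RtoC (f w) * RtoC (g w))%C 1; [lra| |].
  intros; rewrite RtoC_mult; auto. apply ccont_mult; auto.
Qed.

Lemma rcont_const c z : rcont (fun _ => c) z.
Proof. apply (ccont_const (RtoC c)). Qed.

Lemma ccont_components f z : rcont (fun w => Re (f w)) z -> rcont (fun w => Im (f w)) z -> ccont f z.
Proof.
  intros H K. apply ccont_ext_loc with (fun w => RtoC (Re (f w)) + Ci * RtoC (Im (f w)))%C 1; [lra| |].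
  { intros w _. destruct (f w). apply injective_projections; simpl; ring. }
  apply ccont_plus; auto. apply ccont_mult; auto using ccont_const.
Qed.

Lemma Cmod_sq z : Cmod z * Cmod z = Re z * Re z + Im z * Im z.
Proof. pose proof (Cmod2_alt z). simpl in H. lra. Qed.

Lemma slit_plane_pos z : slit_plane z <-> 0 < Cmod z + Re z.
Proof.
  pose proof (component_le Re z component_Re). pose proof (Cmod_sq z). pose proof (Cmod_ge_0 z).
  assert (- Re z <= Rabs (Re z)) by (rewrite <- Rabs_Ropp; apply Rle_abs).
  split.
  - intros S. destruct (Rle_lt_dec (Cmod z + Re z) 0) as [L|]; auto. exfalso. apply S.
    assert (Cmod z = - Re z) by lra. rewrite H3 in H0. split; [|lra]. nra.
  - intros P [I R0]. rewrite I in H0. assert (Cmod z = - Re z) by nra. lra.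
Qed.

Lemma slit_plane_open z : slit_plane z -> near z slit_plane.
Proof.
  intros S. apply slit_plane_pos in S.
  assert (C0 : rcont (fun w => Cmod w + Re w) z).
  { apply rcont_plus; [apply (rcont_Cmod (fun w => w))|apply (rcont_component Re (fun w => w) _ component_Re)]; apply ccont_id. }
  generalize (rcont_elim _ _ C0 _ S). apply filter_imp. intros w Hw. apply slit_plane_pos.
  apply Rabs_def2 in Hw. lra.
Qed.

Lemma slit_plane_neq_0 z : slit_plane z -> z <> RtoC 0.
Proof. intros S ->. apply S. simpl. unfold Re, Im; simpl. lra. Qed.

(** With [t = tan (Carg z / 2) = y / (m + x)], where [z = x + i y] and [m = |z|],
    one has [cos (atan t) ^ 2 = (m + x) / (2 m)]. *)
Lemma Cexp_Clog z : slit_plane z -> Cexp (Clog z) = z.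
Proof.
  intros S. assert (N := slit_plane_neq_0 z S). apply Cmod_gt_0 in N.
  apply slit_plane_pos in S. unfold Cexp, Clog. pose proof (Cmod_sq z) as Q.
  set (m := Cmod z) in *. change (Re (ln m, Carg z)) with (ln m). change (Im (ln m, Carg z)) with (Carg z).
  rewrite exp_ln by auto. unfold Carg. fold m.
  destruct z as [x y]. unfold Re, Im in *; simpl fst in *; simpl snd in *.
  set (s := m + x) in *. set (t := y / s).
  assert (T : 0 < 1 + t * t) by nra.
  assert (TC : cos (atan t) <> 0) by (pose proof (atan_bound t); apply Rgt_not_eq, cos_gt_0; lra).
  pose proof (sin2_cos2 (atan t)) as SC. unfold Rsqr in SC.
  pose proof (tan_atan t) as TT. unfold tan in TT.
  assert (SE : sin (atan t) = t * cos (atan t)) by (rewrite <- TT at 2; field; auto).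
  rewrite cos_2a_cos, sin_2a, SE.
  set (c := cos (atan t)) in *. rewrite SE in SC.
  assert (CC : c * c = s / (2 * m)).
  { assert (c * c * (1 + t * t) = 1) by lra.
    assert (1 + t * t = 2 * m / s).
    { unfold t. apply Rmult_eq_reg_r with (s * s); [|nra]. field_simplify; [|lra|lra].
      unfold s in *. nra. }
    rewrite H0 in H. apply Rmult_eq_reg_r with (2 * m / s). rewrite H. field; split; lra.
    apply Rgt_not_eq, Rdiv_lt_0_compat; lra. }
  apply injective_projections; simpl.
  - replace (m * (2 * c * c - 1) - 0 * (2 * (t * c) * c)) with (m * (2 * (c * c) - 1)) by ring.
    rewrite CC. unfold s. field. lra.
  - replace (m * (2 * (t * c) * c) + 0 * (2 * c * c - 1)) with (m * (2 * t * (c * c))) by ring.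
    rewrite CC. unfold t. field. split; lra.
Qed.

Lemma ccont_Clog z : slit_plane z -> ccont Clog z.
Proof.
  intros S. assert (N := slit_plane_neq_0 z S). apply Cmod_gt_0 in N. apply slit_plane_pos in S.
  assert (CM : rcont Cmod z) by (apply (rcont_Cmod (fun w => w)), ccont_id).
  apply ccont_components.
  - apply (rcont_comp ln Cmod); auto. apply derivable_continuous_pt. exists (/ Cmod z). apply derivable_pt_lim_ln. auto.
  - unfold Clog, Carg, Im. simpl. apply rcont_mult; [apply rcont_const|].
    apply (rcont_comp atan (fun w => snd w / (Cmod w + Re w))).
    apply derivable_continuous_pt, derivable_pt_atan.
    unfold Rdiv. apply rcont_mult. apply (rcont_component Im (fun w => w) _ component_Im), ccont_id.
    apply (rcont_comp Rinv (fun w => Cmod w + Re w)).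
    apply (continuity_pt_inv (fun x => x)). apply derivable_continuous_pt, derivable_pt_id. lra.
    apply rcont_plus; auto. apply (rcont_component Re (fun w => w) _ component_Re), ccont_id.
Qed.

(** [Clog] is a continuous right inverse of [Cexp]: invert the difference
    quotient of [Cexp]. *)
Lemma cderiv_Clog z : slit_plane z -> cderiv Clog z (/ z)%C.
Proof.
  intros S. assert (N := slit_plane_neq_0 z S).
  destruct (cderiv_Cexp (Clog z)) as [q [Cq [Q0 Q]]]. rewrite Cexp_Clog in Q0 by auto.
  assert (CL := ccont_Clog z S).
  assert (Cqq : ccont (fun w => q (Clog w)) z) by (apply (ccont_comp q Clog); auto).
  assert (NQ : near z (fun w => q (Clog w) <> RtoC 0)).
  { apply Cmod_gt_0 in N. rewrite <- Q0 in N.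
    generalize (rcont_elim _ _ (rcont_Cmod _ _ Cqq) _ N). apply filter_imp. intros w Hw.
    apply Cmod_gt_0. apply Rabs_def2 in Hw. lra. }
  destruct (filter_and (F := near z) _ _ NQ (slit_plane_open z S)) as [d [Hd K]].
  apply cderiv_ext_loc with (fun w => Clog z + / q (Clog w) * (w - z))%C d; auto.
  { intros w Hw. destruct (K w Hw) as [K1 K2]. specialize (Q (Clog w)).
    rewrite !Cexp_Clog in Q by auto. rewrite Q at 2. field. auto. }
  exists (fun w => / q (Clog w))%C. split; [|split].
  - apply (ccont_comp Cinv (fun w => q (Clog w))); auto. rewrite Q0. apply ccont_inv; auto.
  - rewrite Q0; auto.
  - intros w. ring.
Qed.

Lemma analytic_Clog z : slit_plane z -> analytic_at_C Clog z.
Proof.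
  intros S. apply analytic_intro with Cinv. generalize (slit_plane_open z S). apply filter_imp.
  intros w Hw. split; [apply cderiv_Clog; auto|apply ccont_inv, slit_plane_neq_0; auto].
Qed.

Lemma analytic_Cexp z : analytic_at_C Cexp z.
Proof.
  apply analytic_intro with Cexp. exists 1; split; [lra|]. intros w _.
  split; [apply cderiv_Cexp|eapply cderiv_cont, cderiv_Cexp].
Qed.

Lemma Cpower_Cexp z p : Cpower z p = Cexp (RtoC p * Clog z)%C.
Proof.
  unfold Cpower, Cexp, Clog, Rpower, Re, Im. simpl.
  replace (p * ln (Cmod z) - 0 * Carg z) with (p * ln (Cmod z)) by ring.
  replace (p * Carg z + 0 * ln (Cmod z)) with (p * Carg z) by ring. auto.
Qed.

Lemma analytic_Cpower z p : slit_plane z -> analytic_at_C (fun w => Cpower w p) z.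
Proof.
  intros S. apply analytic_ext with (fun w => Cexp (RtoC p * Clog w)%C).
  { exists 1; split; [lra|]. intros; rewrite Cpower_Cexp; auto. }
  apply (analytic_comp Cexp (fun w => RtoC p * Clog w)%C); [|apply analytic_Cexp].
  apply analytic_scal, analytic_Clog; auto.
Qed.

Lemma Cmod_Cpower z p : Cmod (Cpower z p) = Rpower (Cmod z) p.
Proof.
  rewrite Cpower_Cexp, Cmod_Cexp. unfold Rpower. f_equal. unfold Re; simpl. ring.
Qed.

Lemma Cpower_R x p : 0 < x -> Cpower (RtoC x) p = RtoC (Rpower x p).
Proof.
  intros Hx. unfold Cpower, Carg. rewrite Cmod_RtoC_pos by lra. unfold Re, Im; simpl.
  replace (0 / (x + x)) with 0 by (field; lra). rewrite atan_0.
  replace (p * (2 * 0)) with 0 by ring. rewrite cos_0, sin_0.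
  apply injective_projections; simpl; ring.
Qed.

(** * Compactness *)

Lemma closure_incl A z : A z -> closure A z.
Proof. intros H e He. exists z. rewrite Cmod_sub_diag. auto. Qed.

Lemma closure_closure A z : closure (closure A) z -> closure A z.
Proof.
  intros H e He. destruct (H (e/2)) as [w [Hw K]]; [lra|]. destruct (Hw (e/2)) as [v [Hv K']]; [lra|].
  exists v. split; auto. pose proof (Cmod_sub_trans v w z). lra.
Qed.

Lemma bounded_closure A : bounded_set A -> bounded_set (closure A).
Proof.
  intros [M H]. exists (M + 1). intros z Hz. destruct (Hz 1) as [w [Hw K]]; [lra|].
  specialize (H w Hw). pose proof (Cmod_sub_lower z w). rewrite Cmod_sub_sym in H0. lra.
Qed.

(** A bounded closed set in the form in which compactness is used below: data
    chosen at each point may be chosen with a uniform radius. *)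
Lemma compact_uniform (A : C -> Prop) (P : C -> R -> Prop) :
  bounded_set A -> (forall z, closure A z -> A z) ->
  (forall u, A u -> exists del, 0 < del /\ P u del) ->
  exists d, 0 < d /\ forall z, A z -> exists u del, A u /\ P u del /\ d <= del /\ Cmod (z - u) < del.
Proof.
  intros [M HM] HC HP.
  assert (G : forall p : R * R, exists del : posreal,
    (A p -> P p (2 * del)) /\ (~ A p -> forall z, A z -> 2 * del <= Cmod (z - p))).
  { intros p. destruct (classic (A p)) as [Ap|Ap].
    - destruct (HP p Ap) as [del [Hd K]]. exists (mkposreal (del/2) ltac:(lra)). split; [|tauto].
      intros _. simpl. replace (2 * (del/2)) with del by field. auto.
    - assert (N : ~ closure A p) by auto. unfold closure in N. apply not_all_ex_not in N. destruct N as [e N].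
      apply imply_to_and in N. destruct N as [He N]. exists (mkposreal (e/2) ltac:(lra)). split; [tauto|].
      intros _ z Hz. simpl. replace (2 * (e/2)) with e by field. apply Rnot_lt_le. intros L. apply N.
      exists z; auto. }
  destruct (choice _ G) as [g Hg].
  destruct (compactness_value_2d (- M) M (- M) M (fun u v => g (u, v))) as [d Hd].
  exists d. split; [apply cond_pos|]. intros z Hz.
  apply NNPP. intros N.
  assert (Z := HM z Hz). pose proof (component_le Re z component_Re) as Z1. pose proof (component_le Im z component_Im) as Z2.
  apply (Hd (Re z) (Im z)). apply Rabs_le_between; lra. apply Rabs_le_between; lra.
  intros [u [v [_ [_ [H1 [H2 H3]]]]]]. destruct (Hg (u, v)) as [K1 K2].
  assert (L : Cmod (z - (u, v)) < 2 * g (u, v)).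
  { eapply Rle_lt_trans; [apply Cmod_le_components|]. destruct z as [x y]. unfold Re, Im in *; simpl in *.
    unfold Rminus in *. lra. }
  destruct (classic (A (u, v))) as [Au|Au].
  - apply N. exists (u, v), (2 * g (u, v)). repeat split; auto.
    pose proof (cond_pos (g (u, v))). lra.
  - specialize (K2 Au z Hz). lra.
Qed.

Lemma Rle_inv_swap a b : 0 < a -> 0 < b -> a <= / b -> b <= / a.
Proof.
  intros Ha Hb H. apply Rmult_le_reg_l with a; auto. rewrite Rinv_r by lra.
  apply Rle_trans with (/ b * b). apply Rmult_le_compat_r; lra. rewrite Rinv_l; lra.
Qed.

Lemma compact_bound (A : C -> Prop) (f : C -> R) : bounded_set A -> (forall z, closure A z -> A z) ->
  (forall u, A u -> exists B, near u (fun z => A z -> f z <= B)) -> exists B, forall z, A z -> f z <= B.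
Proof.
  intros HB HC H.
  destruct (compact_uniform A (fun u del => forall z, A z -> Cmod (z - u) < del -> f z <= / del)) as [d [Hd K]]; auto.
  - intros u Au. destruct (H u Au) as [B [r [Hr K]]]. exists (Rmin r (/ (Rabs B + 1))).
    assert (P : 0 < Rabs B + 1) by (pose proof (Rabs_pos B); lra).
    assert (Q : 0 < Rmin r (/ (Rabs B + 1))) by (apply Rmin_pos; auto; apply Rinv_0_lt_compat; auto).
    split; auto. intros z Az Hz.
    apply Rle_trans with (Rabs B + 1). pose proof (Rle_abs B). assert (f z <= B). apply K; auto.
    eapply Rlt_le_trans; [apply Hz|apply Rmin_l]. lra.
    apply Rle_inv_swap; auto. apply Rmin_r.
  - exists (/ d). intros z Az. destruct (K z Az) as [u [del [Au [Pu [Hdel Hz]]]]].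
    eapply Rle_trans; [apply Pu; auto|]. apply Rinv_le_contravar; auto.
Qed.

Lemma compact_cont_bound (A : C -> Prop) (f : C -> C) : bounded_set A -> (forall z, closure A z -> A z) ->
  (forall z, A z -> ccont f z) -> exists B, forall z, A z -> Cmod (f z) <= B.
Proof.
  intros HB HC H. apply compact_bound; auto. intros u Au. exists (Cmod (f u) + 1).
  generalize (H u Au 1 ltac:(lra)). apply filter_imp. intros z Hz _. pose proof (Cmod_sub_lower (f z) (f u)). lra.
Qed.

Lemma compact_cont_lower (A : C -> Prop) (f : C -> C) : bounded_set A -> (forall z, closure A z -> A z) ->
  (forall z, A z -> ccont f z) -> (forall z, A z -> f z <> RtoC 0) -> exists b, 0 < b /\ forall z, A z -> b <= Cmod (f z).
Proof.
  intros HB HC H N. destruct (compact_cont_bound A (fun z => / f z)%C) as [B K]; auto.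
  { intros z Az. apply (ccont_comp Cinv f); auto. apply ccont_inv; auto. }
  assert (P : 0 < Rabs B + 1) by (pose proof (Rabs_pos B); lra).
  exists (/ (Rabs B + 1)). split. apply Rinv_0_lt_compat; auto. intros z Az.
  assert (NZ := N z Az). apply Cmod_gt_0 in NZ. specialize (K z Az). rewrite Cmod_inv in K by auto.
  rewrite <- (Rinv_inv (Cmod (f z))). apply Rinv_le_contravar.
  apply Rinv_0_lt_compat; auto. pose proof (Rle_abs B). lra.
Qed.

(** * Contraction of the branches and bounded distortion *)

(** Words act from the left, so that a prefix of a word is applied first:
    [psiw psi (b :: v) = psiw psi v o psi b]. *)
Fixpoint psiw (psi : bool -> C -> C) (v : list bool) (z : C) : C :=
  match v with nil => z | b :: v => psiw psi v (psi b z) end.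

Fixpoint weight (psi F : bool -> C -> C) (v : list bool) (z : C) : R :=
  match v with nil => 1 | b :: v => Cmod (F b z) * weight psi F v (psi b z) end.

Definition maps_inside (D : C -> Prop) (psi : C -> C) : Prop :=
  exists eta, 0 < eta /\ forall z w, closure D z -> Cmod (w - psi z) < eta -> D w.

(** The branches map [closure D] well into [D]; their weights are [|F b|]. *)
Definition ifs (D : C -> Prop) (psi F : bool -> C -> C) : Prop :=
  (forall b z, closure D z -> analytic_at_C (psi b) z) /\
  (forall b, maps_inside D (psi b)) /\
  (forall b z, closure D z -> analytic_at_C (F b) z /\ F b z <> RtoC 0).

Lemma maps_inside_in D psi z : maps_inside D psi -> closure D z -> D (psi z).
Proof. intros [e [He K]] Hz. apply (K z); auto. rewrite Cmod_sub_diag; auto. Qed.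

Lemma psiw_app psi u v z : psiw psi (u ++ v) z = psiw psi v (psiw psi u z).
Proof. revert z. induction u; simpl; auto. Qed.

Lemma psiw_in D psi F v z : ifs D psi F -> D z -> D (psiw psi v z).
Proof.
  intros [_ [H _]]. revert z. induction v; simpl; auto. intros z Hz. apply IHv.
  apply maps_inside_in; auto. apply closure_incl; auto.
Qed.

Lemma psiw_in_closure D psi F v z : ifs D psi F -> closure D z -> closure D (psiw psi v z).
Proof.
  intros HI Hz. destruct v; auto. simpl. apply closure_incl. eapply psiw_in; eauto.
  apply maps_inside_in; auto. apply HI.
Qed.

Lemma psiw_analytic D psi F v z : ifs D psi F -> D z -> analytic_at_C (psiw psi v) z.
Proof.
  intros HI. revert z. induction v; simpl; intros z Hz. apply analytic_id.
  apply (analytic_comp (psiw psi v) (psi a)). apply HI, closure_incl, Hz.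
  apply IHv. apply maps_inside_in; auto. apply HI. apply closure_incl; auto.
Qed.

Lemma weight_pos D psi F v z : ifs D psi F -> closure D z -> 0 < weight psi F v z.
Proof.
  intros HI. revert z. induction v; simpl; intros z Hz. lra.
  apply Rmult_lt_0_compat. apply Cmod_gt_0, HI, Hz. apply IHv.
  apply (psiw_in_closure D psi F (a :: nil)); auto.
Qed.

Lemma weight_app psi F u v z : weight psi F (u ++ v) z = weight psi F u z * weight psi F v (psiw psi u z).
Proof. revert z. induction u; simpl; intros z. ring. rewrite IHu. ring. Qed.

Definition unit_ball_on (D : C -> Prop) (G : C -> C) : Prop :=
  analytic_on D G /\ forall w, D w -> Cmod (G w) <= 1.

(** The estimate of Earle and Hamilton for the Caratheodory metric: a map
    [psi] of [D] well inside itself can be replaced by the map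
    [w |-> psi w + del (psi w - psi z)], which still maps [D] into itself and
    has the derivative of [psi] at [z] multiplied by [1 + del]. *)
Lemma Earle_Hamilton_step D psi : open D -> bounded_set D -> maps_inside D psi ->
  (forall z, closure D z -> analytic_at_C psi z) ->
  exists del, 0 < del /\ forall z m, D z ->
    (forall G, unit_ball_on D G -> Cmod (C_derive G z) <= m) ->
    forall G, unit_ball_on D G -> (1 + del) * (Cmod (C_derive G (psi z)) * Cmod (C_derive psi z)) <= m.
Proof.
  intros OD [M HM] MI AN. assert (MI' := MI). destruct MI' as [eta [He MI']].
  set (M' := Rabs M + 1). assert (HM' : 0 < M') by (unfold M'; pose proof (Rabs_pos M); lra).
  set (del := eta / (4 * M')). assert (Hdel : 0 < del) by (apply Rdiv_lt_0_compat; lra).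
  exists del. split; auto. intros z m Dz Hm G [GA GB].
  set (psi' := fun w => (psi w + RtoC del * (psi w - psi z))%C).
  assert (IN : forall w, D w -> D (psi' w)).
  { intros w Dw. apply (MI' w). apply closure_incl; auto. unfold psi'.
    replace (psi w + RtoC del * (psi w - psi z) - psi w)%C with (RtoC del * (psi w - psi z))%C by ring.
    rewrite Cmod_mult_R, Rabs_pos_eq by lra.
    assert (Cmod (psi w - psi z) <= 2 * M').
    { assert (D (psi w)) by (apply maps_inside_in; auto; apply closure_incl; auto).
      assert (D (psi z)) by (apply maps_inside_in; auto; apply closure_incl; auto).
      pose proof (Cmod_sub_upper (psi w) (psi z)). pose proof (HM _ H). pose proof (HM _ H0).
      unfold M'. pose proof (Rle_abs M). lra. }
    apply Rle_lt_trans with (del * (2 * M')). apply Rmult_le_compat_l; lra.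
    unfold del. replace (eta / (4 * M') * (2 * M')) with (eta / 2) by (field; lra). lra. }
  assert (AP : forall w, D w -> analytic_at_C psi' w).
  { intros w Dw. apply analytic_plus. apply AN, closure_incl, Dw. apply analytic_scal.
    apply analytic_minus. apply AN, closure_incl, Dw. apply analytic_const. }
  assert (UB : unit_ball_on D (fun w => G (psi' w))).
  { split; auto. intros w Dw. apply (analytic_comp G psi'); auto. }
  specialize (Hm _ UB).
  assert (PZ : psi' z = psi z) by (unfold psi'; ring).
  assert (DP : cderiv psi' z (RtoC (1 + del) * C_derive psi z)%C).
  { assert (DZ : cderiv psi z (C_derive psi z)) by apply analytic_cderiv, AN, closure_incl, Dz.
    apply cderiv_eq with (C_derive psi z + (RtoC 0 * (psi z - psi z) + RtoC del * (C_derive psi z + RtoC 0)))%C.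
    rewrite RtoC_plus; ring.
    apply (cderiv_plus psi (fun w => RtoC del * (psi w - psi z))%C); auto.
    apply (cderiv_mult (fun _ => RtoC del) (fun w => psi w - psi z)%C). apply cderiv_const.
    apply (cderiv_plus psi (fun _ => - psi z)%C); auto. apply cderiv_const. }
  assert (DG : cderiv G (psi' z) (C_derive G (psi' z))) by apply analytic_cderiv, GA, IN, Dz.
  assert (DC := cderiv_comp G psi' z _ _ DP DG).
  rewrite (cderiv_C_derive _ _ _ DC), PZ in Hm.
  rewrite !Cmod_mult, Cmod_R, Rabs_pos_eq in Hm by lra. lra.
Qed.

(** Iterating the step: the Caratheodory metric at [z], of which [m] is an upper
    bound, contracts by the same factor under every branch. *)
Lemma Earle_Hamilton D psi F : open D -> bounded_set D -> ifs D psi F ->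
  exists theta, 0 < theta < 1 /\ forall v z m, D z -> 0 <= m ->
    (forall G, unit_ball_on D G -> Cmod (C_derive G z) <= m) ->
    forall G, unit_ball_on D G -> Cmod (C_derive (fun w => G (psiw psi v w)) z) <= theta ^ length v * m.
Proof.
  intros OD BD HI.
  assert (ST : exists theta, 0 < theta < 1 /\ forall b z m, D z -> 0 <= m ->
    (forall G, unit_ball_on D G -> Cmod (C_derive G z) <= m) ->
    forall G, unit_ball_on D G -> Cmod (C_derive G (psi b z)) * Cmod (C_derive (psi b) z) <= theta * m).
  { destruct (Earle_Hamilton_step D (psi true)) as [d1 [D1 K1]]; auto; try apply HI.
    destruct (Earle_Hamilton_step D (psi false)) as [d2 [D2 K2]]; auto; try apply HI.
    set (d := Rmin d1 d2). assert (Hd : 0 < d) by (apply Rmin_pos; auto).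
    assert (d <= d1 /\ d <= d2) by (split; [apply Rmin_l|apply Rmin_r]).
    exists (/ (1 + d)). split.
    { split. apply Rinv_0_lt_compat; lra. rewrite <- Rinv_1. apply Rinv_lt_contravar; lra. }
    intros b z m Dz Hm HG G UG.
    assert (X : (1 + d) * (Cmod (C_derive G (psi b z)) * Cmod (C_derive (psi b) z)) <= m).
    { pose proof (Cmod_ge_0 (C_derive G (psi b z))). pose proof (Cmod_ge_0 (C_derive (psi b) z)).
      assert (0 <= Cmod (C_derive G (psi b z)) * Cmod (C_derive (psi b) z)) by (apply Rmult_le_pos; auto).
      destruct b. specialize (K1 z m Dz HG G UG). nra. specialize (K2 z m Dz HG G UG). nra. }
    apply Rmult_le_reg_l with (1 + d); [lra|].
    replace ((1 + d) * (/ (1 + d) * m)) with m by (field; lra). auto. }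
  destruct ST as [theta [Ht K]]. exists theta. split; auto.
  induction v; intros z m Dz Hm HG G UG.
  - simpl. rewrite Rmult_1_l. apply HG, UG.
  - simpl length. simpl psiw.
    assert (Dz' : D (psi a z)) by (apply (psiw_in D psi F (a :: nil)); auto).
    assert (UV : unit_ball_on D (fun w => G (psiw psi v w))).
    { split. intros w Dw. apply (analytic_comp G (psiw psi v)). eapply psiw_analytic; eauto. apply UG. eapply psiw_in; eauto.
      intros w Dw. apply UG. eapply psiw_in; eauto. }
    assert (DC : C_derive (fun w => G (psiw psi v (psi a w))) z =
       (C_derive (fun w => G (psiw psi v w)) (psi a z) * C_derive (psi a) z)%C).
    { apply cderiv_C_derive. apply (cderiv_comp (fun w => G (psiw psi v w)) (psi a)).
      apply analytic_cderiv, HI, closure_incl, Dz. apply analytic_cderiv, UV, Dz'. }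
    rewrite DC, Cmod_mult.
    destruct (Req_dec (Cmod (C_derive (psi a) z)) 0) as [E0|N0].
    { rewrite E0, Rmult_0_r. apply Rmult_le_pos; auto. apply pow_le; lra. }
    pose proof (Cmod_ge_0 (C_derive (psi a) z)).
    set (p := Cmod (C_derive (psi a) z)) in *.
    assert (T := IHv (psi a z) (theta * m / p) Dz').
    apply Rle_trans with (theta ^ length v * (theta * m / p) * p).
    + apply Rmult_le_compat_r; auto. apply T; auto.
      * apply Rmult_le_pos. apply Rmult_le_pos; lra. left; apply Rinv_0_lt_compat; lra.
      * intros G' UG'. apply Rmult_le_reg_r with p; [lra|].
        unfold Rdiv. rewrite Rmult_assoc, Rinv_l, Rmult_1_r by auto. apply (K a z m); auto.
    + right. simpl. field. auto.
Qed.

Lemma weight_factor_bounds D psi F : bounded_set D -> ifs D psi F ->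
  exists MF kap, 0 < MF /\ 0 < kap /\ forall b z, closure D z -> kap <= Cmod (F b z) <= MF.
Proof.
  intros BD HI. assert (BC := bounded_closure D BD).
  destruct (compact_cont_bound (closure D) (F true)) as [M1 K1]; auto using closure_closure.
  { intros z Hz. apply analytic_ccont, HI, Hz. }
  destruct (compact_cont_bound (closure D) (F false)) as [M2 K2]; auto using closure_closure.
  { intros z Hz. apply analytic_ccont, HI, Hz. }
  destruct (compact_cont_lower (closure D) (F true)) as [m1 [Hm1 L1]]; auto using closure_closure.
  { intros z Hz. apply analytic_ccont, HI, Hz. } { intros z Hz. apply HI, Hz. }
  destruct (compact_cont_lower (closure D) (F false)) as [m2 [Hm2 L2]]; auto using closure_closure.
  { intros z Hz. apply analytic_ccont, HI, Hz. } { intros z Hz. apply HI, Hz. }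
  exists (Rmax 1 (Rmax M1 M2)), (Rmin m1 m2).
  pose proof (Rmax_l 1 (Rmax M1 M2)). pose proof (Rmax_r 1 (Rmax M1 M2)).
  pose proof (Rmax_l M1 M2). pose proof (Rmax_r M1 M2). pose proof (Rmin_l m1 m2). pose proof (Rmin_r m1 m2).
  split; [lra|]. split. apply Rmin_pos; auto. intros [|] z Hz.
  specialize (K1 z Hz). specialize (L1 z Hz). lra. specialize (K2 z Hz). specialize (L2 z Hz). lra.
Qed.

Lemma mean_value_disc H z0 r K z z' : (forall w, Cmod (w - z0) < r -> cderiv H w (C_derive H w) /\ Cmod (C_derive H w) <= K) ->
  Cmod (z - z0) < r -> Cmod (z' - z0) < r -> Cmod (H z - H z') <= 2 * K * Cmod (z - z').
Proof.
  intros HD Hz Hz'.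
  set (g := fun s => H (z' + s * (z - z'))%C).
  assert (IN : forall t, 0 <= t <= 1 -> Cmod (z' + RtoC t * (z - z') - z0) < r).
  { intros t Ht. replace (z' + RtoC t * (z - z') - z0)%C with (RtoC (1 - t) * (z' - z0) + RtoC t * (z - z0))%C
      by (rewrite RtoC_minus; ring).
    eapply Rle_lt_trans; [apply Cmod_triangle|]. rewrite !Cmod_mult_R, !Rabs_pos_eq by lra.
    destruct (Req_dec t 0) as [->|]. lra. destruct (Req_dec t 1) as [->|]. lra.
    assert ((1 - t) * Cmod (z' - z0) < (1 - t) * r) by (apply Rmult_lt_compat_l; lra).
    assert (t * Cmod (z - z0) < t * r) by (apply Rmult_lt_compat_l; lra). lra. }
  assert (Dg : forall t, 0 <= t <= 1 -> cderiv g (RtoC t) (C_derive H (z' + RtoC t * (z - z')) * (z - z'))%C).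
  { intros t Ht. apply (cderiv_comp H (fun s => z' + s * (z - z'))%C).
    apply cderiv_eq with (RtoC 0 + (RtoC 1 * (z - z') + RtoC t * RtoC 0))%C; [ring|].
    apply cderiv_plus. apply cderiv_const.
    apply (cderiv_mult (fun s => s) (fun _ => (z - z')%C)); [apply cderiv_id|apply cderiv_const].
    apply HD, IN, Ht. }
  replace (2 * K * Cmod (z - z')) with (2 * (K * Cmod (z - z'))) by ring. apply Cmod_le_2. intros P HP.
  set (dg := fun t : R => P (C_derive H (z' + RtoC t * (z - z')) * (z - z'))%C).
  assert (Dg' : forall t, 0 <= t <= 1 -> is_derive (fun s => P (g (RtoC s))) t (dg t)).
  { intros t Ht. apply (cderiv_component P g); auto. }
  destruct (MVT_gen (fun s => P (g (RtoC s))) 0 1 dg) as [c [Hc E0]];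
    rewrite Rmin_left, Rmax_right in * by lra.
  - intros; apply Dg'; lra.
  - intros x Hx. apply derivable_continuous_pt. exists (dg x). apply is_derive_Reals, Dg', Hx.
  - unfold g in E0. replace (z' + RtoC 1 * (z - z'))%C with z in E0 by ring.
    replace (z' + RtoC 0 * (z - z'))%C with z' in E0 by ring.
    rewrite component_minus, E0, Rminus_0_r, Rmult_1_r by auto.
    eapply Rle_trans; [apply component_le; auto|].
    rewrite Cmod_mult. apply Rmult_le_compat_r. apply Cmod_ge_0. apply HD, IN; auto.
Qed.

Lemma open_near D z : open (T := C_UniformSpace) D -> D z -> near z D.
Proof. intros O Dz. apply near_locally, O, Dz. Qed.

(** Bounded distortion: along a word the logarithms of the weights at [z] and
    [z'] differ by terms that decrease geometrically, since the branches
    contract; their sum does not depend on the length of the word. *)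
Lemma local_distortion D psi F z0 : open D -> bounded_set D -> ifs D psi F -> D z0 ->
  exists r A, 0 < r /\ 0 <= A /\ (forall z, Cmod (z - z0) < r -> D z) /\
  forall z z' v, Cmod (z - z0) < r -> Cmod (z' - z0) < r ->
    weight psi F v z <= exp (A * Cmod (z - z')) * weight psi F v z'.
Proof.
  intros OD BD HI Dz0.
  destruct (Earle_Hamilton D psi F OD BD HI) as [theta [Ht EH]].
  destruct (open_near D z0 OD Dz0) as [R0 [HR HR']].
  assert (BC := bounded_closure D BD).
  pose proof (weight_factor_bounds D psi F BD HI) as FB.
  destruct FB as [MF [kap [HMF [Hkap FB]]]].
  set (r := R0 / 2). assert (Hr : 0 < r) by (unfold r; lra).
  assert (INr : forall z, Cmod (z - z0) < r -> D z) by (intros; apply HR'; unfold r in *; lra).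
  assert (LIP : forall b v z z', Cmod (z - z0) < r -> Cmod (z' - z0) < r ->
     Cmod (F b (psiw psi v z) - F b (psiw psi v z')) <= 2 * (MF * (theta ^ length v * (4 / r))) * Cmod (z - z')).
  { intros b v z z' Hz Hz'. apply (mean_value_disc (fun w => F b (psiw psi v w)) z0 r); auto.
    intros w Hw. assert (Dw := INr w Hw).
    assert (AF : analytic_at_C (fun w => F b (psiw psi v w)) w).
    { apply (analytic_comp (F b) (psiw psi v)). eapply psiw_analytic; eauto. apply HI, closure_incl. eapply psiw_in; eauto. }
    split. apply analytic_cderiv; auto.
    set (G := fun w => (RtoC (/ MF) * F b w)%C).
    assert (UG : unit_ball_on D G).
    { split. intros u Du. apply analytic_scal, HI, closure_incl, Du.
      intros u Du. unfold G. rewrite Cmod_mult_R, Rabs_pos_eq by (left; apply Rinv_0_lt_compat; auto).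
      apply Rmult_le_reg_l with MF; auto.
      replace (MF * (/ MF * Cmod (F b u))) with (Cmod (F b u)) by (field; lra). rewrite Rmult_1_r.
      apply FB, closure_incl, Du. }
    assert (T := EH v w (4 / r) Dw).
    assert (X : Cmod (C_derive (fun w => G (psiw psi v w)) w) <= theta ^ length v * (4 / r)).
    { apply T; auto. left; apply Rdiv_lt_0_compat; lra.
      intros G' [GA GB]. replace (4 / r) with (4 * 1 / r) by (field; lra).
      apply Cauchy_estimate; auto.
      + intros u Hu. assert (Du : D u). { apply HR'. pose proof (Cmod_sub_trans u w z0). unfold r in *. lra. }
        split. apply analytic_cderiv, GA, Du. apply analytic_ccont, analytic_C_derive, GA, Du.
      + intros u Hu. apply GB. apply HR'. pose proof (Cmod_sub_trans u w z0). unfold r in *. lra. }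
    assert (E0 : C_derive (fun w => F b (psiw psi v w)) w = (RtoC MF * C_derive (fun w => G (psiw psi v w)) w)%C).
    { apply cderiv_C_derive. apply cderiv_ext_loc with (fun w => RtoC MF * G (psiw psi v w))%C 1; [lra| |].
      - intros u _. unfold G. rewrite Cmult_assoc, <- RtoC_mult, Rinv_r by lra. ring.
      - apply cderiv_eq with (RtoC 0 * G (psiw psi v w) + RtoC MF * C_derive (fun w => G (psiw psi v w)) w)%C; [ring|].
        apply (cderiv_mult (fun _ => RtoC MF) (fun w => G (psiw psi v w))). apply cderiv_const.
        apply analytic_cderiv. apply (analytic_scal _ (fun w => F b (psiw psi v w))). auto. }
    rewrite E0, Cmod_mult_R, Rabs_pos_eq by lra. apply Rmult_le_compat_l; lra. }
  set (A0 := 2 * (MF * (4 / r)) / kap).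
  assert (HA0 : 0 < A0).
  { apply Rdiv_lt_0_compat; auto. apply Rmult_lt_0_compat; [lra|]. apply Rmult_lt_0_compat; auto. apply Rdiv_lt_0_compat; lra. }
  exists r, (A0 / (1 - theta)). split; auto. split. left; apply Rdiv_lt_0_compat; lra. split; auto.
  assert (MAIN : forall v u z z', Cmod (z - z0) < r -> Cmod (z' - z0) < r ->
    weight psi F v (psiw psi u z) <= exp (A0 / (1 - theta) * theta ^ length u * Cmod (z - z')) * weight psi F v (psiw psi u z')).
  { induction v; intros u z z' Hz Hz'.
    - simpl. rewrite Rmult_1_r.
      assert (0 <= A0 / (1 - theta) * theta ^ length u * Cmod (z - z')).
      { apply Rmult_le_pos; [|apply Cmod_ge_0]. apply Rmult_le_pos. left; apply Rdiv_lt_0_compat; lra. apply pow_le; lra. }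
      pose proof (exp_ineq1_le (A0 / (1 - theta) * theta ^ length u * Cmod (z - z'))). lra.
    - simpl weight.
      assert (CU : closure D (psiw psi u z')) by (apply closure_incl; eapply psiw_in; eauto).
      specialize (IHv (u ++ (a :: nil)) z z' Hz Hz'). rewrite !psiw_app in IHv. simpl psiw in IHv.
      rewrite length_app in IHv. simpl length in IHv.
      assert (L := LIP a u z z' Hz Hz').
      assert (FBz := FB a _ CU).
      set (dd := Cmod (z - z')) in *. set (tn := theta ^ length u) in *.
      assert (Htn : 0 < tn) by (apply pow_lt; lra). assert (Hdd : 0 <= dd) by apply Cmod_ge_0.
      replace (theta ^ (length u + 1)) with (tn * theta) in IHv by (rewrite pow_add; simpl; unfold tn; ring).
      assert (S1 : Cmod (F a (psiw psi u z)) <= exp (A0 * tn * dd) * Cmod (F a (psiw psi u z'))).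
      { pose proof (Cmod_sub_lower (F a (psiw psi u z)) (F a (psiw psi u z'))).
        pose proof (exp_ineq1_le (A0 * tn * dd)).
        assert (A0 * tn * dd * kap = 2 * (MF * (tn * (4 / r))) * dd) by (unfold A0; field; lra).
        assert (0 <= A0 * tn * dd). { apply Rmult_le_pos; auto. apply Rmult_le_pos; lra. }
        set (X := Cmod (F a (psiw psi u z'))) in *.
        assert (A0 * tn * dd * kap <= A0 * tn * dd * X) by (apply Rmult_le_compat_l; lra).
        assert ((1 + A0 * tn * dd) * X <= exp (A0 * tn * dd) * X) by (apply Rmult_le_compat_r; lra).
        lra. }
      replace (A0 / (1 - theta) * tn * dd) with (A0 * tn * dd + A0 / (1 - theta) * (tn * theta) * dd) by (field; lra).
      rewrite exp_plus.
      replace (exp (A0 * tn * dd) * exp (A0 / (1 - theta) * (tn * theta) * dd) *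
        (Cmod (F a (psiw psi u z')) * weight psi F v (psi a (psiw psi u z')))) with
       ((exp (A0 * tn * dd) * Cmod (F a (psiw psi u z'))) * (exp (A0 / (1 - theta) * (tn * theta) * dd) * weight psi F v (psi a (psiw psi u z')))) by ring.
      apply Rmult_le_compat; auto. apply Cmod_ge_0. left. apply (weight_pos D); auto.
      apply (psiw_in_closure D psi F (a :: nil)); auto. apply closure_incl; eapply psiw_in; eauto. }
  intros z z' v Hz Hz'. specialize (MAIN v nil z z' Hz Hz'). simpl in MAIN. rewrite Rmult_1_r in MAIN. auto.
Qed.

(** Harnack's inequality for the weights.  The points comparable to [x0] form an
    open and closed subset of [D]; after one more branch, compactness makes the
    constant uniform up to the boundary. *)
Lemma weight_Harnack D psi F : open D -> connected_open D -> bounded_set D -> ifs D psi F ->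
  forall x0, D x0 -> exists K, 1 <= K /\ forall z z' v, closure D z -> closure D z' ->
    weight psi F v z <= K * weight psi F v z'.
Proof.
  intros OD CD BD HI x0 Dx0.
  set (Q := fun B z => forall v, weight psi F v z <= B * weight psi F v x0 /\ weight psi F v x0 <= B * weight psi F v z).
  assert (WP : forall v z, D z -> 0 < weight psi F v z) by (intros; apply (weight_pos D); auto; apply closure_incl; auto).
  assert (LOC : forall z0, D z0 -> exists B, 0 < B /\ near z0 (fun z => D z /\ forall B0, 0 < B0 ->
      (Q B0 z -> Q (B * B0) z0) /\ (Q B0 z0 -> Q (B * B0) z))).
  { intros z0 Dz0. destruct (local_distortion D psi F z0 OD BD HI Dz0) as [r [A [Hr [HA [HD K]]]]].
    exists (exp (A * r)). split; [apply exp_pos|]. exists r; split; auto. intros z Hz.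
    split; auto. intros B0 HB0.
    assert (Z0 : Cmod (z0 - z0) < r) by (rewrite Cmod_sub_diag; auto).
    assert (EE : exp (A * Cmod (z - z0)) <= exp (A * r)).
    { destruct (Rle_lt_or_eq_dec (A * Cmod (z - z0)) (A * r)) as [L|L]. apply Rmult_le_compat_l; lra.
      left; apply exp_increasing; auto. rewrite L; lra. }
    assert (U1 : forall v, weight psi F v z <= exp (A * r) * weight psi F v z0).
    { intros v. eapply Rle_trans; [apply (K z z0 v); auto|]. apply Rmult_le_compat_r; auto. left; apply WP; auto. }
    assert (U2 : forall v, weight psi F v z0 <= exp (A * r) * weight psi F v z).
    { intros v. eapply Rle_trans; [apply (K z0 z v); auto|]. rewrite Cmod_sub_sym. apply Rmult_le_compat_r; auto. left; apply WP; auto. }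
    pose proof (exp_pos (A * r)).
    split; intros HQ v; destruct (HQ v) as [Q1 Q2]; split.
    - eapply Rle_trans; [apply U2|]. rewrite Rmult_assoc. apply Rmult_le_compat_l; lra.
    - eapply Rle_trans; [apply Q2|]. rewrite (Rmult_comm (exp _)), Rmult_assoc. apply Rmult_le_compat_l; auto; lra.
    - eapply Rle_trans; [apply U1|]. rewrite Rmult_assoc. apply Rmult_le_compat_l; lra.
    - eapply Rle_trans; [apply Q2|]. rewrite (Rmult_comm (exp _)), Rmult_assoc. apply Rmult_le_compat_l; auto; lra. }
  assert (ALL : forall z, D z -> exists B, 0 < B /\ Q B z).
  { intros z Dz. apply NNPP. intros N.
    destruct (CD (fun z => D z /\ exists B, 0 < B /\ Q B z) (fun z => D z /\ ~ exists B, 0 < B /\ Q B z)) as [w [_ [[_ W1] [_ W2]]]].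
    - intros u [Du [B0 [HB0 Qu]]]. apply near_locally. destruct (LOC u Du) as [B [HB [d [Hd K]]]].
      exists d; split; auto. intros w Hw. destruct (K w Hw) as [Dw K']. split; auto. exists (B * B0).
      split. apply Rmult_lt_0_compat; auto. apply K'; auto.
    - intros u [Du NB]. apply near_locally. destruct (LOC u Du) as [B [HB [d [Hd K]]]].
      exists d; split; auto. intros w Hw. destruct (K w Hw) as [Dw K']. split; auto. intros [B0 [HB0 Qw]].
      apply NB. exists (B * B0). split. apply Rmult_lt_0_compat; auto. apply K'; auto.
    - intros u Du. destruct (classic (exists B, 0 < B /\ Q B u)); auto.
    - exists x0. split; auto. split; auto. exists 1. split; [lra|]. intros v; lra.
    - exists z; auto.
    - auto. }
  assert (BC := bounded_closure D BD).
  assert (UNI : forall b, exists B, 0 < B /\ forall z, closure D z -> Q B (psi b z)).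
  { intros b.
    set (P := fun u del => forall z, closure D z -> Cmod (z - u) < del -> Q (/ del) (psi b z)).
    assert (MON : forall B B' z, closure D z -> B <= B' -> Q B z -> Q B' z).
    { intros B B' z Hz HB HQ v. destruct (HQ v). assert (0 < weight psi F v z) by (apply (weight_pos D); auto).
      pose proof (WP v x0 Dx0). split; eapply Rle_trans; eauto; apply Rmult_le_compat_r; lra. }
    destruct (compact_uniform (closure D) P) as [d [Hd K]]; auto using closure_closure.
    - intros u Hu. assert (Du : D (psi b u)) by (apply maps_inside_in; auto; apply HI).
      destruct (ALL _ Du) as [B0 [HB0 Q0]]. destruct (LOC _ Du) as [B [HB [d [Hd K]]]].
      assert (CP : ccont (psi b) u) by (apply analytic_ccont, HI, Hu).
      destruct (CP d Hd) as [d' [Hd' K']].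
      assert (PB : 0 < / (B * B0)) by (apply Rinv_0_lt_compat, Rmult_lt_0_compat; auto).
      exists (Rmin d' (/ (B * B0))). split. apply Rmin_pos; auto.
      intros z Hz Hzu. apply MON with (B * B0). apply closure_incl, maps_inside_in; auto. apply HI.
      apply Rle_inv_swap; [apply Rmin_pos; auto|apply Rmult_lt_0_compat; auto|apply Rmin_r].
      apply K; auto. apply K'. eapply Rlt_le_trans; [apply Hzu|apply Rmin_l].
    - exists (/ d). split. apply Rinv_0_lt_compat; auto. intros z Hz.
      destruct (K z Hz) as [u [del [Hu [Pu [Hdel Hzu]]]]]. apply MON with (/ del).
      apply closure_incl, maps_inside_in; auto. apply HI. apply Rinv_le_contravar; auto. apply Pu; auto. }
  destruct (UNI true) as [B1 [HB1 U1]]. destruct (UNI false) as [B2 [HB2 U2]].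
  pose proof (weight_factor_bounds D psi F BD HI) as FB.
  destruct FB as [MF [kap [HMF [Hkap FB]]]].
  set (B := Rmax B1 B2).
  assert (HB : 0 < B) by (unfold B; pose proof (Rmax_l B1 B2); lra).
  assert (UB : forall b z v, closure D z -> weight psi F v (psi b z) <= B * weight psi F v x0 /\
      weight psi F v x0 <= B * weight psi F v (psi b z)).
  { intros b z v Hz. assert (0 < weight psi F v (psi b z)). { apply WP, maps_inside_in; auto. apply HI. }
    pose proof (WP v x0 Dx0). pose proof (Rmax_l B1 B2). pose proof (Rmax_r B1 B2).
    destruct b; [destruct (U1 z Hz v)|destruct (U2 z Hz v)]; split; (eapply Rle_trans; [eassumption|]); apply Rmult_le_compat_r; unfold B; lra. }
  set (K0 := MF / kap * (B * B)).
  assert (HK0 : 0 < K0). { apply Rmult_lt_0_compat. apply Rdiv_lt_0_compat; auto. apply Rmult_lt_0_compat; auto. }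
  exists (Rmax 1 K0). split. apply Rmax_l. intros z z' v Hz Hz'.
  destruct v as [|b v].
  - simpl. pose proof (Rmax_l 1 K0). lra.
  - assert (0 < weight psi F (b :: v) z') by (apply (weight_pos D); auto).
    apply Rle_trans with (K0 * weight psi F (b :: v) z'); [|apply Rmult_le_compat_r; [lra|apply Rmax_r]].
    simpl. destruct (FB b z Hz) as [_ F1]. destruct (FB b z' Hz') as [F2 _].
    destruct (UB b z v Hz) as [W1 _]. destruct (UB b z' v Hz') as [_ W2].
    pose proof (WP v x0 Dx0). pose proof (Cmod_ge_0 (F b z)).
    assert (0 < weight psi F v (psi b z)). { apply WP, maps_inside_in; auto. apply HI. }
    assert (0 < weight psi F v (psi b z')). { apply WP, maps_inside_in; auto. apply HI. }
    apply Rle_trans with (MF * (B * (B * weight psi F v (psi b z')))).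
    apply Rmult_le_compat; try lra. eapply Rle_trans; [apply W1|]. apply Rmult_le_compat_l; lra.
    unfold K0. replace (MF / kap * (B * B) * (Cmod (F b z') * weight psi F v (psi b z'))) with
      (MF * (B * (B * weight psi F v (psi b z'))) * (Cmod (F b z') / kap)) by (field; lra).
    rewrite <- (Rmult_1_r (MF * (B * (B * weight psi F v (psi b z'))))) at 1.
    apply Rmult_le_compat_l. repeat apply Rmult_le_pos; lra.
    apply Rmult_le_reg_r with kap; auto. unfold Rdiv. rewrite Rmult_assoc, Rinv_l; lra.
Qed.

(** * The positive transfer operator *)

Definition transfer (psi F : bool -> C -> C) (p : R) (v : C -> R) (z : C) : R :=
  Rpower (Cmod (F true z)) p * v (psi true z) + Rpower (Cmod (F false z)) p * v (psi false z).

Fixpoint transfer_iter psi F p (n : nat) (v : C -> R) : C -> R :=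
  match n with O => v | S n => transfer psi F p (transfer_iter psi F p n v) end.

Lemma Rpower_pos x p : 0 < Rpower x p.
Proof. apply exp_pos. Qed.

Lemma transfer_mono (X : C -> Prop) psi F p u v : (forall b z, X z -> X (psi b z)) ->
  (forall z, X z -> u z <= v z) -> forall z, X z -> transfer psi F p u z <= transfer psi F p v z.
Proof.
  intros HX H z Hz. unfold transfer. pose proof (Rpower_pos (Cmod (F true z)) p). pose proof (Rpower_pos (Cmod (F false z)) p).
  apply Rplus_le_compat; apply Rmult_le_compat_l; try lra; auto.
Qed.

Lemma transfer_scal psi F p c v z : transfer psi F p (fun w => c * v w) z = c * transfer psi F p v z.
Proof. unfold transfer. ring. Qed.

Lemma transfer_iter_mono (X : C -> Prop) psi F p n u v : (forall b z, X z -> X (psi b z)) ->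
  (forall z, X z -> u z <= v z) -> forall z, X z -> transfer_iter psi F p n u z <= transfer_iter psi F p n v z.
Proof. intros HX H. induction n; simpl; auto. apply transfer_mono; auto. Qed.

Lemma transfer_ext (X : C -> Prop) psi F p u v : (forall b z, X z -> X (psi b z)) ->
  (forall z, X z -> u z = v z) -> forall z, X z -> transfer psi F p u z = transfer psi F p v z.
Proof. intros HX H z Hz. unfold transfer. rewrite !H; auto. Qed.

Lemma transfer_iter_scal (X : C -> Prop) psi F p n c v z : (forall b z, X z -> X (psi b z)) -> X z ->
  transfer_iter psi F p n (fun w => c * v w) z = c * transfer_iter psi F p n v z.
Proof.
  intros HX. revert z. induction n; simpl; auto. intros z Hz. rewrite <- transfer_scal.
  apply (transfer_ext X); auto.
Qed.

Lemma transfer_iter_add psi F p n m v :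
  transfer_iter psi F p (n + m) v = transfer_iter psi F p n (transfer_iter psi F p m v).
Proof. induction n; simpl; auto. rewrite IHn. auto. Qed.

(** This comparison of points, unlike a modulus of continuity, is inherited by
    all iterates of the transfer operator and by their pointwise limits, and
    both Harnack's inequality and continuity can be read off from it. *)
Definition weight_close psi F (c : R) (z z' : C) : Prop :=
  forall v, weight psi F v z <= c * weight psi F v z' /\ weight psi F v z' <= c * weight psi F v z.

Definition Harnack_class (X : C -> Prop) psi F (e : R) (u : C -> R) : Prop :=
  forall z z' c, X z -> X z' -> 0 < c -> weight_close psi F c z z' -> u z <= Rpower c e * u z'.

Lemma Rpower_le_mono x y p : 0 < x -> x <= y -> 0 <= p -> Rpower x p <= Rpower y p.
Proof. intros. apply Rle_Rpower_l; auto. Qed.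

Lemma psiw_X (X : C -> Prop) psi v z : (forall b z, X z -> X (psi b z)) -> X z -> X (psiw psi v z).
Proof. intros HX. revert z. induction v; simpl; auto. Qed.

Lemma weight_posX (X : C -> Prop) psi F v z : (forall b z, X z -> X (psi b z)) ->
  (forall b z, X z -> F b z <> RtoC 0) -> X z -> 0 < weight psi F v z.
Proof.
  intros HX HF. revert z. induction v; simpl; intros z Hz. lra.
  apply Rmult_lt_0_compat; auto. apply Cmod_gt_0; auto.
Qed.

(** The weight of a word [b :: v] is that of [v] times that of [b], so one step
    of the induction moves the factor of [b] from the weights to [a]. *)
Lemma transfer_iter_close (X : C -> Prop) psi F p e u n :
  (forall b z, X z -> X (psi b z)) -> (forall b z, X z -> F b z <> RtoC 0) -> 0 <= p ->
  (forall z, X z -> 0 <= u z) -> Harnack_class X psi F e u ->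
  forall z z' a c, X z -> X z' -> 0 < a -> 0 < c ->
    (forall v, weight psi F v z <= a * weight psi F v z') ->
    (forall v, weight_close psi F c (psiw psi v z) (psiw psi v z')) ->
    transfer_iter psi F p n u z <= Rpower a p * Rpower c e * transfer_iter psi F p n u z'.
Proof.
  intros HX HF Hp Hu HH. induction n; intros z z' a c Hz Hz' Ha Hc HW HC.
  - simpl. assert (T := HH z z' c Hz Hz' Hc (HC nil)).
    assert (1 <= a). { specialize (HW nil). simpl in HW. lra. }
    assert (1 <= Rpower a p). { rewrite <- (Rpower_O a) at 1 by lra. apply Rle_Rpower; lra. }
    rewrite Rmult_assoc. rewrite <- (Rmult_1_l (u z)). apply Rmult_le_compat; auto; lra.
  - simpl.
    assert (ONE : forall b, Rpower (Cmod (F b z)) p * transfer_iter psi F p n u (psi b z) <=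
       Rpower a p * Rpower c e * (Rpower (Cmod (F b z')) p * transfer_iter psi F p n u (psi b z'))).
    { intros b. assert (P1 : 0 < Cmod (F b z)) by (apply Cmod_gt_0; auto).
      assert (P2 : 0 < Cmod (F b z')) by (apply Cmod_gt_0; auto).
      assert (P3 : 0 < a * Cmod (F b z') / Cmod (F b z)).
      { apply Rdiv_lt_0_compat; auto. apply Rmult_lt_0_compat; auto. }
      assert (T := IHn (psi b z) (psi b z') (a * Cmod (F b z') / Cmod (F b z)) c (HX b z Hz) (HX b z' Hz') P3 Hc).
      eapply Rle_trans. apply Rmult_le_compat_l; [left; apply Rpower_pos|]. apply T.
      - intros v. specialize (HW (b :: v)). simpl in HW. apply Rmult_le_reg_l with (Cmod (F b z)); auto.
        eapply Rle_trans; [apply HW|]. right. field. lra.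
      - intros v. apply (HC (b :: v)).
      - right. rewrite !Rmult_assoc. rewrite <- !(Rmult_assoc _ (Rpower _ p)).
        transitivity ((Rpower (Cmod (F b z)) p * Rpower (a * Cmod (F b z') / Cmod (F b z)) p) * (Rpower c e * transfer_iter psi F p n u (psi b z'))).
        ring. rewrite Rpower_mult_distr by auto.
        replace (Cmod (F b z) * (a * Cmod (F b z') / Cmod (F b z))) with (a * Cmod (F b z')) by (field; lra).
        rewrite <- (Rpower_mult_distr a) by auto. ring. }
    unfold transfer. pose proof (ONE true). pose proof (ONE false). lra.
Qed.

Lemma weight_close_psiw (X : C -> Prop) psi F c z z' v :
  (forall b z, X z -> X (psi b z)) -> (forall b z, X z -> F b z <> RtoC 0) -> X z -> X z' -> 0 < c ->
  weight_close psi F c z z' -> weight_close psi F (c * c) (psiw psi v z) (psiw psi v z').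
Proof.
  intros HX HF Hz Hz' Hc H w. destruct (H v) as [V1 V2]. destruct (H (v ++ w)) as [W1 W2].
  rewrite !weight_app in W1, W2.
  assert (P1 := weight_posX X psi F v z HX HF Hz). assert (P2 := weight_posX X psi F v z' HX HF Hz').
  assert (Q1 := weight_posX X psi F w _ HX HF (psiw_X X psi v z HX Hz)).
  assert (Q2 := weight_posX X psi F w _ HX HF (psiw_X X psi v z' HX Hz')).
  set (a := weight psi F v z) in *. set (a' := weight psi F v z') in *.
  set (b := weight psi F w (psiw psi v z)) in *. set (b' := weight psi F w (psiw psi v z')) in *.
  split.
  - apply Rmult_le_reg_l with a; auto. eapply Rle_trans; [apply W1|].
    replace (c * (a' * b')) with (c * b' * a') by ring.
    replace (a * (c * c * b')) with (c * b' * (c * a)) by ring.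
    apply Rmult_le_compat_l; auto. apply Rmult_le_pos; lra.
  - apply Rmult_le_reg_l with a'; auto. eapply Rle_trans; [apply W2|].
    replace (c * (a * b)) with (c * b * a) by ring.
    replace (a' * (c * c * b)) with (c * b * (c * a')) by ring.
    apply Rmult_le_compat_l; auto. apply Rmult_le_pos; lra.
Qed.

Lemma transfer_iter_Harnack (X : C -> Prop) psi F p e u n :
  (forall b z, X z -> X (psi b z)) -> (forall b z, X z -> F b z <> RtoC 0) -> 0 <= p ->
  (forall z, X z -> 0 <= u z) -> Harnack_class X psi F e u ->
  Harnack_class X psi F (p + 2 * e) (transfer_iter psi F p n u).
Proof.
  intros HX HF Hp Hu HH z z' c Hz Hz' Hc HC.
  replace (Rpower c (p + 2 * e)) with (Rpower c p * Rpower (c * c) e).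
  - apply (transfer_iter_close X); auto. apply Rmult_lt_0_compat; auto. intros v; apply HC.
    intros v. apply (weight_close_psiw X); auto.
  - rewrite <- Rpower_mult_distr by auto. rewrite Rpower_plus. f_equal.
    replace (2 * e) with (e + e) by ring. rewrite Rpower_plus. auto.
Qed.

(** Otherwise [b m / m > a n / n] for some [m] and [n], and the sequences would
    cross at large multiples of [m n]. *)
Lemma common_rate (a b : nat -> R) : (forall n, b n <= a n) ->
  (forall n m, a (n + m)%nat <= a n + a m) -> (forall n m, b n + b m <= b (n + m)%nat) ->
  exists L, forall n, b n <= INR n * L <= a n.
Proof.
  intros HBA HA HB.
  assert (A0 : 0 <= a 0%nat) by (specialize (HA 0%nat 0%nat); simpl in HA; lra).
  assert (B0 : b 0%nat <= 0) by (specialize (HB 0%nat 0%nat); simpl in HB; lra).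
  assert (AM : forall n k, a (k * n)%nat <= a 0%nat + INR k * a n).
  { intros n k. induction k. simpl; lra. rewrite S_INR. simpl. specialize (HA n (k * n)%nat). lra. }
  assert (BM : forall n k, b 0%nat + INR k * b n <= b (k * n)%nat).
  { intros n k. induction k. simpl; lra. rewrite S_INR. simpl. specialize (HB n (k * n)%nat). lra. }
  assert (KEY : forall n m, (0 < n)%nat -> (0 < m)%nat -> b m / INR m <= a n / INR n).
  { intros n m Hn Hm. apply lt_INR in Hn, Hm. simpl in Hn, Hm.
    apply Rnot_lt_le. intros L.
    set (d := b m / INR m - a n / INR n). assert (Hd : 0 < d) by (unfold d; lra).
    assert (E : forall k, INR k * (INR n * INR m * d) <= a 0%nat - b 0%nat).
    { intros k. pose proof (AM n (k * m)%nat) as U. pose proof (BM m (k * n)%nat) as V. rewrite mult_INR in U, V.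
      replace (k * n * m)%nat with (k * m * n)%nat in V by lia.
      pose proof (HBA (k * m * n)%nat).
      replace (INR k * (INR n * INR m * d)) with (INR k * INR n * b m - INR k * INR m * a n) by (unfold d; field; lra). lra. }
    set (y := INR n * INR m * d) in *.
    assert (Y : 0 < y) by (unfold y; apply Rmult_lt_0_compat; auto; apply Rmult_lt_0_compat; auto).
    destruct (INR_archimed y (a 0%nat - b 0%nat) Y) as [k Hk]. specialize (E k). lra. }
  destruct (completeness (fun x => exists m, (0 < m)%nat /\ x = b m / INR m)) as [L [U V]].
  { exists (a 1%nat / INR 1). intros x [m [Hm ->]]. apply KEY; auto. }
  { exists (b 1%nat / INR 1), 1%nat. auto. }
  exists L. intros n. destruct n. simpl; lra.
  assert (P : 0 < INR (S n)) by (apply lt_0_INR; lia). split.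
  - apply Rmult_le_reg_r with (/ INR (S n)). apply Rinv_0_lt_compat; auto.
    replace (INR (S n) * L * / INR (S n)) with L by (field; lra). apply U. exists (S n). split; [lia|auto].
  - apply Rmult_le_reg_r with (/ INR (S n)). apply Rinv_0_lt_compat; auto.
    replace (INR (S n) * L * / INR (S n)) with L by (field; lra). apply V. intros x [m [Hm ->]]. apply KEY; auto. lia.
Qed.

Lemma bounded_LimSup (u : nat -> R) m M : (forall n, m <= u n <= M) ->
  exists l, is_LimSup_seq u (Finite l) /\ m <= l <= M.
Proof.
  intros H. destruct (ex_LimSup_seq u) as [[l| |] Hl].
  - exists l. split; auto. split; apply Rnot_lt_le; intros L.
    + destruct (Hl (mkposreal (m - l) ltac:(lra))) as [_ [N K]]. specialize (K N (Nat.le_refl N)). simpl in K.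
      specialize (H N). lra.
    + destruct (Hl (mkposreal (l - M) ltac:(lra))) as [K _]. destruct (K 0%nat) as [n [_ K']]. simpl in K'.
      specialize (H n). lra.
  - exfalso. destruct (Hl M 0%nat) as [n [_ K]]. specialize (H n). lra.
  - exfalso. destruct (Hl m) as [N K]. specialize (K N (Nat.le_refl N)). specialize (H N). lra.
Qed.

Lemma LimSup_scal_le u v l m k : is_LimSup_seq u (Finite l) -> is_LimSup_seq v (Finite m) ->
  0 < k -> (forall n, u n <= k * v n) -> l <= k * m.
Proof.
  intros Hu Hv Hk H. apply le_epsilon. intros e He.
  destruct (Hv (mkposreal (e / (2 * k)) ltac:(apply Rdiv_lt_0_compat; lra))) as [_ [N K]]. simpl in K.
  destruct (Hu (mkposreal (e/2) ltac:(lra))) as [K' _]. destruct (K' N) as [n [Hn K2]]. simpl in K2.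
  specialize (K n Hn). specialize (H n).
  assert (k * v n < k * (m + e / (2 * k))) by (apply Rmult_lt_compat_l; auto).
  replace (k * (m + e / (2 * k))) with (k * m + e/2) in H0 by (field; lra). lra.
Qed.

(** A positive eigenfunction.  By bounded distortion the iterates of the
    constant 1, divided by their growth rate, stay between two positive
    constants.  Their upper limit [h0] satisfies [r h0 <= transfer h0]; hence
    the normalized iterates of [h0] increase to an eigenfunction. *)
Theorem transfer_eigenfunction (X : C -> Prop) psi F p K x0 :
  X x0 -> (forall b z, X z -> X (psi b z)) -> (forall b z, X z -> F b z <> RtoC 0) -> 0 <= p -> 0 < K ->
  (forall z z', X z -> X z' -> weight_close psi F K z z') ->
  exists r h c1 c2, 0 < r /\ 0 < c1 /\ (forall z, X z -> c1 <= h z <= c2) /\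
    (forall z, X z -> transfer psi F p h z = r * h z) /\ Harnack_class X psi F (3 * p) h.
Proof.
  intros X0 HX HF Hp HK HC.
  set (Pn := fun n => transfer_iter psi F p n (fun _ => 1)).
  assert (H1 : Harnack_class X psi F 0 (fun _ => 1)).
  { intros z z' c _ _ Hc _. rewrite Rpower_O by auto. lra. }
  assert (HPn : forall n, Harnack_class X psi F p (Pn n)).
  { intros n. pose proof (transfer_iter_Harnack X psi F p 0 (fun _ => 1) n HX HF Hp ltac:(intros; lra) H1).
    replace (p + 2 * 0) with p in H by ring. auto. }
  set (kap := Rpower K p). assert (Hkap : 0 < kap) by apply Rpower_pos.
  assert (OSC : forall n z z', X z -> X z' -> Pn n z <= kap * Pn n z').
  { intros n z z' Hz Hz'. apply (HPn n z z' K); auto. }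
  assert (POS : forall n z, X z -> 0 < Pn n z).
  { intros n. unfold Pn. induction n; simpl; intros z Hz. lra.
    unfold transfer. apply Rplus_lt_0_compat; apply Rmult_lt_0_compat; auto; apply Rpower_pos. }
  set (s := fun n => Pn n x0).
  assert (Hs : forall n, 0 < s n) by (intros; apply POS; auto).
  assert (SUB : forall n m, s (n + m)%nat <= kap * s m * s n).
  { intros n m. unfold s, Pn. rewrite transfer_iter_add.
    rewrite <- (transfer_iter_scal X) by auto. apply (transfer_iter_mono X); auto.
    intros z Hz. rewrite Rmult_1_r. apply OSC; auto. }
  assert (SUP : forall n m, s m / kap * s n <= s (n + m)%nat).
  { intros n m. unfold s at 3. unfold Pn. rewrite transfer_iter_add. unfold s at 2, Pn.
    rewrite <- (transfer_iter_scal X) by auto. apply (transfer_iter_mono X); auto.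
    intros z Hz. rewrite Rmult_1_r. apply Rmult_le_reg_r with kap; auto.
    unfold Rdiv. rewrite Rmult_assoc, Rinv_l, Rmult_1_r by lra. rewrite Rmult_comm. apply OSC; auto. }
  assert (K1 : 1 <= kap). { specialize (OSC 0%nat x0 x0 X0 X0). unfold Pn in OSC. simpl in OSC. lra. }
  assert (LK : 0 <= ln kap). { rewrite <- ln_1. destruct K1 as [K1|K1]. left; apply ln_increasing; lra. rewrite <- K1; lra. }
  destruct (common_rate (fun n => ln kap + ln (s n)) (fun n => ln (s n) - ln kap)) as [L HL].
  { intros n. lra. }
  { intros n m. assert (ln (s (n + m)%nat) <= ln (kap * s m * s n)).
    { apply ln_le; auto. } rewrite !ln_mult in H; auto. lra. apply Rmult_lt_0_compat; auto. }
  { intros n m. assert (ln (s m / kap * s n) <= ln (s (n + m)%nat)).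
    { apply ln_le; auto. apply Rmult_lt_0_compat; auto. apply Rdiv_lt_0_compat; auto. }
    rewrite ln_mult, ln_div in H; auto. lra. apply Rdiv_lt_0_compat; auto. }
  set (r := exp L). assert (Hr : 0 < r) by apply exp_pos.
  assert (Hrn : forall n, 0 < r ^ n) by (intros; apply pow_lt; auto).
  assert (LR : forall n, ln (r ^ n) = INR n * L).
  { intros n. rewrite ln_pow by auto. unfold r. rewrite ln_exp. auto. }
  assert (LEE : forall x y, 0 < x -> 0 < y -> ln x <= ln y -> x <= y).
  { intros x y Hx Hy H. apply Rnot_lt_le. intros HL'. apply ln_increasing in HL'; lra. }
  assert (UP : forall n z, X z -> Pn n z <= kap * kap * r ^ n).
  { intros n z Hz. apply Rle_trans with (kap * s n). apply OSC; auto.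
    rewrite Rmult_assoc. apply Rmult_le_compat_l; [lra|]. apply LEE; auto. apply Rmult_lt_0_compat; auto.
    rewrite ln_mult, LR by auto. specialize (HL n). lra. }
  assert (LO : forall n z, X z -> r ^ n <= kap * kap * Pn n z).
  { intros n z Hz. apply Rle_trans with (kap * s n).
    apply LEE; auto. apply Rmult_lt_0_compat; auto. rewrite ln_mult, LR by auto. specialize (HL n). lra.
    rewrite Rmult_assoc. apply Rmult_le_compat_l; [lra|]. apply OSC; auto. }
  set (u := fun z n => Pn n z / r ^ n).
  set (c := / (kap * kap)). set (c' := kap * kap).
  assert (Hc' : 0 < c') by (apply Rmult_lt_0_compat; auto).
  assert (Hc : 0 < c) by (apply Rinv_0_lt_compat; auto).
  assert (BU : forall z, X z -> forall n, c <= u z n <= c').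
  { intros z Hz n. unfold u, c. split.
    - apply Rmult_le_reg_r with (r ^ n); auto. unfold Rdiv. rewrite (Rmult_assoc (Pn n z)), Rinv_l, Rmult_1_r by (apply Rgt_not_eq; red; auto).
      apply Rmult_le_reg_l with c'; auto. unfold c'. rewrite <- Rmult_assoc, Rinv_r, Rmult_1_l by (apply Rgt_not_eq; red; auto). apply LO; auto.
    - apply Rmult_le_reg_r with (r ^ n); auto. unfold Rdiv. rewrite (Rmult_assoc (Pn n z)), Rinv_l, Rmult_1_r by (apply Rgt_not_eq; red; auto).
      apply UP; auto. }
  set (h0 := fun z => real (LimSup_seq (u z))).
  assert (HS : forall z, X z -> is_LimSup_seq (u z) (Finite (h0 z)) /\ c <= h0 z <= c').
  { intros z Hz. destruct (bounded_LimSup (u z) c c' (BU z Hz)) as [l [Hl Bl]]. unfold h0.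
    rewrite (is_LimSup_seq_unique _ _ Hl). simpl. auto. }
  assert (H0H : Harnack_class X psi F p h0).
  { intros z z' d Hz Hz' Hd Hcl. eapply LimSup_scal_le; [apply HS; auto|apply HS; auto|apply Rpower_pos|].
    intros n. unfold u. unfold Rdiv. rewrite <- Rmult_assoc. apply Rmult_le_compat_r.
    left; apply Rinv_0_lt_compat; auto. apply (HPn n z z' d); auto. }
  assert (SE : forall z, X z -> r * h0 z <= transfer psi F p h0 z).
  { intros z Hz. set (W := Rpower (Cmod (F true z)) p + Rpower (Cmod (F false z)) p).
    assert (HW : 0 < W) by (apply Rplus_lt_0_compat; apply Rpower_pos).
    apply le_epsilon. intros e He.
    assert (He' : 0 < e / (2 * W)) by (apply Rdiv_lt_0_compat; lra).
    destruct (HS _ (HX true z Hz)) as [LT _]. destruct (HS _ (HX false z Hz)) as [LF _]. destruct (HS z Hz) as [LZ _].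
    destruct (LT (mkposreal _ He')) as [_ [N1 K1']]. destruct (LF (mkposreal _ He')) as [_ [N2 K2]].
    assert (He2 : 0 < e / (2 * r)) by (apply Rdiv_lt_0_compat; lra).
    destruct (LZ (mkposreal _ He2)) as [K3 _]. destruct (K3 (S (max N1 N2))) as [n [Hn K4]]. simpl in K1', K2, K4.
    destruct n as [|n]; [lia|]. specialize (K1' n ltac:(lia)). specialize (K2 n ltac:(lia)).
    assert (EQ : r * u z (S n) = Rpower (Cmod (F true z)) p * u (psi true z) n + Rpower (Cmod (F false z)) p * u (psi false z) n).
    { unfold u, Pn. simpl. unfold transfer. pose proof (Hrn n). field. split; lra. }
    pose proof (Rpower_pos (Cmod (F true z)) p). pose proof (Rpower_pos (Cmod (F false z)) p).
    assert (Rpower (Cmod (F true z)) p * u (psi true z) n <= Rpower (Cmod (F true z)) p * (h0 (psi true z) + e / (2 * W))) by (apply Rmult_le_compat_l; lra).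
    assert (Rpower (Cmod (F false z)) p * u (psi false z) n <= Rpower (Cmod (F false z)) p * (h0 (psi false z) + e / (2 * W))) by (apply Rmult_le_compat_l; lra).
    assert (r * (h0 z - e / (2 * r)) <= r * u z (S n)) by (apply Rmult_le_compat_l; lra).
    replace (r * (h0 z - e / (2 * r))) with (r * h0 z - e / 2) in H4 by (field; lra).
    assert (W * (e / (2 * W)) = e / 2) by (field; lra). unfold W in H5 at 1. unfold transfer. lra. }
  set (t := fun z n => transfer_iter psi F p n h0 z / r ^ n).
  assert (TI : forall n z, X z -> r * transfer_iter psi F p n h0 z <= transfer_iter psi F p (S n) h0 z).
  { induction n; intros z Hz. apply SE; auto.
    change (transfer_iter psi F p (S (S n)) h0 z) with (transfer psi F p (transfer_iter psi F p (S n) h0) z).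
    change (transfer_iter psi F p (S n) h0 z) with (transfer psi F p (transfer_iter psi F p n h0) z).
    rewrite <- transfer_scal. apply (transfer_mono X); auto. }
  assert (TINC : forall z, X z -> forall n, t z n <= t z (S n)).
  { intros z Hz n. unfold t. specialize (TI n z Hz).
    replace (transfer_iter psi F p n h0 z / r ^ n) with (r * transfer_iter psi F p n h0 z / r ^ S n).
    apply Rmult_le_compat_r; auto. left; apply Rinv_0_lt_compat; auto.
    pose proof (Hrn n). simpl. field. split; lra. }
  assert (TB : forall z, X z -> forall n, t z n <= c' * c').
  { intros z Hz n. unfold t. apply Rmult_le_reg_r with (r ^ n); auto.
    unfold Rdiv. rewrite Rmult_assoc, Rinv_l, Rmult_1_r by (apply Rgt_not_eq; red; auto).
    apply Rle_trans with (c' * Pn n z).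
    - unfold Pn. rewrite <- (transfer_iter_scal X) by auto. apply (transfer_iter_mono X); auto.
      intros w Hw. rewrite Rmult_1_r. apply HS; auto.
    - rewrite Rmult_assoc. apply Rmult_le_compat_l; [lra|]. apply UP; auto. }
  set (h := fun z => real (Lim_seq (t z))).
  assert (HL' : forall z, X z -> is_lim_seq (t z) (h z)).
  { intros z Hz. apply Lim_seq_correct'. apply ex_finite_lim_seq_incr with (c' * c'). apply TINC; auto. apply TB; auto. }
  exists r, h, c, (c' * c'). split; auto. split; auto. split; [|split].
  - intros z Hz. split.
    + apply (is_lim_seq_le (fun _ => c) (t z) c (h z)); auto using is_lim_seq_const.
      induction n. unfold t. simpl. unfold Rdiv. rewrite Rinv_1, Rmult_1_r. apply HS; auto.
      eapply Rle_trans; [apply IHn|apply TINC; auto].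
    + apply (is_lim_seq_le (t z) (fun _ => c' * c') (h z) (c' * c')); auto using is_lim_seq_const.
  - intros z Hz.
    assert (L1 : is_lim_seq (fun n => Rpower (Cmod (F true z)) p * t (psi true z) n + Rpower (Cmod (F false z)) p * t (psi false z) n)
      (transfer psi F p h z)).
    { unfold transfer. apply is_lim_seq_plus'; apply is_lim_seq_mult'; try apply is_lim_seq_const; apply HL'; auto. }
    assert (L2 : is_lim_seq (fun n => r * t z (S n)) (r * h z)).
    { apply is_lim_seq_mult'; [apply is_lim_seq_const|]. apply (is_lim_seq_incr_1 (t z)). apply HL'; auto. }
    assert (E0 : Finite (transfer psi F p h z) = Finite (r * h z)).
    { rewrite <- (is_lim_seq_unique _ _ L1), <- (is_lim_seq_unique _ _ L2). apply Lim_seq_ext.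
      intros n. unfold t. simpl. unfold transfer. pose proof (Hrn n). field. split; lra. }
    injection E0; auto.
  - intros z z' d Hz Hz' Hd Hcl.
    apply (is_lim_seq_le (t z) (fun n => Rpower d (3 * p) * t z' n) (h z) (Rpower d (3 * p) * h z')); auto.
    + intros n. unfold t, Rdiv. rewrite <- Rmult_assoc. apply Rmult_le_compat_r. left; apply Rinv_0_lt_compat; auto.
      replace (3 * p) with (p + 2 * p) by ring. apply (transfer_iter_Harnack X psi F p p h0 n); auto.
      intros w Hw. destruct (HS w Hw). lra.
    + apply is_lim_seq_mult'; [apply is_lim_seq_const|apply HL'; auto].
Qed.

(** * The spectrum of a weighted composition operator *)

Definition wcont (A : C -> Prop) (f : C -> C) : Prop :=
  forall z, A z -> forall e, 0 < e -> near z (fun w => A w -> Cmod (f w - f z) < e).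

Lemma continuous_on_wcont A f :
  continuous_on (T := C_UniformSpace) (U := C_UniformSpace) A f <-> wcont A f.
Proof.
  split; intros H z Hz.
  - intros e He. specialize (H z Hz (fun w => Cmod (w - f z) < e)).
    apply near_locally. apply H. apply near_locally. exists e; auto.
  - intros P HP. apply near_locally in HP. destruct HP as [e [He HP]].
    unfold filtermap, within. apply near_locally. generalize (H z Hz e He). apply filter_imp. auto.
Qed.

Lemma ccont_wcont A f : (forall z, A z -> ccont f z) -> wcont A f.
Proof. intros H z Hz e He. generalize (H z Hz e He). apply filter_imp. auto. Qed.

Lemma wcont_plus A f g : wcont A f -> wcont A g -> wcont A (fun z => f z + g z)%C.
Proof.
  intros Hf Hg z Hz e He.
  generalize (filter_and (F := near z) _ _ (Hf z Hz (e/2) ltac:(lra)) (Hg z Hz (e/2) ltac:(lra))).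
  apply filter_imp. intros w [H1 H2] Aw. specialize (H1 Aw). specialize (H2 Aw).
  replace (f w + g w - (f z + g z))%C with ((f w - f z) + (g w - g z))%C by ring.
  eapply Rle_lt_trans; [apply Cmod_triangle|lra].
Qed.

Lemma wcont_scal A c f : wcont A f -> wcont A (fun z => c * f z)%C.
Proof.
  intros Hf z Hz e He. pose proof (Cmod_ge_0 c).
  assert (He' : 0 < e / (Cmod c + 1)) by (apply Rdiv_lt_0_compat; lra).
  generalize (Hf z Hz _ He'). apply filter_imp. intros w K Aw. specialize (K Aw).
  replace (c * f w - c * f z)%C with (c * (f w - f z))%C by ring. rewrite Cmod_mult.
  apply Rle_lt_trans with (Cmod c * (e / (Cmod c + 1))). apply Rmult_le_compat_l; lra.
  apply Rlt_le_trans with ((Cmod c + 1) * (e / (Cmod c + 1))). apply Rmult_lt_compat_r; lra.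
  right; field; lra.
Qed.

Lemma wcont_csum A (u : nat -> C -> C) n : (forall k, wcont A (u k)) -> wcont A (fun z => csum (fun k => u k z) n).
Proof.
  intros H. induction n; simpl.
  - apply ccont_wcont. intros; apply ccont_const.
  - apply (wcont_plus A _ (u n)); auto.
Qed.

Lemma analytic_csum (u : nat -> C -> C) n z : (forall k, analytic_at_C (u k) z) -> analytic_at_C (fun z => csum (fun k => u k z) n) z.
Proof.
  intros H. induction n; simpl. apply analytic_const. apply (analytic_plus _ (u n)); auto.
Qed.

Lemma wcont_uniform_limit A (s : nat -> C -> C) U : (forall n, wcont A (s n)) ->
  (forall e, 0 < e -> exists n, forall z, A z -> Cmod (s n z - U z) < e) -> wcont A U.
Proof.
  intros H L z Hz e He. destruct (L (e/3)) as [n K]; [lra|].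
  generalize (H n z Hz (e/3) ltac:(lra)). apply filter_imp. intros w Hw Aw. specialize (Hw Aw).
  pose proof (K w Aw). pose proof (K z Hz). rewrite Cmod_sub_sym in H0.
  pose proof (Cmod_sub_trans (U w) (s n w) (U z)). pose proof (Cmod_sub_trans (s n w) (s n z) (U z)). lra.
Qed.

Lemma wcont_closure_bound D f M : wcont (closure D) f -> (forall z, D z -> Cmod (f z) <= M) ->
  forall z, closure D z -> Cmod (f z) <= M.
Proof.
  intros H B z Hz. apply le_epsilon. intros e He. destruct (H z Hz e He) as [d [Hd K]].
  destruct (Hz d Hd) as [w [Dw Hw]]. specialize (K w Hw (closure_incl _ _ Dw)). specialize (B w Dw).
  pose proof (Cmod_sub_lower (f z) (f w)). rewrite Cmod_sub_sym in H0. lra.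
Qed.

Lemma ratio_lt_1 a b : 0 < a < b -> 0 <= a / b < 1.
Proof.
  intros H. split. left; apply Rdiv_lt_0_compat; lra. apply Rmult_lt_reg_r with b; [lra|].
  unfold Rdiv; rewrite Rmult_assoc, Rinv_l; lra.
Qed.

Lemma Csub_eq_0 (a b : C) : (a - b)%C = RtoC 0 -> a = b.
Proof. intros H. transitivity (a - b + b)%C; [ring|rewrite H; ring]. Qed.

Lemma Cmod_sub_eq_0 a b : Cmod (a - b) = 0 -> a = b.
Proof. intros H. apply Csub_eq_0, Cmod_eq_0, H. Qed.

Definition wco (psi G : bool -> C -> C) (u : C -> C) (z : C) : C :=
  (G true z * u (psi true z) + G false z * u (psi false z))%C.

Lemma wco_plus psi G u v z : wco psi G (fun w => u w + v w)%C z = (wco psi G u z + wco psi G v z)%C.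
Proof. unfold wco. ring. Qed.

Lemma wco_scal psi G c u z : wco psi G (fun w => c * u w)%C z = (c * wco psi G u z)%C.
Proof. unfold wco. ring. Qed.

(** Such an [h] makes [sup |u / h|] an equivalent norm, in which every operator
    [wco psi G] with [|G| = |F|^p] has norm at most [r]. *)
Definition pos_eigen (X : C -> Prop) psi F p (r : R) (h : C -> R) (c1 c2 : R) : Prop :=
  0 < r /\ 0 < c1 /\ (forall z, X z -> c1 <= h z <= c2) /\
  (forall z, X z -> transfer psi F p h z = r * h z).

Lemma wco_bound (X : C -> Prop) psi F G p r h c1 c2 u M :
  (forall b z, X z -> X (psi b z)) -> (forall b z, X z -> Cmod (G b z) = Rpower (Cmod (F b z)) p) ->
  pos_eigen X psi F p r h c1 c2 ->
  (forall z, X z -> Cmod (u z) <= M * h z) -> forall z, X z -> Cmod (wco psi G u z) <= r * M * h z.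
Proof.
  intros HX HG [Hr [Hc [Hh He]]] Hu z Hz. unfold wco.
  eapply Rle_trans; [apply Cmod_triangle|]. rewrite !Cmod_mult, !HG by auto.
  replace (r * M * h z) with (M * (r * h z)) by ring. rewrite <- He by auto. unfold transfer.
  rewrite Rmult_plus_distr_l. pose proof (Rpower_pos (Cmod (F true z)) p). pose proof (Rpower_pos (Cmod (F false z)) p).
  apply Rplus_le_compat.
  - replace (M * (Rpower (Cmod (F true z)) p * h (psi true z))) with (Rpower (Cmod (F true z)) p * (M * h (psi true z))) by ring.
    apply Rmult_le_compat_l; auto; lra.
  - replace (M * (Rpower (Cmod (F false z)) p * h (psi false z))) with (Rpower (Cmod (F false z)) p * (M * h (psi false z))) by ring.
    apply Rmult_le_compat_l; auto; lra.
Qed.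

(** The difference of two solutions satisfies [|mu| |u| <= transfer |u|];
    iterate. *)
Lemma wco_unique (X : C -> Prop) psi F G p r h c1 c2 U V B mu :
  (forall b z, X z -> X (psi b z)) -> (forall b z, X z -> Cmod (G b z) = Rpower (Cmod (F b z)) p) ->
  pos_eigen X psi F p r h c1 c2 -> r < Cmod mu ->
  (forall z, X z -> Cmod (U z) <= B) -> (forall z, X z -> Cmod (V z) <= B) ->
  (forall z, X z -> (mu * U z - wco psi G U z)%C = (mu * V z - wco psi G V z)%C) ->
  forall z, X z -> U z = V z.
Proof.
  intros HX HG PE Hmu HU HV HE z Hz. assert (PE' := PE). destruct PE' as [Hr [Hc [Hh _]]].
  set (q := r / Cmod mu).
  assert (Hq : 0 <= q < 1) by (apply ratio_lt_1; lra).
  set (u := fun w => (U w - V w)%C). set (M := 2 * B / c1).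
  assert (HB : 0 <= B) by (pose proof (Cmod_ge_0 (U z)); specialize (HU z Hz); lra).
  assert (IT : forall n z, X z -> Cmod (u z) <= M * q ^ n * h z).
  { induction n; intros w Hw.
    - simpl. destruct (Hh w Hw). apply Rle_trans with (2 * B).
      { eapply Rle_trans; [apply Cmod_sub_upper|]. specialize (HU w Hw). specialize (HV w Hw). lra. }
      rewrite Rmult_1_r. apply Rle_trans with (M * c1). right; unfold M; field; lra.
      apply Rmult_le_compat_l; auto. apply Rmult_le_pos; [lra|]. left; apply Rinv_0_lt_compat; auto.
    - apply Rmult_le_reg_l with (Cmod mu); [lra|]. rewrite <- Cmod_mult.
      replace (mu * u w)%C with (wco psi G u w).
      2:{ unfold u. transitivity (wco psi G U w - wco psi G V w)%C. unfold wco; ring.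
          transitivity (wco psi G U w + (mu * U w - wco psi G U w) - (mu * V w - wco psi G V w) - wco psi G V w)%C.
          rewrite HE by auto. ring. ring. }
      eapply Rle_trans; [apply (wco_bound X psi F G p r h c1 c2 u (M * q ^ n)); auto|].
      right. simpl. unfold q. field. lra. }
  apply Cmod_sub_eq_0. apply Rle_antisym; [|apply Cmod_ge_0]. apply le_epsilon. intros e He0.
  destruct (pow_lt_1_small q (M * h z) e Hq He0) as [n K]. specialize (K n (Nat.le_refl n)).
  specialize (IT n z Hz). unfold u in IT. nra.
Qed.

Lemma rsum_geom_le B q n : 0 <= B -> 0 <= q < 1 -> rsum (fun k => B * q ^ k) n <= B / (1 - q).
Proof.
  intros HB Hq.
  assert (E : rsum (fun k => B * q ^ k) n = B / (1 - q) * (1 - q ^ n)).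
  { induction n; simpl. ring. rewrite IHn. field. lra. }
  rewrite E. assert (0 <= B / (1 - q)). { apply Rmult_le_pos; auto. left; apply Rinv_0_lt_compat; lra. }
  pose proof (pow_le q n ltac:(lra)). nra.
Qed.

Lemma ex_series_geom_scal B q : 0 <= q < 1 -> ex_series (fun k => B * q ^ k).
Proof.
  intros Hq. apply (ex_series_scal (K := R_AbsRing) (V := R_NormedModule) B (fun k => q ^ k)).
  apply ex_series_geom. rewrite Rabs_pos_eq; lra.
Qed.

Lemma csum_tail (u : nat -> C) n m : csum u (n + m) = (csum u n + csum (fun k => u (n + k)%nat) m)%C.
Proof. induction m. rewrite Nat.add_0_r; simpl; ring. rewrite Nat.add_succ_r. simpl. rewrite IHm. ring. Qed.

Definition real_point (A : C -> Prop) (z : C) : Prop := A z /\ Im z = 0.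

(** The last clause makes [wco psi G] a positive operator on the functions on
    the real points of [closure D]. *)
Definition weighted_ifs (D : C -> Prop) (psi F G : bool -> C -> C) (p : R) : Prop :=
  ifs D psi F /\
  (forall b z, closure D z -> analytic_at_C (G b) z) /\
  (forall b z, closure D z -> Cmod (G b z) = Rpower (Cmod (F b z)) p) /\
  (forall b z, real_point (closure D) z -> Im (psi b z) = 0 /\ Im (G b z) = 0 /\ 0 <= Re (G b z)).

(** The Neumann series, in the norm weighted by the positive eigenfunction. *)
Lemma wco_resolvent D psi F G p r h c1 c2 mu :
  open (T := C_UniformSpace) D -> weighted_ifs D psi F G p ->
  pos_eigen (closure D) psi F p r h c1 c2 -> r < Cmod mu ->
  exists K, 0 <= K /\ forall A N, analytic_on D A -> wcont (closure D) A -> 0 <= N ->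
    (forall z, closure D z -> Cmod (A z) <= N) ->
    exists U, analytic_on D U /\ wcont (closure D) U /\ (forall z, closure D z -> Cmod (U z) <= K * N) /\
      forall z, closure D z -> (mu * U z - wco psi G U z)%C = A z.
Proof.
  intros OD [HI [GA [HG _]]] PE Hmu. assert (PE' := PE). destruct PE' as [Hr [Hc [Hh He]]].
  assert (HX : forall b z, closure D z -> closure D (psi b z)).
  { intros b z Hz. apply (psiw_in_closure D psi F (b :: nil)); auto. }
  assert (HXD : forall b z, closure D z -> D (psi b z)).
  { intros b z Hz. apply maps_inside_in; auto. apply HI. }
  set (q := r / Cmod mu).
  assert (Hq : 0 <= q < 1) by (apply ratio_lt_1; lra).
  assert (Nmu : mu <> RtoC 0) by (apply Cmod_gt_0; lra).
  set (K := Rabs c2 / (c1 * Cmod mu) / (1 - q)).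
  assert (HK : 0 <= K).
  { unfold K. repeat apply Rmult_le_pos; try apply Rabs_pos; left; apply Rinv_0_lt_compat; try lra. apply Rmult_lt_0_compat; lra. }
  exists K. split; auto. intros A N AA AC HN AB.
  set (An := fix An n := match n with O => A | S n => wco psi G (An n) end).
  set (B := N * Rabs c2 / (c1 * Cmod mu)).
  assert (HB : 0 <= B).
  { apply Rmult_le_pos. apply Rmult_le_pos; auto; apply Rabs_pos. left; apply Rinv_0_lt_compat, Rmult_lt_0_compat; lra. }
  assert (BAn : forall n z, closure D z -> Cmod (An n z) <= (r ^ n * (N / c1)) * h z).
  { induction n; intros z Hz.
    - simpl. destruct (Hh z Hz). eapply Rle_trans; [apply AB; auto|]. rewrite Rmult_1_l.
      apply Rle_trans with (N / c1 * c1). right; field; lra. apply Rmult_le_compat_l; auto.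
      apply Rmult_le_pos; auto. left; apply Rinv_0_lt_compat; auto.
    - simpl An. eapply Rle_trans; [apply (wco_bound (closure D) psi F G p r h c1 c2 (An n) (r ^ n * (N / c1))); auto|].
      right; simpl; ring. }
  assert (WA : forall u, analytic_on D u -> forall z, closure D z -> analytic_at_C (wco psi G u) z).
  { intros u Hu z Hz. unfold wco. apply analytic_plus; apply analytic_mult; auto.
    apply (analytic_comp u (psi true)); [apply HI; auto|]. apply Hu, HXD, Hz.
    apply (analytic_comp u (psi false)); [apply HI; auto|]. apply Hu, HXD, Hz. }
  assert (AnA : forall n, analytic_on D (An n)).
  { induction n; auto. intros z Dz. apply WA; auto. apply closure_incl; auto. }
  assert (AnC : forall n, wcont (closure D) (An n)).
  { intros [|n]; auto. apply ccont_wcont. intros z Hz. apply analytic_ccont. apply WA; auto. }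
  set (T := fun k z => (Cpow (/ mu) (S k) * An k z)%C).
  assert (BT : forall k z, closure D z -> Cmod (T k z) <= B * q ^ k).
  { intros k z Hz. unfold T. rewrite Cmod_mult, Cmod_pow, Cmod_inv by auto.
    specialize (BAn k z Hz). destruct (Hh z Hz).
    assert (PM : 0 < (/ Cmod mu) ^ S k) by (apply pow_lt, Rinv_0_lt_compat; lra).
    apply Rle_trans with ((/ Cmod mu) ^ S k * (r ^ k * (N / c1) * Rabs c2)).
    - apply Rmult_le_compat_l; [lra|]. eapply Rle_trans; [apply BAn|]. apply Rmult_le_compat_l.
      apply Rmult_le_pos. apply pow_le; lra. apply Rmult_le_pos; auto. left; apply Rinv_0_lt_compat; auto.
      pose proof (Rle_abs c2); lra.
    - right. unfold B, q, Rdiv. rewrite Rpow_mult_distr. simpl. field. split; lra. }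
  assert (EXU : forall z, exists l, closure D z -> clim (csum (fun k => T k z)) l).
  { intros z. destruct (classic (closure D z)) as [Hz|]; [|exists (RtoC 0); tauto].
    destruct (clim_abs (fun k => T k z) (fun k => B * q ^ k)) as [l L]; auto. apply ex_series_geom_scal; auto.
    exists l; auto. }
  destruct (choice _ EXU) as [U HU].
  assert (TAIL : forall n z, closure D z -> Cmod (csum (fun k => T k z) n - U z) <= B / (1 - q) * q ^ n).
  { intros n z Hz. rewrite Cmod_sub_sym.
    apply (clim_le (fun m => (csum (fun k => T k z) (n + m) + RtoC (-1) * csum (fun k => T k z) n)%C)).
    - replace (U z - csum (fun k => T k z) n)%C with (U z + RtoC (-1) * csum (fun k => T k z) n)%C by ring.
      apply (clim_plus _ (fun _ => RtoC (-1) * csum (fun k => T k z) n)%C); [|apply tendsto_const, _].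
      intros e He0. destruct (HU z Hz e He0) as [M HM]. exists M. intros m Hm. apply HM. lia.
    - exists 0%nat. intros m _. rewrite csum_tail.
      replace (csum (fun k => T k z) n + csum (fun k => T (n + k)%nat z) m + RtoC (-1) * csum (fun k => T k z) n)%C
        with (csum (fun k => T (n + k)%nat z) m) by ring.
      eapply Rle_trans. apply Cmod_csum_le with (b := fun k => (B * q ^ n) * q ^ k).
      intros k _. eapply Rle_trans; [apply BT; auto|]. rewrite pow_add. right; ring.
      eapply Rle_trans; [apply rsum_geom_le; auto|]. apply Rmult_le_pos; auto; apply pow_le; lra. right; field; lra. }
  assert (UNIF : forall e, 0 < e -> exists n, forall z, closure D z -> Cmod (csum (fun k => T k z) n - U z) < e).
  { intros e He0. destruct (pow_lt_1_small q (B / (1 - q)) e Hq He0) as [n K0]. exists n. intros z Hz.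
    eapply Rle_lt_trans; [apply TAIL; auto|]. apply K0; auto. }
  assert (BU : forall z, closure D z -> Cmod (U z) <= K * N).
  { intros z Hz. specialize (TAIL 0%nat z Hz). simpl in TAIL. rewrite Cmod_sub_sym in TAIL.
    replace (U z - RtoC 0)%C with (U z) in TAIL by ring. eapply Rle_trans; [apply TAIL|].
    right. unfold B, K. field. split; lra. }
  exists U. split; [|split; [|split; auto]].
  - intros z Dz. destruct (open_near D z OD Dz) as [d [Hd HD]].
    apply (analytic_uniform_limit (fun n z => csum (fun k => T k z) n) U z d (K * N)); auto.
    + intros n w Hw.
      assert (AS : forall v, D v -> analytic_at_C (fun z => csum (fun k => T k z) n) v).
      { intros v Dv. apply analytic_csum. intros k. apply analytic_scal, AnA, Dv. }
      split. apply analytic_cderiv; auto. apply analytic_ccont, analytic_C_derive; auto.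
    + intros w Hw. apply BU, closure_incl; auto.
    + intros e He0. destruct (UNIF e He0) as [n K0]. exists n. intros w Hw. apply K0, closure_incl; auto.
  - apply (wcont_uniform_limit _ (fun n z => csum (fun k => T k z) n)); auto.
    intros n. apply wcont_csum. intros k. apply wcont_scal, AnC.
  - intros z Hz.
    assert (ID : forall n, wco psi G (fun w => csum (fun k => T k w) n) z = (mu * csum (fun k => T k z) (S n) + RtoC (-1) * A z)%C).
    { induction n. unfold wco, T. simpl. field. auto.
      change (csum (fun k => T k z) (S (S n))) with (csum (fun k => T k z) (S n) + T (S n) z)%C.
      replace (wco psi G (fun w => csum (fun k => T k w) (S n)) z) with
        (wco psi G (fun w => csum (fun k => T k w) n) z + wco psi G (T n) z)%C.
      2:{ rewrite <- wco_plus. reflexivity. }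
      assert (WT : wco psi G (T n) z = (mu * T (S n) z)%C).
      { unfold T. rewrite wco_scal.
        change (Cpow (/ mu) (S (S n))) with (/ mu * Cpow (/ mu) (S n))%C.
        change (An (S n) z) with (wco psi G (An n) z). field. auto. }
      rewrite IHn, WT. ring. }
    assert (L1 : clim (fun n => wco psi G (fun w => csum (fun k => T k w) n) z) (wco psi G U z)).
    { unfold wco. apply clim_plus; apply clim_scal; apply HU; auto. }
    assert (L2 : clim (fun n => wco psi G (fun w => csum (fun k => T k w) n) z) (mu * U z + RtoC (-1) * A z)%C).
    { eapply clim_ext; [intros n; symmetry; apply ID|]. apply (clim_plus _ (fun _ => RtoC (-1) * A z)%C); [|apply tendsto_const, _].
      apply clim_scal. apply (clim_shift (csum (fun k => T k z))), HU; auto. }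
    rewrite (clim_unique _ _ _ L1 L2). ring.
Qed.

Lemma sup_norm_le A f M : (exists z, A z) -> 0 <= M -> (forall z, A z -> Cmod (f z) <= M) -> sup_norm A f <= M.
Proof.
  intros [z0 Hz0] HM H. unfold sup_norm.
  destruct (Lub_Rbar_correct (fun r => exists z, A z /\ r = Cmod (f z))) as [U V].
  assert (W : Rbar_le (Lub_Rbar (fun r => exists z, A z /\ r = Cmod (f z))) M).
  { apply V. intros x [z [Hz ->]]. simpl; auto. }
  destruct (Lub_Rbar _) as [l| |]; simpl in *; auto; tauto.
Qed.

Lemma sup_norm_ge A f M z : (forall z, A z -> Cmod (f z) <= M) -> A z -> Cmod (f z) <= sup_norm A f.
Proof.
  intros H Hz. unfold sup_norm.
  destruct (Lub_Rbar_correct (fun r => exists z, A z /\ r = Cmod (f z))) as [U V].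
  assert (W : Rbar_le (Lub_Rbar (fun r => exists z, A z /\ r = Cmod (f z))) M).
  { apply V. intros x [w [Hw ->]]. simpl; auto. }
  assert (U' : Rbar_le (Cmod (f z)) (Lub_Rbar (fun r => exists z, A z /\ r = Cmod (f z)))).
  { apply U. exists z; auto. }
  destruct (Lub_Rbar _) as [l| |]; simpl in *; auto; tauto.
Qed.

Lemma Hr_bound D h : Hr D h -> exists M, 0 <= M /\ forall z, closure D z -> Cmod (h z) <= M.
Proof.
  intros [_ [[M HM] [HC _]]]. apply continuous_on_wcont in HC. exists (Rabs M). split; [apply Rabs_pos|].
  intros z Hz. eapply Rle_trans; [|apply Rle_abs]. apply (wcont_closure_bound D h M); auto.
Qed.

Lemma real_point_RtoC z : Im z = 0 -> z = RtoC (Re z).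
Proof. destruct z as [x y]. unfold Im, Re; simpl. intros ->. reflexivity. Qed.

Lemma Ci_pair p q : (p + Ci * q)%C = RtoC 0 -> (p - Ci * q)%C = RtoC 0 -> p = RtoC 0 /\ q = RtoC 0.
Proof.
  destruct p as [p1 p2], q as [q1 q2]. intros H K. injection H. injection K. intros.
  split; apply injective_projections; simpl; lra.
Qed.

Lemma Ci_pair_exists U1 U2 : let u := (RtoC (1/2) * (U1 + U2))%C in let v := (RtoC (1/2) * (Ci * (U2 - U1)))%C in
  (u + Ci * v)%C = U1 /\ (u - Ci * v)%C = U2.
Proof. destruct U1, U2. split; apply injective_projections; simpl; field. Qed.

(** A formal pair [u + i v] is determined by the functions [u + Ci v] and
    [u - Ci v], on which the complexified operator acts by [mu - K] and by
    [Cconj mu - K]. *)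
Lemma solves_split D psi G mu u v a b : solves D (wco psi G) mu u v a b <-> forall z, closure D z ->
  (mu * (u z + Ci * v z) - wco psi G (fun w => u w + Ci * v w) z)%C = (a z + Ci * b z)%C /\
  (Cconj mu * (u z - Ci * v z) - wco psi G (fun w => u w - Ci * v w) z)%C = (a z - Ci * b z)%C.
Proof.
  assert (E : forall z,
    let e1 := (RtoC (Re mu) * u z - RtoC (Im mu) * v z - wco psi G u z - a z)%C in
    let e2 := (RtoC (Im mu) * u z + RtoC (Re mu) * v z - wco psi G v z - b z)%C in
    (mu * (u z + Ci * v z) - wco psi G (fun w => u w + Ci * v w) z)%C = (a z + Ci * b z + (e1 + Ci * e2))%C /\
    (Cconj mu * (u z - Ci * v z) - wco psi G (fun w => u w - Ci * v w) z)%C = (a z - Ci * b z + (e1 - Ci * e2))%C).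
  { intros z. unfold wco. destruct mu as [x y]. change (Cconj (x, y)) with (x, - y). unfold Re, Im; simpl fst; simpl snd.
    replace (x, y) with (RtoC x + Ci * RtoC y)%C by (apply injective_projections; simpl; ring).
    replace (x, - y) with (RtoC x - Ci * RtoC y)%C by (apply injective_projections; simpl; ring).
    assert (I2 : (Ci * Ci)%C = (- RtoC 1)%C) by (apply injective_projections; simpl; ring).
    split; ring [I2]. }
  split; intros H z Hz; destruct (E z) as [E1 E2]; cbv zeta in E1, E2; destruct (H z Hz) as [H1 H2].
  - rewrite H1, H2 in E1, E2. split; [rewrite E1|rewrite E2]; ring.
  - rewrite E1 in H1. rewrite E2 in H2.
    match type of H1 with (_ + (?e1 + Ci * ?e2))%C = _ => destruct (Ci_pair e1 e2) as [Z1 Z2] end.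
    + rewrite <- (Cplus_opp_r (a z + Ci * b z)). rewrite <- H1 at 1. ring.
    + rewrite <- (Cplus_opp_r (a z - Ci * b z)). rewrite <- H2 at 1. ring.
    + split; apply Csub_eq_0; auto.
Qed.

Lemma weighted_ifs_real D psi F G p U V z : weighted_ifs D psi F G p -> real_point (closure D) z ->
  (forall w, real_point (closure D) w -> V w = Cconj (U w)) -> wco psi G V z = Cconj (wco psi G U z).
Proof.
  intros [HI [_ [_ RD]]] Hz H. unfold wco. rewrite Cplus_conj, !Cmult_conj, !H.
  - f_equal; f_equal; [destruct (RD true z Hz) as [_ [I _]]|destruct (RD false z Hz) as [_ [I _]]];
      rewrite (real_point_RtoC _ I); apply injective_projections; simpl; ring.
  - split; [apply (psiw_in_closure D psi F (false :: nil) z HI), Hz|apply RD; auto].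
  - split; [apply (psiw_in_closure D psi F (true :: nil) z HI), Hz|apply RD; auto].
Qed.

Lemma Hr_intro D h : analytic_on D h -> wcont (closure D) h -> (exists M, forall z, closure D z -> Cmod (h z) <= M) ->
  (forall z, real_point (closure D) z -> Im (h z) = 0) -> Hr D h.
Proof.
  intros HA HC [M HM] HR. split; [|split; [|split]]; auto.
  - exists M. intros; apply HM, closure_incl; auto.
  - apply continuous_on_wcont; auto.
  - intros x Hx. apply HR. split; auto.
Qed.

(** The Neumann series solves the equations for [u + Ci v] and [u - Ci v]
    separately.  That [u] and [v] are real on the reals follows from uniqueness
    on the real points, where the second solution is conjugate to the first. *)
Lemma resolvent_beyond D psi F G p r h c1 c2 mu : (exists z, closure D z) ->
  open (T := C_UniformSpace) D -> weighted_ifs D psi F G p -> pos_eigen (closure D) psi F p r h c1 c2 ->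
  r < Cmod mu -> resolvent_set D (wco psi G) mu.
Proof.
  intros NE OD WI PE Hmu. assert (WI' := WI). destruct WI' as [HI [_ [HG RD]]].
  assert (HX : forall b z, closure D z -> closure D (psi b z)).
  { intros b z Hz. apply (psiw_in_closure D psi F (b :: nil)); auto. }
  assert (Hmu' : r < Cmod (Cconj mu)) by (rewrite Cmod_conj; auto).
  destruct (wco_resolvent D psi F G p r h c1 c2 mu OD WI PE Hmu) as [K1 [HK1 R1]].
  destruct (wco_resolvent D psi F G p r h c1 c2 (Cconj mu) OD WI PE Hmu') as [K2 [HK2 R2]].
  exists (2 * (K1 + K2)). intros a b Ha Hb.
  destruct (Hr_bound D a Ha) as [Ma [HMa Ba]]. destruct (Hr_bound D b Hb) as [Mb [HMb Bb]].
  assert (BaN : forall z, closure D z -> Cmod (a z) <= sup_norm (closure D) a) by (intros; eapply sup_norm_ge; eauto).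
  assert (BbN : forall z, closure D z -> Cmod (b z) <= sup_norm (closure D) b) by (intros; eapply sup_norm_ge; eauto).
  set (N := sup_norm (closure D) a + sup_norm (closure D) b).
  destruct Ha as [aA [_ [aC aR]]]. destruct Hb as [bA [_ [bC bR]]]. apply continuous_on_wcont in aC, bC.
  assert (PAIR : forall (f g : C -> C) M1 M2, (forall z, closure D z -> Cmod (f z) <= M1) -> (forall z, closure D z -> Cmod (g z) <= M2) ->
    forall c z, Cmod c = 1 -> closure D z -> Cmod (f z + c * g z) <= M1 + M2).
  { intros f g M1 M2 Hf Hg c z Hc Hz. eapply Rle_trans; [apply Cmod_triangle|]. rewrite Cmod_mult, Hc, Rmult_1_l.
    apply Rplus_le_compat; auto. }
  assert (C1 : Cmod (- Ci) = 1) by (rewrite Cmod_opp; apply Cmod_Ci).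
  assert (HN : 0 <= N).
  { destruct NE as [z Hz]. eapply Rle_trans; [apply Cmod_ge_0|]. apply (PAIR a b _ _ BaN BbN Ci z Cmod_Ci Hz). }
  destruct (R1 (fun z => a z + Ci * b z)%C N) as [U1 [U1A [U1C [U1B U1E]]]]; auto.
  { intros z Dz. apply analytic_plus; [apply aA, Dz|apply analytic_scal, bA, Dz]. }
  { apply wcont_plus; auto. apply wcont_scal; auto. }
  { intros z Hz. apply PAIR; auto using Cmod_Ci. }
  destruct (R2 (fun z => a z + - Ci * b z)%C N) as [U2 [U2A [U2C [U2B U2E]]]]; auto.
  { intros z Dz. apply analytic_plus; [apply aA, Dz|apply analytic_scal, bA, Dz]. }
  { apply wcont_plus; auto. apply wcont_scal; auto. }
  { intros z Hz. apply PAIR; auto. }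
  assert (BU1 : forall z, closure D z -> Cmod (U1 z) <= (K1 + K2) * N).
  { intros z Hz. specialize (U1B z Hz). assert (0 <= K2 * N) by (apply Rmult_le_pos; auto). lra. }
  assert (BU2 : forall z, closure D z -> Cmod (U2 z) <= (K1 + K2) * N).
  { intros z Hz. specialize (U2B z Hz). assert (0 <= K1 * N) by (apply Rmult_le_pos; auto). lra. }
  (* at real points both sides solve the equation with the conjugate of mu *)
  assert (REAL : forall z, real_point (closure D) z -> U2 z = Cconj (U1 z)).
  { apply (wco_unique (real_point (closure D)) psi F G p r h c1 c2 U2 (fun z => Cconj (U1 z)) ((K1 + K2) * N) (Cconj mu)); auto.
    - intros d z Hz. split; [apply HX, Hz|apply RD; auto].
    - intros d z [Hz _]; auto.
    - destruct PE as [P1 [P2 [P3 P4]]]. split; [|split; [|split]]; auto; intros z [Hz _]; auto.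
    - intros z [Hz _]; auto.
    - intros z [Hz _]; rewrite Cmod_conj; auto.
    - intros z Hz. destruct (Hz) as [Cz Rz]. rewrite U2E by auto.
      rewrite (weighted_ifs_real D psi F G p U1 (fun w => Cconj (U1 w)) z WI Hz) by auto.
      rewrite <- Cmult_conj, <- Cminus_conj, U1E by auto.
      assert (Ra := aR (Re z)). assert (Rb := bR (Re z)). rewrite <- (real_point_RtoC z Rz) in Ra, Rb.
      rewrite (real_point_RtoC _ (Ra Cz)), (real_point_RtoC _ (Rb Cz)). apply injective_projections; simpl; ring. }
  set (u := fun z => (RtoC (1/2) * (U1 z + U2 z))%C).
  set (v := fun z => (RtoC (1/2) * (Ci * (U2 z + RtoC (-1) * U1 z)))%C).
  assert (UV : forall z, (u z + Ci * v z)%C = U1 z /\ (u z - Ci * v z)%C = U2 z).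
  { intros z. replace (v z) with (RtoC (1/2) * (Ci * (U2 z - U1 z)))%C by (unfold v; ring). apply Ci_pair_exists. }
  assert (Bu : forall z, closure D z -> Cmod (u z) <= (K1 + K2) * N).
  { intros z Hz. unfold u. rewrite Cmod_mult_R, Rabs_pos_eq by lra. pose proof (Cmod_triangle (U1 z) (U2 z)).
    specialize (BU1 z Hz). specialize (BU2 z Hz). lra. }
  assert (Bv : forall z, closure D z -> Cmod (v z) <= (K1 + K2) * N).
  { intros z Hz. unfold v. rewrite Cmod_mult_R, Cmod_mult, Cmod_Ci, Rabs_pos_eq by lra.
    replace (U2 z + RtoC (-1) * U1 z)%C with (U2 z - U1 z)%C by ring. pose proof (Cmod_sub_upper (U2 z) (U1 z)).
    specialize (BU1 z Hz). specialize (BU2 z Hz). lra. }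
  exists u, v. split; [|split; [|split; [|split]]].
  - apply Hr_intro; eauto.
    + intros z Dz. apply analytic_scal, analytic_plus; auto.
    + apply wcont_scal, wcont_plus; auto.
    + intros z Hz. unfold u. rewrite REAL by auto. destruct (U1 z). unfold Im; simpl. ring.
  - apply Hr_intro; eauto.
    + intros z Dz. apply analytic_scal, analytic_scal, analytic_plus; auto. apply analytic_scal; auto.
    + apply wcont_scal, wcont_scal, wcont_plus; auto. apply wcont_scal; auto.
    + intros z Hz. unfold v. rewrite REAL by auto. destruct (U1 z). unfold Im; simpl. ring.
  - apply solves_split. intros z Hz. destruct (UV z) as [V1 V2].
    assert (W1 : wco psi G (fun w => u w + Ci * v w)%C z = wco psi G U1 z) by (unfold wco; rewrite !(proj1 (UV _)); auto).
    assert (W2 : wco psi G (fun w => u w - Ci * v w)%C z = wco psi G U2 z) by (unfold wco; rewrite !(proj2 (UV _)); auto).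
    rewrite V1, V2, W1, W2, U1E, U2E by auto. split; ring.
  - fold N. assert (sup_norm (closure D) u <= (K1 + K2) * N) by (apply sup_norm_le; auto; apply Rmult_le_pos; lra).
    assert (sup_norm (closure D) v <= (K1 + K2) * N) by (apply sup_norm_le; auto; apply Rmult_le_pos; lra). lra.
  - intros u' v' Hu' Hv' HS. rewrite solves_split in HS.
    destruct (Hr_bound D u' Hu') as [Mu [HMu BMu]]. destruct (Hr_bound D v' Hv') as [Mv [HMv BMv]].
    set (B := Mu + Mv + (K1 + K2) * N). assert (0 <= (K1 + K2) * N) by (apply Rmult_le_pos; lra).
    assert (Z1 : forall z, closure D z -> (u' z + Ci * v' z)%C = U1 z).
    { apply (wco_unique (closure D) psi F G p r h c1 c2 (fun z => u' z + Ci * v' z)%C U1 B mu); auto.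
      - intros z Hz. pose proof (PAIR u' v' _ _ BMu BMv Ci z Cmod_Ci Hz). unfold B; lra.
      - intros z Hz. specialize (BU1 z Hz). unfold B; lra.
      - intros z Hz. rewrite U1E by auto. apply HS; auto. }
    assert (Z2 : forall z, closure D z -> (u' z - Ci * v' z)%C = U2 z).
    { apply (wco_unique (closure D) psi F G p r h c1 c2 (fun z => u' z - Ci * v' z)%C U2 B (Cconj mu)); auto.
      - intros z Hz. pose proof (PAIR u' v' _ _ BMu BMv (- Ci)%C z C1 Hz).
        replace (u' z - Ci * v' z)%C with (u' z + - Ci * v' z)%C by ring. unfold B; lra.
      - intros z Hz. specialize (BU2 z Hz). unfold B; lra.
      - intros z Hz. rewrite U2E by auto. destruct (HS z Hz) as [_ E]. rewrite E. ring. }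
    assert (ZZ : forall z, closure D z -> u' z = u z /\ v' z = v z).
    { intros z Hz. destruct (UV z) as [V1 V2]. rewrite <- (Z1 z Hz) in V1. rewrite <- (Z2 z Hz) in V2.
      destruct (Ci_pair (u' z - u z) (v' z - v z)) as [E1 E2].
      - transitivity ((u' z + Ci * v' z) - (u z + Ci * v z))%C. ring. rewrite V1. ring.
      - transitivity ((u' z - Ci * v' z) - (u z - Ci * v z))%C. ring. rewrite V2. ring.
      - split; apply Csub_eq_0; auto. }
    split; intros z Hz; apply ZZ; auto.
Qed.

(** Were [(r - K) u = 1] solvable, the infimum of [u / h] over the real points
    would exceed itself. *)
Lemma growth_rate_in_spectrum D psi F G p r h c1 c2 x0 : real_point (closure D) x0 ->
  weighted_ifs D psi F G p -> pos_eigen (closure D) psi F p r h c1 c2 -> spectrum D (wco psi G) (RtoC r).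
Proof.
  intros Hx0 [HI [_ [HG RD]]] [Hr0 [Hc [Hh He]]] [M HM].
  set (XR := real_point (closure D)) in *.
  assert (HXR : forall b z, XR z -> XR (psi b z)).
  { intros b z Hz. split; [apply (psiw_in_closure D psi F (b :: nil) z HI), Hz|apply RD; auto]. }
  assert (HC : forall x : R, Hr D (fun _ => RtoC x)).
  { intros x. apply Hr_intro.
    - intros z _. apply analytic_const.
    - apply ccont_wcont. intros; apply ccont_const.
    - eexists. intros; apply Rle_refl.
    - intros; reflexivity. }
  destruct (HM _ _ (HC 1) (HC 0)) as [u [v [Hu [_ [HS _]]]]].
  destruct (Hr_bound D u Hu) as [Mu [HMu BMu]]. destruct Hu as [_ [_ [_ uR]]].
  assert (UR : forall z, XR z -> u z = RtoC (Re (u z))).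
  { intros z [Hz Rz]. apply real_point_RtoC. rewrite (real_point_RtoC z Rz). apply uR. rewrite <- real_point_RtoC; auto. }
  assert (GR : forall b z, XR z -> G b z = RtoC (Rpower (Cmod (F b z)) p)).
  { intros b z Hz. destruct (RD b z Hz) as [_ [I P]]. rewrite <- HG by apply Hz.
    rewrite (real_point_RtoC _ I). rewrite Cmod_RtoC_pos; auto. }
  assert (EQ : forall z, XR z -> r * Re (u z) = transfer psi F p (fun w => Re (u w)) z + 1).
  { intros z Hz. destruct (HS z (proj1 Hz)) as [S1 _]. unfold wco in S1.
    rewrite !GR, (UR _ (HXR true z Hz)), (UR _ (HXR false z Hz)), (UR z Hz) in S1 by auto.
    apply (f_equal Re) in S1. unfold transfer. change (Re (RtoC r)) with r in S1. change (Im (RtoC r)) with 0 in S1.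
    unfold Re in *. simpl in S1. lra. }
  destruct (completeness (fun x => exists z, XR z /\ x = - (Re (u z) / h z))) as [m [UB LB]].
  { exists (Mu / c1). intros x [z [Hz ->]]. destruct (Hh z (proj1 Hz)) as [h1 h2].
    pose proof (component_le Re (u z) component_Re) as Q. specialize (BMu z (proj1 Hz)).
    pose proof (Rle_abs (- Re (u z))) as Q'. rewrite Rabs_Ropp in Q'.
    replace (- (Re (u z) / h z)) with (- Re (u z) / h z) by (field; lra).
    apply Rle_trans with (Mu / h z). apply Rmult_le_compat_r. left; apply Rinv_0_lt_compat; lra. lra.
    apply Rmult_le_compat_l; auto. apply Rinv_le_contravar; auto. }
  { exists (- (Re (u x0) / h x0)), x0. auto. }
  assert (Hc2 : 0 < c2) by (specialize (Hh x0 (proj1 Hx0)); lra).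
  assert (m <= m - / (r * c2)).
  { apply LB. intros x [z [Hz ->]]. destruct (Hh z (proj1 Hz)) as [h1 h2].
    assert (T : - m * (r * h z) <= transfer psi F p (fun w => Re (u w)) z).
    { rewrite <- He by apply Hz. rewrite <- transfer_scal. apply (transfer_mono XR); auto.
      intros w Hw. destruct (Hh w (proj1 Hw)). assert (- (Re (u w) / h w) <= m) by (apply UB; exists w; auto).
      apply Rle_trans with (Re (u w) / h w * h w). apply Rmult_le_compat_r; lra. right; field; lra. }
    specialize (EQ z Hz).
    assert (EE : - m + / (r * c2) <= Re (u z) / h z).
    { apply Rmult_le_reg_r with (r * h z). apply Rmult_lt_0_compat; lra.
      replace (Re (u z) / h z * (r * h z)) with (r * Re (u z)) by (field; lra).
      assert (/ (r * c2) * (r * h z) <= 1).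
      { replace (/ (r * c2) * (r * h z)) with (h z / c2) by (field; lra).
        apply Rmult_le_reg_r with c2; auto. unfold Rdiv. rewrite Rmult_assoc, Rinv_l; lra. }
      lra. }
    lra. }
  assert (0 < / (r * c2)) by (apply Rinv_0_lt_compat, Rmult_lt_0_compat; auto). lra.
Qed.

Theorem wco_spectral_radius D psi F G p r h c1 c2 x0 :
  open (T := C_UniformSpace) D -> real_point (closure D) x0 -> weighted_ifs D psi F G p ->
  pos_eigen (closure D) psi F p r h c1 c2 -> spectral_radius D (wco psi G) = r.
Proof.
  intros OD Hx0 WI PE. unfold spectral_radius.
  replace (Lub_Rbar (fun x => exists mu, spectrum D (wco psi G) mu /\ x = Cmod mu)) with (Finite r); auto.
  symmetry. apply is_lub_Rbar_unique. split.
  - intros x [mu [Hmu ->]]. simpl. apply Rnot_lt_le. intros L. apply Hmu.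
    apply (resolvent_beyond D psi F G p r h c1 c2); auto. exists x0; apply Hx0.
  - intros b Hb. apply Hb. exists (RtoC r). split. apply (growth_rate_in_spectrum D psi F G p r h c1 c2 x0); auto.
    rewrite Cmod_RtoC_pos; auto. left; apply PE.
Qed.

(** * Pressure inequalities on the interval *)

Definition rtransfer (t1 t2 w1 w2 : R -> R) (p : R) (h : R -> R) (x : R) : R :=
  Rpower (w1 x) p * h (t1 x) + Rpower (w2 x) p * h (t2 x).

Definition pos_cont (h : R -> R) : Prop := forall x, in_I x -> 0 < h x /\ continuity_pt h x.

Definition eig (t1 t2 w1 w2 : R -> R) (p r : R) (h : R -> R) : Prop :=
  pos_cont h /\ forall x, in_I x -> rtransfer t1 t2 w1 w2 p h x = r * h x.

Definition stays (t : R -> R) : Prop := forall x, in_I x -> in_I (t x).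

Lemma in_I_0 : in_I 0. Proof. unfold in_I; lra. Qed.
Lemma in_I_1 : in_I 1. Proof. unfold in_I; lra. Qed.

Lemma rtransfer_mono t1 t2 w1 w2 p u v x : stays t1 -> stays t2 -> in_I x ->
  (forall y, in_I y -> u y <= v y) -> rtransfer t1 t2 w1 w2 p u x <= rtransfer t1 t2 w1 w2 p v x.
Proof.
  intros H1 H2 Hx H. unfold rtransfer. pose proof (Rpower_pos (w1 x) p). pose proof (Rpower_pos (w2 x) p).
  apply Rplus_le_compat; apply Rmult_le_compat_l; try lra; auto.
Qed.

Lemma rtransfer_scal t1 t2 w1 w2 p c u x :
  rtransfer t1 t2 w1 w2 p (fun y => c * u y) x = c * rtransfer t1 t2 w1 w2 p u x.
Proof. unfold rtransfer. ring. Qed.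

Lemma ratio_max h H : pos_cont h -> pos_cont H -> exists x0, in_I x0 /\ 0 < h x0 / H x0 /\
  forall x, in_I x -> h x <= h x0 / H x0 * H x.
Proof.
  intros Hh HH. destruct (continuity_ab_maj (fun x => h x / H x) (-1) 1) as [x0 [M B]].
  - lra.
  - intros x Hx. destruct (Hh x Hx), (HH x Hx). apply continuity_pt_div; auto. lra.
  - exists x0. split; auto. destruct (Hh x0 B), (HH x0 B). split. apply Rdiv_lt_0_compat; auto.
    intros x Hx. destruct (HH x Hx). specialize (M x Hx).
    apply Rle_trans with (h x / H x * H x). right; field; lra. apply Rmult_le_compat_r; lra.
Qed.

(** The maximum principle, applied at a maximum of [h / H]; in [compare_gt], at a
    maximum of [H / h]. *)
Lemma compare_le t1 t2 w1 w2 p r h H c : stays t1 -> stays t2 -> eig t1 t2 w1 w2 p r h -> pos_cont H ->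
  (forall x, in_I x -> rtransfer t1 t2 w1 w2 p H x <= c * H x) -> r <= c.
Proof.
  intros S1 S2 [Hh He] HH HT. destruct (ratio_max h H Hh HH) as [x0 [I0 [M0 B]]].
  set (M := h x0 / H x0) in *. destruct (Hh x0 I0) as [h0 _]. destruct (HH x0 I0) as [H0 _].
  assert (T : r * h x0 <= M * (c * H x0)).
  { rewrite <- He by auto. eapply Rle_trans.
    apply (rtransfer_mono t1 t2 w1 w2 p h (fun y => M * H y)); auto.
    rewrite rtransfer_scal. apply Rmult_le_compat_l; auto. lra. }
  replace (M * (c * H x0)) with (c * h x0) in T by (unfold M; field; lra).
  apply Rmult_le_reg_r with (h x0); auto.
Qed.

Lemma compare_lt t1 t2 w1 w2 p r h H c : stays t1 -> stays t2 -> eig t1 t2 w1 w2 p r h -> pos_cont H ->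
  (forall x, in_I x -> rtransfer t1 t2 w1 w2 p H x < c * H x) -> r < c.
Proof.
  intros S1 S2 [Hh He] HH HT. destruct (ratio_max h H Hh HH) as [x0 [I0 [M0 B]]].
  set (M := h x0 / H x0) in *. destruct (Hh x0 I0) as [h0 _]. destruct (HH x0 I0) as [H0 _].
  assert (T : r * h x0 < M * (c * H x0)).
  { rewrite <- He by auto. eapply Rle_lt_trans.
    apply (rtransfer_mono t1 t2 w1 w2 p h (fun y => M * H y)); auto.
    rewrite rtransfer_scal. apply Rmult_lt_compat_l; auto. }
  replace (M * (c * H x0)) with (c * h x0) in T by (unfold M; field; lra).
  apply Rmult_lt_reg_r with (h x0); auto.
Qed.

Lemma compare_gt t1 t2 w1 w2 p r h H c : stays t1 -> stays t2 -> eig t1 t2 w1 w2 p r h -> pos_cont H ->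
  (forall x, in_I x -> c * H x < rtransfer t1 t2 w1 w2 p H x) -> c < r.
Proof.
  intros S1 S2 [Hh He] HH HT. destruct (ratio_max H h HH Hh) as [x0 [I0 [M0 B]]].
  set (M := H x0 / h x0) in *. destruct (Hh x0 I0) as [h0 _]. destruct (HH x0 I0) as [H0 _].
  assert (T : c * H x0 < M * (r * h x0)).
  { rewrite <- He by auto. eapply Rlt_le_trans; [apply HT; auto|].
    rewrite <- rtransfer_scal. apply rtransfer_mono; auto. }
  replace (M * (r * h x0)) with (r * H x0) in T by (unfold M; field; lra).
  apply Rmult_lt_reg_r with (H x0); auto.
Qed.

Lemma Rpower_gt_1 x p : 1 < x -> 0 < p -> 1 < Rpower x p.
Proof. intros Hx Hp. rewrite <- (Rpower_O x) by lra. apply Rpower_lt; auto. Qed.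

Lemma Rpower_lt_base x y p : 0 < x < y -> 0 < p -> Rpower x p < Rpower y p.
Proof. intros Hx Hp. apply Rlt_Rpower_l; auto. Qed.

(** At the exponent [q] the eigenfunction for [p] grows by a factor larger than [rp]. *)
Lemma eig_increasing t1 t2 w1 w2 p q rp rq hp hq : stays t1 -> stays t2 ->
  (forall x, in_I x -> 1 < w1 x /\ 1 < w2 x) -> p < q ->
  eig t1 t2 w1 w2 p rp hp -> eig t1 t2 w1 w2 q rq hq -> rp < rq.
Proof.
  intros S1 S2 HW Hpq [Hp Ep] Eq. apply (compare_gt t1 t2 w1 w2 q rq hq hp rp S1 S2 Eq Hp).
  intros x Hx. rewrite <- Ep by auto. unfold rtransfer. destruct (HW x Hx) as [W1 W2].
  destruct (Hp _ (S1 x Hx)) as [P1 _]. destruct (Hp _ (S2 x Hx)) as [P2 _].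
  apply Rplus_lt_compat; apply Rmult_lt_compat_r; auto; apply Rpower_lt; auto.
Qed.

Lemma sum_Rpower_lt A B s : 0 < A -> 0 < B -> 1 < s -> Rpower A s + Rpower B s < Rpower (A + B) s.
Proof.
  intros HA HB Hs.
  assert (G : forall A B, 0 < A -> 0 < B -> Rpower A s < A / (A + B) * Rpower (A + B) s).
  { intros a b Ha Hb. replace (Rpower a s) with (Rpower a (1 + (s - 1))) by (f_equal; ring).
    replace (Rpower (a + b) s) with (Rpower (a + b) (1 + (s - 1))) by (f_equal; ring).
    rewrite !Rpower_plus, !Rpower_1 by lra.
    replace (a / (a + b) * ((a + b) * Rpower (a + b) (s - 1))) with (a * Rpower (a + b) (s - 1)) by (field; lra).
    apply Rmult_lt_compat_l; auto. apply Rpower_lt_base; lra. }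
  pose proof (G A B HA HB). pose proof (G B A HB HA). rewrite (Rplus_comm B A) in H0.
  replace (Rpower (A + B) s) with (A / (A + B) * Rpower (A + B) s + B / (A + B) * Rpower (A + B) s) by (field; lra).
  lra.
Qed.

Lemma continuity_pt_Rpower h s x : 0 < h x -> continuity_pt h x -> continuity_pt (fun y => Rpower (h y) s) x.
Proof.
  intros P Hc. unfold Rpower. apply (continuity_pt_comp (fun y => s * ln (h y)) exp).
  - apply (continuity_pt_scal (fun y => ln (h y))). apply (continuity_pt_comp h ln); auto.
    apply derivable_continuous_pt. exists (/ h x). apply derivable_pt_lim_ln; auto.
  - apply derivable_continuous_pt, derivable_pt_exp.
Qed.


(** With [s = q / p], the function [hp ^ s] satisfies a strict inequality for the
    exponent [q], because [A ^ s + B ^ s < (A + B) ^ s] for [s > 1]. *)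
Lemma eig_ratio t1 t2 w1 w2 p q rp rq hp hq : stays t1 -> stays t2 ->
  (forall x, in_I x -> 0 < w1 x /\ 0 < w2 x) -> 0 < p < q -> 0 < rp -> 0 < rq ->
  eig t1 t2 w1 w2 p rp hp -> eig t1 t2 w1 w2 q rq hq -> ln rq / q < ln rp / p.
Proof.
  intros S1 S2 HW Hpq Rp Rq [Hp Ep] Eq. set (s := q / p).
  assert (Hs : 1 < s). { unfold s. apply Rmult_lt_reg_r with p; [lra|]. unfold Rdiv. rewrite Rmult_assoc, Rinv_l; lra. }
  assert (PQ : p * s = q) by (unfold s; field; lra).
  assert (L : rq < Rpower rp s).
  { apply (compare_lt t1 t2 w1 w2 q rq hq (fun x => Rpower (hp x) s)); auto.
    - intros x Hx. destruct (Hp x Hx). split. apply Rpower_pos. apply continuity_pt_Rpower; auto.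
    - intros x Hx. destruct (Hp x Hx) as [P0 _]. destruct (Hp _ (S1 x Hx)) as [P1 _]. destruct (Hp _ (S2 x Hx)) as [P2 _].
      rewrite Rpower_mult_distr by auto. rewrite <- Ep by auto. unfold rtransfer.
      pose proof (Rpower_pos (w1 x) p). pose proof (Rpower_pos (w2 x) p).
      eapply Rle_lt_trans; [|apply sum_Rpower_lt; auto; apply Rmult_lt_0_compat; auto].
      rewrite <- !Rpower_mult_distr, !Rpower_mult, PQ by auto. lra. }
  assert (ln rq < ln (Rpower rp s)) by (apply ln_increasing; auto).
  unfold Rpower in H. rewrite ln_exp in H. unfold s in H.
  apply Rmult_lt_reg_r with q; [lra|]. replace (ln rq / q * q) with (ln rq) by (field; lra).
  replace (ln rp / p * q) with (q / p * ln rp) by (field; lra). auto.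
Qed.

Lemma ln_le_sub_1 x : 0 < x -> ln x <= x - 1 /\ (ln x = x - 1 -> x = 1).
Proof.
  intros Hx. destruct (Req_dec (ln x) 0) as [E|N].
  - assert (x = 1). { rewrite <- (exp_ln x Hx), E. apply exp_0. } subst. rewrite ln_1. split; [lra|auto].
  - pose proof (exp_ineq1 _ N). rewrite exp_ln in H by auto. split; [lra|]. intros; lra.
Qed.

Lemma weighted_AMGM x y t : 0 < x -> 0 < y -> 0 < t < 1 ->
  Rpower x t * Rpower y (1 - t) <= t * x + (1 - t) * y /\
  (Rpower x t * Rpower y (1 - t) = t * x + (1 - t) * y -> x = y).
Proof.
  intros Hx Hy Ht. set (m := t * x + (1 - t) * y).
  assert (Hm : 0 < m) by (unfold m; apply Rplus_lt_0_compat; apply Rmult_lt_0_compat; lra).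
  destruct (ln_le_sub_1 (x / m)) as [X1 X2]; [apply Rdiv_lt_0_compat; auto|].
  destruct (ln_le_sub_1 (y / m)) as [Y1 Y2]; [apply Rdiv_lt_0_compat; auto|].
  assert (Z : t * (x / m - 1) + (1 - t) * (y / m - 1) = 0).
  { replace (t * (x / m - 1) + (1 - t) * (y / m - 1)) with ((t * x + (1 - t) * y) / m - 1) by (field; lra).
    fold m. field. lra. }
  rewrite ln_div in X1, X2, Y1, Y2 by auto.
  assert (E : Rpower x t * Rpower y (1 - t) = exp (t * ln x + (1 - t) * ln y)) by (unfold Rpower; rewrite exp_plus; auto).
  rewrite E. split.
  - rewrite <- (exp_ln m Hm). assert (LE : t * ln x + (1 - t) * ln y <= ln m) by nra.
    destruct LE as [L|L]; [left; apply exp_increasing; auto|rewrite L; lra].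
  - intros EQ. assert (LE : t * ln x + (1 - t) * ln y = ln m) by (rewrite <- EQ, ln_exp; auto).
    assert (ln x - ln m = x / m - 1) by nra. assert (ln y - ln m = y / m - 1) by nra.
    apply X2 in H. apply Y2 in H0.
    transitivity (x / m * m). field; lra. rewrite H, <- H0. field; lra.
Qed.

Lemma Holder_two A1 A2 B1 B2 t : 0 < A1 -> 0 < A2 -> 0 < B1 -> 0 < B2 -> 0 < t < 1 ->
  let L := Rpower A1 t * Rpower B1 (1 - t) + Rpower A2 t * Rpower B2 (1 - t) in
  let U := Rpower (A1 + A2) t * Rpower (B1 + B2) (1 - t) in
  L <= U /\ (L = U -> A1 / (A1 + A2) = B1 / (B1 + B2)).
Proof.
  intros HA1 HA2 HB1 HB2 Ht L U.
  assert (PU : 0 < U) by (apply Rmult_lt_0_compat; apply Rpower_pos).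
  assert (G : forall a b, 0 < a -> 0 < b -> Rpower a t * Rpower b (1 - t) = U * (Rpower (a / (A1 + A2)) t * Rpower (b / (B1 + B2)) (1 - t))).
  { intros a b Ha Hb. unfold U.
    transitivity ((Rpower (A1 + A2) t * Rpower (a / (A1 + A2)) t) * (Rpower (B1 + B2) (1 - t) * Rpower (b / (B1 + B2)) (1 - t))); [|ring].
    rewrite !Rpower_mult_distr by (try lra; apply Rdiv_lt_0_compat; lra). f_equal; f_equal; field; lra. }
  destruct (weighted_AMGM (A1 / (A1 + A2)) (B1 / (B1 + B2)) t) as [V1 V2]; auto; try (apply Rdiv_lt_0_compat; lra).
  destruct (weighted_AMGM (A2 / (A1 + A2)) (B2 / (B1 + B2)) t) as [W1 _]; auto; try (apply Rdiv_lt_0_compat; lra).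
  unfold L. rewrite (G A1 B1), (G A2 B2) by auto.
  set (x := Rpower (A1 / (A1 + A2)) t * Rpower (B1 / (B1 + B2)) (1 - t)) in *.
  set (y := Rpower (A2 / (A1 + A2)) t * Rpower (B2 / (B1 + B2)) (1 - t)) in *.
  assert (EA : A2 / (A1 + A2) = 1 - A1 / (A1 + A2)) by (field; lra).
  assert (EB : B2 / (B1 + B2) = 1 - B1 / (B1 + B2)) by (field; lra).
  rewrite EA, EB in W1.
  assert (x + y <= 1) by nra. split. nra.
  intros EQ. apply V2. assert (x + y = 1) by (apply Rmult_eq_reg_l with U; lra). nra.
Qed.

(** Hoelder's inequality gives [T_m H <= c H] for [H = hp^t hq^(1-t)] and
    [c = rp^t rq^(1-t)].  If [rm >= c], then equality holds at a maximum of
    [hm / H] and, by invariance, at all its images under the branches.  At the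
    fixed point 0 of the first branch it yields [rq / rp = a^(q-p)]; along the
    orbit of 0 under the second branch [hq / hp] is then multiplied at each step
    by [(a / w2)^(q-p) > 1], although it is bounded. *)
Lemma eig_log_convex l t2 w1 w2 a p q t rp rq rm hp hq hm :
  let t1 := fun x => l * x in
  -1 < l < 0 -> stays t2 -> (forall x, in_I x -> 0 < w1 x) -> 0 < w2 -> w1 0 = a -> w2 < a ->
  p < q -> 0 < t < 1 -> 0 < rp -> 0 < rq -> 0 < rm ->
  eig t1 t2 w1 (fun _ => w2) p rp hp -> eig t1 t2 w1 (fun _ => w2) q rq hq ->
  eig t1 t2 w1 (fun _ => w2) (t * p + (1 - t) * q) rm hm ->
  ln rm < t * ln rp + (1 - t) * ln rq.
Proof.
  intros t1 Hl S2 HW HW2 W0 Wa Hpq Ht Rp Rq Rm [Hp Ep] [Hq Eq] [Hm Em].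
  assert (S1 : stays t1) by (intros x Hx; unfold t1, in_I in *; nra).
  set (m := t * p + (1 - t) * q) in *.
  set (H := fun x => Rpower (hp x) t * Rpower (hq x) (1 - t)).
  assert (HH : pos_cont H).
  { intros x Hx. destruct (Hp x Hx), (Hq x Hx). split. apply Rmult_lt_0_compat; apply Rpower_pos.
    apply continuity_pt_mult; apply continuity_pt_Rpower; auto. }
  set (c := Rpower rp t * Rpower rq (1 - t)).
  assert (Lc : ln c = t * ln rp + (1 - t) * ln rq).
  { unfold c. rewrite ln_mult by apply Rpower_pos. unfold Rpower. rewrite !ln_exp. auto. }
  assert (Pc : 0 < c) by (apply Rmult_lt_0_compat; apply Rpower_pos).
  rewrite <- Lc. apply ln_increasing; auto. apply Rnot_le_lt. intros Lrm.
  assert (HOL : forall x, in_I x -> rtransfer t1 t2 w1 (fun _ => w2) m H x <= c * H x /\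
     (rtransfer t1 t2 w1 (fun _ => w2) m H x = c * H x -> Rpower (w1 x) p * hp (t1 x) / (rp * hp x) = Rpower (w1 x) q * hq (t1 x) / (rq * hq x))).
  { intros x Hx. specialize (HW x Hx).
    destruct (Hp x Hx) as [px _]. destruct (Hq x Hx) as [qx _].
    destruct (Hp _ (S1 x Hx)) as [p1 _]. destruct (Hq _ (S1 x Hx)) as [q1 _].
    destruct (Hp _ (S2 x Hx)) as [p2 _]. destruct (Hq _ (S2 x Hx)) as [q2 _].
    pose proof (Rpower_pos (w1 x) p). pose proof (Rpower_pos (w1 x) q). pose proof (Rpower_pos w2 p). pose proof (Rpower_pos w2 q).
    destruct (Holder_two (Rpower (w1 x) p * hp (t1 x)) (Rpower w2 p * hp (t2 x)) (Rpower (w1 x) q * hq (t1 x)) (Rpower w2 q * hq (t2 x)) t)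
      as [V1 V2]; try (apply Rmult_lt_0_compat; auto); auto.
    change (Rpower (w1 x) p * hp (t1 x) + Rpower w2 p * hp (t2 x)) with (rtransfer t1 t2 w1 (fun _ => w2) p hp x) in V1, V2.
    change (Rpower (w1 x) q * hq (t1 x) + Rpower w2 q * hq (t2 x)) with (rtransfer t1 t2 w1 (fun _ => w2) q hq x) in V1, V2.
    rewrite Ep, Eq in V1, V2 by auto.
    assert (SPL : forall w h1 h2, 0 < w -> 0 < h1 -> 0 < h2 -> Rpower (Rpower w p * h1) t * Rpower (Rpower w q * h2) (1 - t) = Rpower w m * (Rpower h1 t * Rpower h2 (1 - t))).
    { intros w h1 h2 Hw Hh1 Hh2. rewrite <- !Rpower_mult_distr by (auto; apply Rpower_pos). rewrite !Rpower_mult.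
      transitivity ((Rpower w (p * t) * Rpower w (q * (1 - t))) * (Rpower h1 t * Rpower h2 (1 - t))). ring.
      rewrite <- Rpower_plus. f_equal. f_equal. unfold m; ring. }
    rewrite !SPL in V1, V2 by auto.
    assert (EC : Rpower (rp * hp x) t * Rpower (rq * hq x) (1 - t) = c * H x).
    { rewrite <- !Rpower_mult_distr by auto. unfold c, H. ring. }
    rewrite EC in V1, V2. split; auto. }
  destruct (ratio_max hm H Hm HH) as [x0 [I0 [M0 B]]]. set (M := hm x0 / H x0) in *.
  assert (INV : forall x, in_I x -> hm x = M * H x ->
     hm (t1 x) = M * H (t1 x) /\ hm (t2 x) = M * H (t2 x) /\
     Rpower (w1 x) p * hp (t1 x) / (rp * hp x) = Rpower (w1 x) q * hq (t1 x) / (rq * hq x)).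
  { intros x Hx HE. destruct (HOL x Hx) as [H1 H2]. destruct (HH x Hx) as [Hpos _].
    assert (T1 : rtransfer t1 t2 w1 (fun _ => w2) m hm x = rm * (M * H x)) by (rewrite Em, HE; auto).
    assert (T2 : c * (M * H x) <= rm * (M * H x)). { apply Rmult_le_compat_r; auto. apply Rmult_le_pos; lra. }
    assert (T3 : M * rtransfer t1 t2 w1 (fun _ => w2) m H x <= M * (c * H x)) by (apply Rmult_le_compat_l; lra).
    pose proof (B _ (S1 x Hx)) as B1. pose proof (B _ (S2 x Hx)) as B2.
    unfold rtransfer in T1, T3.
    pose proof (Rpower_pos (w1 x) m) as P1. pose proof (Rpower_pos w2 m) as P2.
    assert (G1 : 0 <= Rpower (w1 x) m * (M * H (t1 x) - hm (t1 x))) by (apply Rmult_le_pos; lra).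
    assert (G2 : 0 <= Rpower w2 m * (M * H (t2 x) - hm (t2 x))) by (apply Rmult_le_pos; lra).
    assert (G3 : Rpower (w1 x) m * (M * H (t1 x) - hm (t1 x)) = 0) by lra.
    assert (G4 : Rpower w2 m * (M * H (t2 x) - hm (t2 x)) = 0) by lra.
    apply Rmult_integral in G3, G4. split; [|split].
    - destruct G3; lra.
    - destruct G4; lra.
    - apply H2. unfold rtransfer. apply Rmult_eq_reg_l with M; [|lra]. destruct G3; [lra|]. destruct G4; [lra|].
      apply Rle_antisym; auto. replace (hm (t1 x)) with (M * H (t1 x)) in T1 by lra. replace (hm (t2 x)) with (M * H (t2 x)) in T1 by lra. lra. }
  assert (Z : hm 0 = M * H 0).
  { assert (IT : forall n, in_I (l ^ n * x0) /\ hm (l ^ n * x0) = M * H (l ^ n * x0)).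
    { induction n. simpl. rewrite Rmult_1_l. split; auto. destruct (HH x0 I0). unfold M; field; lra.
      destruct IHn as [A1 A2]. replace (l ^ S n * x0) with (t1 (l ^ n * x0)) by (unfold t1; simpl; ring).
      split. apply S1; auto. apply INV; auto. }
    assert (LIM : is_lim_seq (fun n => l ^ n * x0) 0).
    { replace (Finite 0) with (Finite (0 * x0)) by (f_equal; ring). apply is_lim_seq_mult'; [|apply is_lim_seq_const].
      apply is_lim_seq_geom. rewrite Rabs_left; lra. }
    destruct (Hm 0 in_I_0) as [_ C1]. destruct (HH 0 in_I_0) as [_ C2].
    assert (L1 := is_lim_seq_continuous hm _ 0 C1 LIM). assert (L2 := is_lim_seq_continuous H _ 0 C2 LIM).
    assert (L3 : is_lim_seq (fun n => hm (l ^ n * x0)) (M * H 0)).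
    { apply is_lim_seq_ext with (fun n => M * H (l ^ n * x0)). intros n. symmetry; apply IT.
      apply is_lim_seq_mult'; auto. apply is_lim_seq_const. }
    apply is_lim_seq_unique in L1, L3. rewrite L1 in L3. injection L3; auto. }
  assert (KAP : rq / rp = Rpower a (q - p)).
  { destruct (INV 0 in_I_0 Z) as [_ [_ E]]. unfold t1 in E. rewrite Rmult_0_r, W0 in E.
    destruct (Hp 0 in_I_0). destruct (Hq 0 in_I_0). pose proof (Rpower_pos a p). pose proof (Rpower_pos a q).
    assert (E2 : Rpower a p / rp = Rpower a q / rq).
    { transitivity (Rpower a p * hp 0 / (rp * hp 0)). field; lra. rewrite E. field; lra. }
    unfold Rminus. rewrite Rpower_plus, Rpower_Ropp.
    replace (Rpower a q) with (Rpower a p / rp * rq). field. split; lra. rewrite E2. field. lra. }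
  set (th := Rpower (a / w2) (q - p)).
  assert (Hth : 1 < th).
  { apply Rpower_gt_1; [|lra]. apply Rmult_lt_reg_r with w2; auto. unfold Rdiv. rewrite Rmult_assoc, Rinv_l; lra. }
  assert (STEP : forall x, in_I x -> hm x = M * H x -> hq (t2 x) / hp (t2 x) = th * (hq x / hp x)).
  { intros x Hx HE. destruct (INV x Hx HE) as [_ [_ E]].
    pose proof (Ep x Hx) as Ex. pose proof (Eq x Hx) as Fx. unfold rtransfer in Ex, Fx.
    destruct (Hp x Hx) as [px _]. destruct (Hq x Hx) as [qx _].
    destruct (Hp _ (S2 x Hx)) as [p2 _]. destruct (Hq _ (S2 x Hx)) as [q2 _].
    pose proof (Rpower_pos w2 p). pose proof (Rpower_pos w2 q).
    assert (rp * hp x <> 0) by (apply Rgt_not_eq; red; apply Rmult_lt_0_compat; auto).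
    assert (rq * hq x <> 0) by (apply Rgt_not_eq; red; apply Rmult_lt_0_compat; auto).
    assert (E' : Rpower w2 p * hp (t2 x) / (rp * hp x) = Rpower w2 q * hq (t2 x) / (rq * hq x)).
    { replace (Rpower w2 p * hp (t2 x)) with (rp * hp x - Rpower (w1 x) p * hp (t1 x)) by lra.
      replace (Rpower w2 q * hq (t2 x)) with (rq * hq x - Rpower (w1 x) q * hq (t1 x)) by lra.
      unfold Rdiv in *. rewrite !Rmult_minus_distr_r, E, !Rinv_r; auto. }
    assert (Eth : th = rq / rp * (Rpower w2 p / Rpower w2 q)).
    { rewrite KAP. unfold th, Rdiv at 1. rewrite <- Rpower_mult_distr by (try apply Rinv_0_lt_compat; lra). f_equal.
      unfold Rpower. rewrite ln_Rinv by auto. unfold Rdiv. rewrite <- exp_Ropp, <- exp_plus. f_equal. ring. }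
    rewrite Eth.
    assert (E3 : Rpower w2 q * hq (t2 x) = Rpower w2 p * hp (t2 x) / (rp * hp x) * (rq * hq x)) by (rewrite E'; field; lra).
    replace (hq (t2 x)) with (Rpower w2 p * hp (t2 x) / (rp * hp x) * (rq * hq x) / Rpower w2 q) by (rewrite <- E3; field; lra).
    field. repeat split; lra. }
  assert (ORB : forall n, exists x, in_I x /\ hm x = M * H x /\ hq x / hp x = th ^ n * (hq 0 / hp 0)).
  { induction n. exists 0. split; [apply in_I_0|]. split; auto. simpl; ring.
    destruct IHn as [x [Hx [HE HQ]]]. exists (t2 x). split; [apply S2; auto|]. split. apply INV; auto.
    rewrite STEP, HQ by auto. simpl; ring. }
  destruct (ratio_max hq hp Hq Hp) as [y [Iy [_ By]]]. set (Q := hq y / hp y) in *.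
  assert (BQ : forall n, th ^ n * (hq 0 / hp 0) <= Q).
  { intros n. destruct (ORB n) as [x [Hx [_ <-]]]. destruct (Hp x Hx). specialize (By x Hx).
    apply Rmult_le_reg_r with (hp x); auto. unfold Rdiv. rewrite Rmult_assoc, Rinv_l, Rmult_1_r by lra. auto. }
  assert (Pos0 : 0 < hq 0 / hp 0). { destruct (Hp 0 in_I_0), (Hq 0 in_I_0). apply Rdiv_lt_0_compat; auto. }
  destruct (Pow_x_infinity th) with (b := (Q + 1) / (hq 0 / hp 0)) as [N HN].
  { rewrite Rabs_pos_eq; lra. }
  specialize (HN N (Nat.le_refl N)). rewrite Rabs_pos_eq in HN by (apply pow_le; lra).
  specialize (BQ N). apply Rge_le in HN. apply Rmult_le_compat_r with (r := hq 0 / hp 0) in HN; [|lra].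
  unfold Rdiv in HN at 1. rewrite Rmult_assoc, Rinv_l in HN by lra. lra.
Qed.

(** The eigenvalue equation at the fixed point 0 of the first branch. *)
Lemma eig_lower l t2 w1 w2 a p r h : let t1 := fun x => l * x in stays t2 -> w1 0 = a ->
  eig t1 t2 w1 w2 p r h -> Rpower a p < r.
Proof.
  intros t1 S2 W0 [Hh He]. specialize (He 0 in_I_0). unfold rtransfer, t1 in He. rewrite Rmult_0_r, W0 in He.
  destruct (Hh 0 in_I_0) as [h0 _]. destruct (Hh _ (S2 0 in_I_0)) as [h1 _].
  pose proof (Rpower_pos (w2 0) p). assert (0 < Rpower (w2 0) p * h (t2 0)) by (apply Rmult_lt_0_compat; auto).
  apply Rmult_lt_reg_r with (h 0); auto. lra.
Qed.

(** Comparison with the constant 1.  In case of equality [h] would be maximal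
    both at 0 and at [t2 0 <> 0], where the first weight is less than [a]. *)
Lemma eig_upper l t2 w1 w2 a p r h : let t1 := fun x => l * x in -1 < l < 0 -> stays t2 ->
  (forall x, in_I x -> 0 < w1 x) -> w1 0 = a -> (forall x, in_I x -> x <> 0 -> w1 x < a) -> t2 0 <> 0 -> 0 <= p ->
  eig t1 t2 w1 (fun _ => w2) p r h -> r <= Rpower a p + Rpower w2 p /\ (0 < p -> r < Rpower a p + Rpower w2 p).
Proof.
  intros t1 Hl S2 HW W0 Wa T0 Hp0 EE. assert (EE' := EE). destruct EE' as [Hh He].
  assert (S1 : stays t1) by (intros x Hx; unfold t1, in_I in *; nra).
  assert (ONE : pos_cont (fun _ => 1)). { intros x Hx. split; [lra|]. apply continuity_pt_const. intros u v; auto. }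
  assert (Hle : forall x, in_I x -> w1 x <= a). { intros x Hx. destruct (Req_dec x 0). subst; lra. left; auto. }
  split.
  - apply (compare_le t1 t2 w1 (fun _ => w2) p r h (fun _ => 1)); auto. intros x Hx. unfold rtransfer.
    assert (Rpower (w1 x) p <= Rpower a p) by (apply Rpower_le_mono; auto). lra.
  - intros Hp. destruct (ratio_max h (fun _ => 1) Hh ONE) as [x0 [I0 [_ B]]].
    assert (Bx : forall x, in_I x -> h x <= h x0). { intros x Hx. specialize (B x Hx). lra. }
    assert (KEY : forall x, in_I x -> h x = h x0 -> x <> 0 -> r < Rpower a p + Rpower w2 p).
    { intros x Hx E N. specialize (He x Hx). unfold rtransfer in He. destruct (Hh x Hx) as [Hx0 _].
      apply Rmult_lt_reg_r with (h x); auto. rewrite <- He, Rmult_plus_distr_r.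
      pose proof (Bx _ (S1 x Hx)). pose proof (Bx _ (S2 x Hx)). rewrite <- E in *.
      assert (Rpower (w1 x) p < Rpower a p) by (apply Rpower_lt_base; auto).
      pose proof (Rpower_pos (w1 x) p). pose proof (Rpower_pos w2 p).
      apply Rplus_lt_le_compat.
      apply Rle_lt_trans with (Rpower (w1 x) p * h x). apply Rmult_le_compat_l; lra. apply Rmult_lt_compat_r; auto.
      apply Rmult_le_compat_l; lra. }
    destruct (Req_dec x0 0) as [E0|N0]; [|apply (KEY x0); auto].
    subst x0. destruct (Rle_lt_or_eq_dec _ _ (Bx _ (S2 0 in_I_0))) as [L|E].
    + specialize (He 0 in_I_0). unfold rtransfer, t1 in He. rewrite Rmult_0_r, W0 in He.
      destruct (Hh 0 in_I_0) as [h0 _]. apply Rmult_lt_reg_r with (h 0); auto. rewrite <- He, Rmult_plus_distr_r.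
      apply Rplus_lt_compat_l. apply Rmult_lt_compat_l; auto. apply Rpower_pos.
    + apply (KEY (t2 0)); auto.
Qed.

(** * Maps close to the fixed point *)

(** The two lemmas by which strict conditions on [g] over a compact set are
    turned into conditions with room for a perturbation. *)
Lemma compact_open_margin (A O : C -> Prop) (v : C -> C) :
  bounded_set A -> (forall z, closure A z -> A z) -> (forall z, A z -> ccont v z) ->
  (forall z, A z -> near (v z) O) ->
  exists kap, 0 < kap /\ forall z w, A z -> Cmod (w - v z) < kap -> O w.
Proof.
  intros BA CA HV HO.
  destruct (compact_uniform A (fun u del => forall z w, Cmod (z - u) < del -> Cmod (w - v z) < del -> O w)) as [d [Hd K]]; auto.
  - intros u Au. destruct (HO u Au) as [e [He K]]. destruct (HV u Au (e/2)) as [d [Hd K']]; [lra|].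
    exists (Rmin d (e/2)). split. apply Rmin_pos; lra. intros z w Hz Hw. apply K.
    assert (Hz' := Rlt_le_trans _ _ _ Hz (Rmin_l _ _)). assert (Hw' := Rlt_le_trans _ _ _ Hw (Rmin_r _ _)).
    specialize (K' z Hz'). pose proof (Cmod_sub_trans w (v z) (v u)). lra.
  - exists d. split; auto. intros z w Az Hw. destruct (K z Az) as [u [del [_ [P [Hdel Hz]]]]]. apply (P z); auto. lra.
Qed.

Lemma compact_unif_cont (A : C -> Prop) (v1 v2 : C -> C) e : 0 < e ->
  bounded_set A -> (forall z, closure A z -> A z) -> (forall z, A z -> ccont v1 z) ->
  (forall z, A z -> ccont v2 (v1 z)) ->
  exists kap, 0 < kap /\ forall z y, A z -> Cmod (y - v1 z) < kap -> Cmod (v2 y - v2 (v1 z)) < e.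
Proof.
  intros He BA CA H1 H2.
  destruct (compact_uniform A (fun u del => forall z y, Cmod (z - u) < del -> Cmod (y - v1 z) < del -> Cmod (v2 y - v2 (v1 z)) < e)) as [d [Hd K]]; auto.
  - intros u Au. destruct (H2 u Au (e/2)) as [d [Hd K]]; [lra|]. destruct (H1 u Au (d/2)) as [d' [Hd' K']]; [lra|].
    exists (Rmin d' (d/2)). split. apply Rmin_pos; lra. intros z y Hz Hy.
    assert (Hz' := Rlt_le_trans _ _ _ Hz (Rmin_l _ _)). assert (Hy' := Rlt_le_trans _ _ _ Hy (Rmin_r _ _)).
    specialize (K' z Hz'). assert (K1 := K (v1 z) ltac:(lra)).
    assert (K2 : Cmod (v2 y - v2 (v1 u)) < e/2). { apply K. pose proof (Cmod_sub_trans y (v1 z) (v1 u)). lra. }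
    rewrite Cmod_sub_sym in K1. pose proof (Cmod_sub_trans (v2 y) (v2 (v1 u)) (v2 (v1 z))). lra.
  - exists d. split; auto. intros z y Az Hy. destruct (K z Az) as [u [del [_ [P [Hdel Hz]]]]]. apply (P z); auto. lra.
Qed.

Definition real_segment (a b : R) (z : C) : Prop := Im z = 0 /\ a <= Re z <= b.

Lemma real_segment_RtoC a b x : a <= x <= b -> real_segment a b (RtoC x).
Proof. intros H. split; auto. Qed.

Lemma real_segment_bounded a b : bounded_set (real_segment a b).
Proof.
  exists (Rabs a + Rabs b). intros z [I [H1 H2]]. rewrite (real_point_RtoC z I), Cmod_R.
  pose proof (Rle_abs b). pose proof (Rle_abs (- a)). rewrite Rabs_Ropp in H0. pose proof (Rabs_pos a). pose proof (Rabs_pos b).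
  apply Rabs_le. lra.
Qed.

Lemma real_segment_closed a b z : closure (real_segment a b) z -> real_segment a b z.
Proof.
  intros H. split; [|split].
  - destruct (Req_dec (Im z) 0) as [|N]; auto. exfalso. assert (P := Rabs_pos_lt _ N).
    destruct (H _ P) as [w [[I _] K]]. pose proof (component_le Im (w - z) component_Im).
    replace (Im (w - z)) with (- Im z) in H0 by (unfold Im in *; simpl; lra). rewrite Rabs_Ropp in H0. lra.
  - apply Rnot_lt_le. intros L. destruct (H (a - Re z) ltac:(lra)) as [w [[I [H1 H2]] K]].
    pose proof (component_le Re (w - z) component_Re). pose proof (Rle_abs (Re (w - z))).
    replace (Re (w - z)) with (Re w - Re z) in * by (unfold Re; simpl; ring). lra.
  - apply Rnot_lt_le. intros L. destruct (H (Re z - b) ltac:(lra)) as [w [[I [H1 H2]] K]].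
    pose proof (component_le Re (w - z) component_Re). pose proof (Rle_abs (- Re (w - z))). rewrite Rabs_Ropp in H3.
    replace (Re (w - z)) with (Re w - Re z) in * by (unfold Re; simpl; ring). lra.
Qed.

Definition real_on_reals (D : C -> Prop) (f : C -> C) : Prop := forall x, D (RtoC x) -> Im (f (RtoC x)) = 0.

Lemma trace_RtoC D f x : real_on_reals D f -> D (RtoC x) -> f (RtoC x) = RtoC (trace f x).
Proof. intros H Dx. unfold trace. apply real_point_RtoC, H, Dx. Qed.

Lemma open_real_nearby D (x : R) : open (T := C_UniformSpace) D -> D (RtoC x) -> locally x (fun y => D (RtoC y)).
Proof.
  intros OD Dx. destruct (open_near D _ OD Dx) as [d [Hd K]]. exists (mkposreal d Hd). intros y Hy. apply K.
  rewrite <- RtoC_minus, Cmod_R. apply Hy.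
Qed.

Lemma trace_derive D f x : open (T := C_UniformSpace) D -> analytic_on D f -> D (RtoC x) ->
  is_derive (trace f) x (trace (C_derive f) x).
Proof. intros OD HA Dx. apply (cderiv_component Re f x _ component_Re), analytic_cderiv, HA, Dx. Qed.

Lemma C_derive_real D f : open (T := C_UniformSpace) D -> analytic_on D f -> real_on_reals D f ->
  real_on_reals D (C_derive f).
Proof.
  intros OD HA HR x Dx. assert (K := cderiv_component Im f x _ component_Im (analytic_cderiv _ _ (HA _ Dx))).
  apply is_derive_unique in K. rewrite <- K.
  rewrite (Derive_ext_loc _ (fun _ => 0)). apply Derive_const.
  generalize (open_real_nearby D x OD Dx). apply filter_imp. intros y Dy. apply HR, Dy.
Qed.

Lemma Derive_trace D f x : open (T := C_UniformSpace) D -> analytic_on D f -> D (RtoC x) ->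
  Derive (trace f) x = trace (C_derive f) x.
Proof. intros. eapply is_derive_unique, trace_derive; eauto. Qed.

Lemma Derive_n_2_trace D f x : open (T := C_UniformSpace) D -> analytic_on D f -> D (RtoC x) ->
  Derive_n (trace f) 2 x = trace (C_derive (C_derive f)) x.
Proof.
  intros OD HA Dx. simpl. rewrite (Derive_ext_loc _ (trace (C_derive f))).
  apply (Derive_trace D); auto. intros z Dz. apply analytic_C_derive, HA, Dz.
  generalize (open_real_nearby D x OD Dx). apply filter_imp. intros y Dy. apply (Derive_trace D); auto.
Qed.

Lemma analytic_Cpow n z : analytic_at_C (fun w => Cpow w n) z.
Proof.
  induction n. apply (analytic_const (RtoC 1)).
  apply (analytic_mult (fun w => w) (fun w => Cpow w n)); auto using analytic_id.
Qed.

Lemma in_GP_facts D k f : open (T := C_UniformSpace) D -> bounded_set D -> in_GP D k f ->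
  analytic_on D f /\ real_on_reals (closure D) f /\ class_P (trace f) /\
  exists M, 0 <= M /\ forall z, closure D z -> Cmod (f z) <= M.
Proof.
  intros OD BD [[h [Hh E]] HP].
  assert (Hh' := Hh). destruct Hh' as [hA [_ [_ hR]]].
  split; [|split; [|split; auto]].
  - intros z Dz. apply analytic_ext with (fun w => RtoC 1 + Cpow w (2 * k) * h w)%C.
    { generalize (open_near D z OD Dz). apply filter_imp. intros w Dw. symmetry. apply E, closure_incl, Dw. }
    apply (analytic_plus (fun _ => RtoC 1)); [apply analytic_const|].
    apply (analytic_mult (fun w => Cpow w (2 * k))); [apply analytic_Cpow|apply hA, Dz].
  - intros x Hx. rewrite E by auto. rewrite (real_point_RtoC _ (hR x Hx)).
    assert (PR : forall n, Cpow (RtoC x) n = RtoC (x ^ n)).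
    { induction n; auto. simpl. rewrite IHn, RtoC_mult. auto. }
    rewrite PR, <- RtoC_mult, <- RtoC_plus. reflexivity.
  - destruct (Hr_bound D h Hh) as [M [HM BM]]. destruct (bounded_closure D BD) as [R0 HR0].
    exists (1 + Rabs R0 ^ (2 * k) * M). split.
    { assert (0 <= Rabs R0 ^ (2 * k) * M) by (apply Rmult_le_pos; auto; apply pow_le, Rabs_pos). lra. }
    intros z Hz. rewrite E by auto. eapply Rle_trans; [apply Cmod_triangle|]. rewrite Cmod_1, Cmod_mult, Cmod_pow.
    apply Rplus_le_compat_l. apply Rmult_le_compat; auto; try apply Cmod_ge_0. apply pow_le, Cmod_ge_0.
    apply pow_incr. split. apply Cmod_ge_0. eapply Rle_trans; [apply HR0; auto|apply Rle_abs].
Qed.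

Lemma trace_MVT D f a b : open (T := C_UniformSpace) D -> analytic_on D f -> a < b ->
  (forall x, a <= x <= b -> D (RtoC x)) ->
  exists c, a < c < b /\ trace f b - trace f a = trace (C_derive f) c * (b - a).
Proof.
  intros OD HA Hab HD. destruct (MVT_cor2 (trace f) (trace (C_derive f)) a b Hab) as [c [E Hc]].
  - intros x Hx. apply is_derive_Reals. apply (trace_derive D); auto.
  - exists c. auto.
Qed.

Lemma class_P_decreasing D f : open (T := C_UniformSpace) D -> analytic_on D f ->
  (forall x, in_I x -> D (RtoC x)) -> class_P (trace f) ->
  forall x y, 0 <= x < y -> y <= 1 -> trace f y < trace f x.
Proof.
  intros OD HA HD [_ [_ [_ [_ [P2 _]]]]] x y Hxy Hy.
  destruct (trace_MVT D f x y OD HA) as [c [Hc E]]. lra. { intros; apply HD; unfold in_I; lra. }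
  assert (Ic : in_I c) by (unfold in_I; lra).
  specialize (P2 c Ic ltac:(lra)). rewrite (Derive_trace D) in P2 by auto. nra.
Qed.

Lemma class_P_lam D f : open (T := C_UniformSpace) D -> analytic_on D f ->
  (forall x, in_I x -> D (RtoC x)) -> class_P (trace f) ->
  -1 < lam (trace f) < 0 /\ - lam (trace f) < bpt (trace f) <= 1 /\
  0 < trace f (bpt (trace f)) < - lam (trace f).
Proof.
  intros OD HA HD HP. assert (DEC := class_P_decreasing D f OD HA HD HP). set (F := trace f) in *.
  destruct HP as [_ [_ [HI [H0 [_ [_ [P4 P5]]]]]]].
  assert (I1 : in_I 1) by (unfold in_I; lra).
  assert (IL : in_I (lam F)) by (apply HI; auto).
  assert (IB : in_I (bpt F)) by (apply HI; auto). unfold in_I in IB.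
  assert (NL : lam F < 0).
  { apply Rnot_le_lt. intros L. destruct (Rle_lt_or_eq_dec _ _ L) as [L'|L'].
    2:{ rewrite <- L', Rabs_R0 in P4. lra. }
    (* otherwise 0 < lam < b <= 1 and monotonicity gives F b >= F 1 = lam *)
    rewrite Rabs_pos_eq in P4, P5 by lra. destruct (Req_dec (bpt F) 1) as [E|N].
    rewrite E in P5. unfold lam in P5. lra.
    assert (F 1 < F (bpt F)) by (apply DEC; lra). unfold lam in P5. lra. }
  rewrite Rabs_left in P4, P5 by auto. lra.
Qed.

Lemma class_P_range D f x : open (T := C_UniformSpace) D -> analytic_on D f ->
  (forall x, in_I x -> D (RtoC x)) -> class_P (trace f) -> in_I x ->
  bpt (trace f) <= trace f (lam (trace f) * x) <= 1 /\ (x <> 0 -> trace f (lam (trace f) * x) < 1).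
Proof.
  intros OD HA HD HP Hx. assert (DEC := class_P_decreasing D f OD HA HD HP).
  destruct (class_P_lam D f OD HA HD HP) as [L [B _]]. set (F := trace f) in *.
  destruct HP as [_ [EV [HI [H0 _]]]].
  set (l := lam F) in *. unfold in_I in Hx.
  assert (AB : F (l * x) = F (Rabs (l * x))).
  { unfold Rabs. destruct (Rcase_abs (l * x)); auto. symmetry; apply EV. unfold in_I; nra. }
  assert (BE : bpt F = F (- l)). { unfold bpt. fold l. symmetry. apply EV. unfold in_I; lra. }
  assert (R1 : 0 <= Rabs (l * x) <= - l). { split. apply Rabs_pos. apply Rabs_le. nra. }
  rewrite AB, BE. split; [split|].
  - destruct (Req_dec (Rabs (l * x)) (- l)) as [->|]. lra. left; apply DEC; lra.
  - destruct (Req_dec (Rabs (l * x)) 0) as [->|]. rewrite H0; lra. rewrite <- H0. left; apply DEC; lra.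
  - intros N. rewrite <- H0. apply DEC; [|lra]. split; [lra|]. apply Rabs_pos_lt.
    apply Rmult_integral_contrapositive; lra.
Qed.

(** What is used of a map [f] close to [g]. *)
Definition tame (D : C -> Prop) (f : C -> C) : Prop :=
  let l := RtoC (lamC f) in
  maps_inside D (fun z => l * z)%C /\ maps_inside D (fun z => f (l * z)%C) /\
  (forall z, closure D z -> slit_plane (- C_derive f (f (l * z)))%C) /\
  (forall y, bpt (trace f) <= y <= 1 -> trace (C_derive f) y < -1 /\ trace (C_derive (C_derive f)) y < 0).

Lemma Re_lt_open c z : Re z < c -> near z (fun w => Re w < c).
Proof.
  intros H. exists (c - Re z). split; [lra|]. intros w Hw.
  pose proof (component_le Re (w - z) component_Re). pose proof (Rle_abs (Re (w - z))).
  replace (Re (w - z)) with (Re w - Re z) in * by (unfold Re; simpl; ring). lra.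
Qed.

(** On the chord from [|lam|] to [b] the slope [(g b - b) / (b - |lam|)] is less
    than -1 because [g b < |lam|]; [g'] decreases to the right of it. *)
Lemma fixed_point_slopes k D g : doubling_fixed_point k D g -> analytic_on D g ->
  forall y, bpt (trace g) <= y <= 1 -> trace (C_derive g) y < -1 /\ trace (C_derive (C_derive g)) y < 0.
Proof.
  intros [[_ HP] [_ [_ [_ [CV [_ [OD [_ [BD [HD _]]]]]]]]]] HA y Hy.
  destruct (class_P_lam D g OD HA HD HP) as [L [B FB]].
  assert (EV : trace g (- lam (trace g)) = bpt (trace g)).
  { destruct HP as [_ [EV _]]. unfold bpt. apply EV. unfold in_I; lra. }
  set (l := lam (trace g)) in *. set (b := bpt (trace g)) in *.
  assert (C2 : forall x, 0 < x <= 1 -> trace (C_derive (C_derive g)) x < 0).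
  { intros x Hx. rewrite <- (Derive_n_2_trace D g x); auto. apply CV; unfold in_I; lra. apply HD; unfold in_I; lra. }
  split; [|apply C2; lra].
  destruct (trace_MVT D g (- l) b OD HA) as [c [Hc E]]; [lra| |]. { intros; apply HD; unfold in_I; lra. }
  rewrite EV in E.
  assert (S1 : trace (C_derive g) c < -1) by nra.
  destruct (trace_MVT D (C_derive g) c y OD) as [c' [Hc' E']]; [|lra| |].
  { intros z Dz. apply analytic_C_derive, HA, Dz. } { intros; apply HD; unfold in_I; lra. }
  specialize (C2 c' ltac:(lra)). nra.
Qed.

Lemma Cauchy_estimate_margin D F z M r : analytic_on D F -> 0 < r ->
  (forall w, Cmod (w - z) < r -> D w /\ Cmod (F w) <= M) -> Cmod (C_derive F z) <= 4 * M / r.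
Proof.
  intros HA Hr H. apply Cauchy_estimate; auto.
  - intros w Hw. destruct (H w Hw). split. apply analytic_cderiv, HA; auto. apply analytic_ccont, analytic_C_derive, HA; auto.
  - intros w Hw. apply H; auto.
Qed.

Lemma C_derive_minus f g z : analytic_at_C f z -> analytic_at_C g z ->
  C_derive (fun w => f w - g w)%C z = (C_derive f z - C_derive g z)%C.
Proof.
  intros Hf Hg. apply cderiv_C_derive. apply cderiv_ext_loc with (fun w => f w + RtoC (-1) * g w)%C 1; [lra|intros; ring|].
  apply cderiv_eq with (C_derive f z + (RtoC 0 * g z + RtoC (-1) * C_derive g z))%C; [ring|].
  apply cderiv_plus. apply analytic_cderiv; auto. apply (cderiv_mult (fun _ => RtoC (-1)) g). apply cderiv_const. apply analytic_cderiv; auto.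
Qed.

(** Every condition in [tame] holds for [g] with a margin.  By Cauchy's estimates
    the first two derivatives of [f - g] are small on compact subsets of [D]. *)
Theorem near_fixed_point_tame k D g : doubling_fixed_point k D g ->
  exists eps, 0 < eps /\ forall f, in_GP D k f ->
    (forall z, closure D z -> Cmod (f z - g z) <= eps) -> tame D f.
Proof.
  intros HG. assert (HG' := HG).
  destruct HG' as [GP [_ [_ [_ [_ [_ [OD [CD [BD [HD [_ [IN1 [IN2 SL]]]]]]]]]]]]].
  destruct (in_GP_facts D k g OD BD GP) as [gA [gR [gP [Mg [HMg BMg]]]]].
  assert (SLOPE := fixed_point_slopes k D g HG gA).
  destruct (class_P_lam D g OD gA HD gP) as [Lg [Bg _]].
  assert (BC := bounded_closure D BD). assert (CC := closure_closure D).
  assert (HDi : forall x, -1 <= x <= 1 -> D (RtoC x)) by (intros; apply HD; auto).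
  set (lamg := RtoC (lamC g)) in *.
  set (b := bpt (trace g)) in *.
  destruct BC as [R0 HR0]. assert (BC := bounded_closure D BD).
  set (R1 := Rabs R0 + 1). assert (HR1 : 0 < R1) by (unfold R1; pose proof (Rabs_pos R0); lra).
  assert (ZR : forall z, closure D z -> Cmod z <= R1).
  { intros z Hz. specialize (HR0 z Hz). pose proof (Rle_abs R0). unfold R1; lra. }
  assert (clos_img : forall v z, ccont v z -> closure D z -> closure (image v D) (v z)).
  { intros v z Cv Hz e He. destruct (Cv e He) as [d [Hd K]]. destruct (Hz d Hd) as [w [Dw Hw]].
    exists (v w). split; auto. exists w; auto. }
  assert (Clin : forall z, ccont (fun z => lamg * z)%C z).
  { intros z. apply ccont_mult; [apply ccont_const|apply ccont_id]. }
  assert (DL : forall z, closure D z -> D (lamg * z)%C).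
  { intros z Hz. apply IN1, (clos_img (fun z => lamg * z)%C); auto. }
  assert (CgL : forall z, closure D z -> ccont (fun z => g (lamg * z)%C) z).
  { intros z Hz. apply (ccont_comp g (fun z => lamg * z)%C); auto. apply analytic_ccont, gA, DL, Hz. }
  assert (DGL : forall z, closure D z -> D (g (lamg * z)%C)).
  { intros z Hz. apply IN2, (clos_img (fun z => g (lamg * z)%C)); auto. }
  assert (g'A : analytic_on D (C_derive g)) by (intros z Dz; apply analytic_C_derive, gA, Dz).
  assert (g''A : analytic_on D (C_derive (C_derive g))) by (intros z Dz; apply analytic_C_derive, g'A, Dz).
  (* each of the constants below is the margin of one strict condition on [g] *)
  destruct (compact_open_margin (closure D) D (fun z => lamg * z)%C) as [k1 [Hk1 M1]]; auto.
  { intros z Hz. apply open_near; auto. }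
  destruct (compact_open_margin (closure D) D (fun z => g (lamg * z)%C)) as [k2 [Hk2 M2]]; auto.
  { intros z Hz. apply open_near; auto. }
  destruct (compact_open_margin (closure D) slit_plane (fun z => - C_derive g (g (lamg * z)))%C) as [k3 [Hk3 M3]]; auto.
  { intros z Hz. apply ccont_opp. apply (ccont_comp (C_derive g) (fun z => g (lamg * z)%C)); auto.
    apply analytic_ccont, g'A, DGL, Hz. }
  { intros z Hz. apply slit_plane_open, SL, Hz. }
  destruct (compact_open_margin (real_segment (-1) 1) D (fun z => z)) as [k4 [Hk4 M4]];
    auto using real_segment_bounded, real_segment_closed, ccont_id.
  { intros z [I Hz]. apply open_near; auto. rewrite (real_point_RtoC z I). apply HD; auto. }
  assert (SegD : forall z, real_segment b 1 z -> D z).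
  { intros z [I Hz]. rewrite (real_point_RtoC z I). apply HDi. lra. }
  destruct (compact_open_margin (real_segment b 1) (fun w => Re w < -1) (C_derive g)) as [k5 [Hk5 M5]];
    auto using real_segment_bounded, real_segment_closed.
  { intros z Hz. apply analytic_ccont, g'A, SegD, Hz. }
  { intros z [I Hz]. apply Re_lt_open. rewrite (real_point_RtoC z I). apply (SLOPE (Re z)); auto. }
  destruct (compact_open_margin (real_segment b 1) (fun w => Re w < 0) (C_derive (C_derive g))) as [k6 [Hk6 M6]];
    auto using real_segment_bounded, real_segment_closed.
  { intros z Hz. apply analytic_ccont, g''A, SegD, Hz. }
  { intros z [I Hz]. apply Re_lt_open. rewrite (real_point_RtoC z I). apply (SLOPE (Re z)); auto. }
  destruct (compact_unif_cont (closure D) (fun z => g (lamg * z)%C) (C_derive g) (k3/2)) as [d3 [Hd3 U3]]; auto; [lra| |].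
  { intros z Hz. apply analytic_ccont, g'A, DGL, Hz. }
  destruct (compact_unif_cont (real_segment b 1) (fun z => z) (C_derive g) (k5/2)) as [d5 [Hd5 U5]];
    auto using real_segment_bounded, real_segment_closed, ccont_id; [lra| |].
  { intros z Hz. apply analytic_ccont, g'A, SegD, Hz. }
  destruct (compact_unif_cont (real_segment b 1) (fun z => z) (C_derive (C_derive g)) (k6/2)) as [d6 [Hd6 U6]];
    auto using real_segment_bounded, real_segment_closed, ccont_id; [lra| |].
  { intros z Hz. apply analytic_ccont, g''A, SegD, Hz. }
  destruct (positive_lower_bound [k2/4; d3/2; d5/2; d6/2]) as [e2 [He2 Hl]]; [repeat constructor; lra|].
  rewrite !Forall_cons_iff in Hl.
  destruct (compact_unif_cont (closure D) (fun z => lamg * z)%C g e2) as [d2 [Hd2 U2]]; auto.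
  { intros z Hz. apply analytic_ccont, gA, DL, Hz. }
  (* the first two entries control [l z - lamg z]; the last three come from the
     estimates of [f' - g'] and [f'' - g''] on discs of radius [k2/2] and [k4/2] *)
  destruct (positive_lower_bound [d2 / (2 * R1); k1 / (2 * R1); e2/2; k3 * k2 / 32; k5 * k4 / 16; k6 * (k4 * k4) / 256])
    as [eps [Heps Hm]].
  { repeat constructor; repeat (apply Rdiv_lt_0_compat || apply Rmult_lt_0_compat); lra. }
  rewrite !Forall_cons_iff in Hm. destruct Hm as [Q1 [Q2 [Q3 [Q4 [Q5 [Q6 _]]]]]].
  assert (Q1' : eps * R1 <= d2 / 2).
  { apply Rle_trans with (d2 / (2 * R1) * R1). apply Rmult_le_compat_r; lra. right; field; lra. }
  assert (Q2' : eps * R1 <= k1 / 2).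
  { apply Rle_trans with (k1 / (2 * R1) * R1). apply Rmult_le_compat_r; lra. right; field; lra. }
  exists eps. split; auto. intros f GPf CL.
  destruct (in_GP_facts D k f OD BD GPf) as [fA [fR [fP _]]].
  destruct (class_P_lam D f OD fA HD fP) as [Lf [Bf _]].
  set (l := RtoC (lamC f)).
  assert (D1 : D (RtoC 1)) by (apply HDi; lra).
  assert (DLT : forall x, closure D (RtoC x) -> Rabs (trace f x - trace g x) <= eps).
  { intros x Hx. eapply Rle_trans; [|apply (CL _ Hx)]. apply (component_le Re (f (RtoC x) - g (RtoC x)) component_Re). }
  assert (LL : Cmod (l - lamg) <= eps).
  { unfold l, lamg. rewrite <- RtoC_minus, Cmod_R. apply DLT, closure_incl, D1. }
  assert (LZ : forall z, closure D z -> Cmod (l * z - lamg * z) <= eps * R1).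
  { intros z Hz. replace (l * z - lamg * z)%C with ((l - lamg) * z)%C by ring. rewrite Cmod_mult.
    apply Rmult_le_compat; auto; apply Cmod_ge_0. }
  assert (DLz : forall z, closure D z -> D (l * z)%C).
  { intros z Hz. apply (M1 z); auto. specialize (LZ z Hz). lra. }
  assert (FG : forall z, closure D z -> Cmod (f (l * z)%C - g (lamg * z)%C) < 2 * e2).
  { intros z Hz. assert (C1 := CL _ (closure_incl _ _ (DLz z Hz))).
    assert (C2 : Cmod (g (l * z)%C - g (lamg * z)%C) < e2) by (apply U2; auto; specialize (LZ z Hz); lra).
    pose proof (Cmod_sub_trans (f (l * z)%C) (g (l * z)%C) (g (lamg * z)%C)). lra. }
  set (E := fun w => (f w - g w)%C).
  assert (EA : analytic_on D E) by (intros z Dz; apply analytic_minus; [apply fA|apply gA]; auto).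
  assert (EB : forall z, D z -> Cmod (E z) <= eps) by (intros; apply CL, closure_incl; auto).
  assert (E'A : analytic_on D (C_derive E)) by (intros z Dz; apply analytic_C_derive, EA, Dz).
  assert (E'f : forall z, D z -> C_derive f z = (C_derive g z + C_derive E z)%C).
  { intros z Dz. unfold E. rewrite C_derive_minus by auto. ring. }
  split; [|split; [|split]].
  - exists (k1/2). split; [lra|]. intros z w Hz Hw. apply (M1 z); auto.
    specialize (LZ z Hz). pose proof (Cmod_sub_trans w (l * z)%C (lamg * z)%C). fold l in Hw. lra.
  - exists (k2/2). split; [lra|]. intros z w Hz Hw. apply (M2 z); auto.
    specialize (FG z Hz). pose proof (Cmod_sub_trans w (f (l * z)%C) (g (lamg * z)%C)). fold l in Hw. lra.
  - intros z Hz. fold l. apply (M3 z); auto. specialize (FG z Hz).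
    assert (DFz : D (f (l * z)%C)) by (apply (M2 z); auto; lra).
    assert (C1 : Cmod (C_derive E (f (l * z)%C)) <= k3/4).
    { eapply Rle_trans. apply (Cauchy_estimate_margin D E _ eps (k2/2)); auto; [lra|].
      - intros w Hw. assert (D w). { apply (M2 z); auto. pose proof (Cmod_sub_trans w (f (l * z)%C) (g (lamg * z)%C)). lra. } auto.
      - apply Rmult_le_reg_r with (k2/2); [lra|]. replace (4 * eps / (k2/2) * (k2/2)) with (4 * eps) by (field; lra). lra. }
    assert (C2 : Cmod (C_derive g (f (l * z)%C) - C_derive g (g (lamg * z)%C)) < k3/2) by (apply U3; auto; lra).
    rewrite E'f by auto.
    replace (- (C_derive g (f (l * z)%C) + C_derive E (f (l * z)%C)) - - C_derive g (g (lamg * z)))%C with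
      (- ((C_derive g (f (l * z)%C) - C_derive g (g (lamg * z))) + C_derive E (f (l * z)%C)))%C by ring.
    rewrite Cmod_opp. pose proof (Cmod_triangle (C_derive g (f (l * z)%C) - C_derive g (g (lamg * z)%C)) (C_derive E (f (l * z)%C))). lra.
  - intros y Hy.
    assert (Iy : in_I y) by (unfold in_I; lra). assert (Dy := HD y Iy).
    assert (BB : Rabs (bpt (trace f) - b) < 2 * e2).
    { assert (F1 : f (l * RtoC 1)%C = RtoC (bpt (trace f))).
      { rewrite Cmult_1_r. unfold bpt. apply (trace_RtoC (closure D)); auto. apply closure_incl, HDi. lra. }
      assert (G1 : g (lamg * RtoC 1)%C = RtoC b).
      { rewrite Cmult_1_r. unfold b, bpt. apply (trace_RtoC (closure D)); auto. apply closure_incl, HDi. lra. }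
      specialize (FG (RtoC 1) (closure_incl _ _ D1)). rewrite F1, G1, <- RtoC_minus, Cmod_R in FG. auto. }
    apply Rabs_def2 in BB.
    set (y' := Rmax y b).
    assert (Hy' : b <= y' <= 1 /\ Rabs (y - y') < 2 * e2).
    { unfold y', Rmax. destruct (Rle_dec y b); split; try lra. apply Rabs_def1; lra. rewrite Rminus_diag, Rabs_R0. lra. }
    destruct Hy' as [Hy' Hyy].
    assert (Seg : real_segment b 1 (RtoC y')) by (apply real_segment_RtoC; auto).
    assert (Cyy : Cmod (RtoC y - RtoC y') < 2 * e2) by (rewrite <- RtoC_minus, Cmod_R; auto).
    assert (InD : forall w, Cmod (w - RtoC y) < k4 -> D w).
    { intros w Hw. apply (M4 (RtoC y)); auto. apply real_segment_RtoC; auto. }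
    assert (C1 : forall w, Cmod (w - RtoC y) < k4/2 -> Cmod (C_derive E w) <= 8 * eps / k4).
    { intros w Hw. replace (8 * eps / k4) with (4 * eps / (k4/2)) by (field; lra).
      apply (Cauchy_estimate_margin D E); auto; [lra|]. intros v Hv.
      assert (D v). { apply InD. pose proof (Cmod_sub_trans v w (RtoC y)). lra. } auto. }
    assert (C1y : Cmod (C_derive E (RtoC y)) <= k5/2).
    { eapply Rle_trans; [apply C1; rewrite Cmod_sub_diag; lra|].
      apply Rmult_le_reg_r with k4; [lra|]. replace (8 * eps / k4 * k4) with (8 * eps) by (field; lra). lra. }
    assert (C2y : Cmod (C_derive (C_derive E) (RtoC y)) <= k6/2).
    { eapply Rle_trans. apply (Cauchy_estimate_margin D (C_derive E) _ (8 * eps / k4) (k4/2)); auto; [lra|].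
      intros w Hw. split. apply InD; lra. apply C1; auto.
      apply Rmult_le_reg_r with (k4 * k4); [apply Rmult_lt_0_compat; lra|].
      replace (4 * (8 * eps / k4) / (k4 / 2) * (k4 * k4)) with (64 * eps) by (field; lra). lra. }
    split.
    + unfold trace. apply (M5 (RtoC y')); auto. rewrite E'f by auto.
      assert (V : Cmod (C_derive g (RtoC y) - C_derive g (RtoC y')) < k5/2) by (apply U5; auto; lra).
      replace (C_derive g (RtoC y) + C_derive E (RtoC y) - C_derive g (RtoC y'))%C with
        ((C_derive g (RtoC y) - C_derive g (RtoC y')) + C_derive E (RtoC y))%C by ring.
      eapply Rle_lt_trans; [apply Cmod_triangle|lra].
    + unfold trace. apply (M6 (RtoC y')); auto.
      assert (E''f : C_derive (C_derive f) (RtoC y) = (C_derive (C_derive g) (RtoC y) + C_derive (C_derive E) (RtoC y))%C).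
      { apply cderiv_C_derive. apply cderiv_ext_loc with (fun w => C_derive g w + C_derive E w)%C k4; auto.
        intros w Hw. symmetry. apply E'f, InD, Hw.
        apply cderiv_plus; apply analytic_cderiv; auto. }
      rewrite E''f.
      assert (V : Cmod (C_derive (C_derive g) (RtoC y) - C_derive (C_derive g) (RtoC y')) < k6/2) by (apply U6; auto; lra).
      replace (C_derive (C_derive g) (RtoC y) + C_derive (C_derive E) (RtoC y) - C_derive (C_derive g) (RtoC y'))%C with
        ((C_derive (C_derive g) (RtoC y) - C_derive (C_derive g) (RtoC y')) + C_derive (C_derive E) (RtoC y))%C by ring.
      eapply Rle_lt_trans; [apply Cmod_triangle|lra].
Qed.

(** * The Lindeberg-Lyapunov operators *)

Definition LL_branch (f : C -> C) (b : bool) (z : C) : C :=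
  let l := RtoC (lamC f) in if b then (l * z)%C else f (l * z)%C.

(** The weights for [p = 1]: for every [p] the coefficients below have the
    [p]-th powers of their moduli. *)
Definition LL_weight (f : C -> C) (b : bool) (z : C) : C :=
  let l := RtoC (lamC f) in
  if b then (C_derive f (f (l * z)) * RtoC (/ lamC f))%C else RtoC (/ lamC f).

Definition LL_coef (f : C -> C) (p : R) (b : bool) (z : C) : C :=
  let l := RtoC (lamC f) in
  if b then (RtoC (/ Rpower (- lamC f) p) * Cpower (- C_derive f (f (l * z))) p)%C
  else RtoC (/ Rpower (- lamC f) p).

Lemma LL_op_wco f p : LL_op f p = wco (LL_branch f) (LL_coef f p).
Proof.
  apply functional_extensionality. intros h. apply functional_extensionality. intros z.
  unfold LL_op, wco, LL_branch, LL_coef. ring.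
Qed.

Lemma Rpower_Rinv x p : 0 < x -> Rpower (/ x) p = / Rpower x p.
Proof. intros Hx. unfold Rpower. rewrite ln_Rinv by auto. rewrite <- exp_Ropp. f_equal. ring. Qed.

Lemma Rpower_neg x p : 0 < x -> Rpower x (- p) = Rpower (/ x) p.
Proof. intros Hx. rewrite Rpower_Rinv by auto. apply Rpower_Ropp. Qed.

Lemma LL_ifs D f : analytic_on D f -> lamC f < 0 -> tame D f -> ifs D (LL_branch f) (LL_weight f).
Proof.
  intros HA HL [T1 [T2 [T3 _]]].
  assert (AL : forall z, analytic_at_C (fun z => RtoC (lamC f) * z)%C z).
  { intros z. apply analytic_scal, analytic_id. }
  assert (D1 : forall z, closure D z -> D (RtoC (lamC f) * z)%C).
  { intros z Hz. exact (maps_inside_in D _ z T1 Hz). }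
  assert (D2 : forall z, closure D z -> D (f (RtoC (lamC f) * z)%C)).
  { intros z Hz. exact (maps_inside_in D _ z T2 Hz). }
  assert (AF : forall z, closure D z -> analytic_at_C (fun z => f (RtoC (lamC f) * z)%C) z).
  { intros z Hz. apply (analytic_comp f (fun z => RtoC (lamC f) * z)%C); auto. }
  assert (NZ : RtoC (/ lamC f) <> RtoC 0).
  { intros E. apply RtoC_inj in E. assert (/ lamC f < 0) by (apply Rinv_lt_0_compat; auto). lra. }
  split; [|split].
  - intros [|] z Hz; unfold LL_branch; auto.
  - intros [|]; auto.
  - intros [|] z Hz; unfold LL_weight.
    + split.
      * apply analytic_mult; [|apply analytic_const].
        apply (analytic_comp (C_derive f) (fun z => f (RtoC (lamC f) * z)%C)); auto. apply analytic_C_derive, HA; auto.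
      * apply Cmult_neq_0; auto. intros E. apply (slit_plane_neq_0 _ (T3 z Hz)). rewrite E. ring.
    + split; auto. apply analytic_const.
Qed.

Lemma LL_coef_Cmod D f p b z : lamC f < 0 -> tame D f -> closure D z ->
  Cmod (LL_coef f p b z) = Rpower (Cmod (LL_weight f b z)) p.
Proof.
  intros HL [_ [_ [T3 _]]] Hz. unfold LL_coef, LL_weight.
  assert (PL : 0 < / Rpower (- lamC f) p) by (apply Rinv_0_lt_compat, Rpower_pos).
  assert (AL : Rabs (/ lamC f) = / - lamC f). { rewrite Rabs_inv, Rabs_left by auto. auto. }
  destruct b.
  - rewrite !Cmod_mult, !Cmod_R, (Rabs_pos_eq (/ Rpower _ _)), AL, Cmod_Cpower, Cmod_opp by lra.
    assert (NZ := slit_plane_neq_0 _ (T3 z Hz)). apply Cmod_gt_0 in NZ. rewrite Cmod_opp in NZ.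
    rewrite <- Rpower_mult_distr by (auto; apply Rinv_0_lt_compat; lra).
    rewrite Rpower_Rinv by lra. ring.
  - rewrite !Cmod_R, (Rabs_pos_eq (/ Rpower _ _)), AL, Rpower_Rinv by lra. auto.
Qed.

Lemma LL_coef_analytic D f p b z : analytic_on D f -> tame D f -> closure D z -> analytic_at_C (LL_coef f p b) z.
Proof.
  intros HA [T1 [T2 [T3 _]]] Hz. unfold LL_coef. destruct b; [|apply analytic_const].
  apply analytic_scal.
  apply (analytic_comp (fun w => Cpower w p) (fun z => - C_derive f (f (RtoC (lamC f) * z)))%C).
  2: apply analytic_Cpower, T3, Hz.
  apply analytic_ext with (fun z => RtoC (-1) * C_derive f (f (RtoC (lamC f) * z)))%C.
  { exists 1; split; [lra|]. intros; ring. }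
  apply analytic_scal. apply (analytic_comp (C_derive f) (fun z => f (RtoC (lamC f) * z)%C)).
  apply (analytic_comp f (fun z => RtoC (lamC f) * z)%C). apply analytic_scal, analytic_id.
  exact (HA _ (maps_inside_in D _ z T1 Hz)).
  apply analytic_C_derive. exact (HA _ (maps_inside_in D _ z T2 Hz)).
Qed.

Lemma LL_real D f x : open (T := C_UniformSpace) D -> analytic_on D f -> real_on_reals (closure D) f ->
  lamC f < 0 -> tame D f -> closure D (RtoC x) ->
  let y := trace f (lamC f * x) in
  LL_branch f true (RtoC x) = RtoC (lamC f * x) /\ LL_branch f false (RtoC x) = RtoC y /\
  D (RtoC y) /\ trace (C_derive f) y < 0 /\
  LL_weight f true (RtoC x) = RtoC (trace (C_derive f) y / lamC f) /\
  forall p b, Im (LL_coef f p b (RtoC x)) = 0 /\ 0 <= Re (LL_coef f p b (RtoC x)).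
Proof.
  intros OD HA HR HL TM Hx y. assert (TM' := TM). destruct TM' as [T1 [T2 [T3 _]]].
  assert (HRD : real_on_reals D f) by (intros u Du; apply HR, closure_incl, Du).
  assert (M1 : (RtoC (lamC f) * RtoC x)%C = RtoC (lamC f * x)) by (rewrite RtoC_mult; auto).
  assert (D1 := maps_inside_in D _ _ T1 Hx). cbv beta in D1. rewrite M1 in D1.
  assert (M2 : f (RtoC (lamC f * x)) = RtoC y) by (apply (trace_RtoC D); auto).
  assert (D2 := maps_inside_in D _ _ T2 Hx). cbv beta in D2. rewrite M1, M2 in D2.
  assert (M3 : C_derive f (RtoC y) = RtoC (trace (C_derive f) y)).
  { apply (trace_RtoC D); auto. apply C_derive_real; auto. }
  assert (NEG : trace (C_derive f) y < 0).
  { apply Rnot_le_lt. intros L. apply (T3 _ Hx). rewrite M1, M2, M3, <- RtoC_opp. unfold Re, Im; simpl. lra. }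
  assert (W1 : LL_weight f true (RtoC x) = RtoC (trace (C_derive f) y / lamC f)).
  { unfold LL_weight. rewrite M1, M2, M3, <- RtoC_mult. auto. }
  repeat split; auto.
  - unfold LL_branch. rewrite M1; auto.
  - unfold LL_coef. destruct b; [|reflexivity].
    rewrite M1, M2, M3, <- RtoC_opp, Cpower_R, <- RtoC_mult by lra. reflexivity.
  - assert (PL : 0 < / Rpower (- lamC f) p) by (apply Rinv_0_lt_compat, Rpower_pos).
    unfold LL_coef. destruct b; [|simpl; lra].
    rewrite M1, M2, M3, <- RtoC_opp, Cpower_R, <- RtoC_mult by lra.
    left; apply Rmult_lt_0_compat; auto. apply Rpower_pos.
Qed.

(** The positive eigenfunction on [closure D], restricted to the interval, where
    the weights are given by real derivatives; its continuity there comes from local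
    distortion. *)
Theorem LL_spectral_radius D f p : open (T := C_UniformSpace) D -> connected_open D -> bounded_set D ->
  (forall x, in_I x -> D (RtoC x)) -> analytic_on D f -> real_on_reals (closure D) f ->
  class_P (trace f) -> tame D f -> 0 <= p ->
  let l := lamC f in
  0 < spectral_radius D (LL_op f p) /\
  exists h, eig (fun x => l * x) (fun x => trace f (l * x))
    (fun x => trace (C_derive f) (trace f (l * x)) / l) (fun _ => / - l) p (spectral_radius D (LL_op f p)) h.
Proof.
  intros OD CD BD HD HA HR HP TM Hp l.
  destruct (class_P_lam D f OD HA HD HP) as [HL _]. change (lam (trace f)) with (lamC f) in HL. fold l in HL.
  assert (HI := LL_ifs D f HA (proj2 HL) TM).
  assert (D0 : D (RtoC 0)) by (apply HD, in_I_0).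
  destruct (weight_Harnack D _ _ OD CD BD HI _ D0) as [K [HK HAR]].
  assert (HX : forall b z, closure D z -> closure D (LL_branch f b z)).
  { intros b z Hz. apply (psiw_in_closure D _ _ (b :: nil) z HI Hz). }
  destruct (transfer_eigenfunction (closure D) (LL_branch f) (LL_weight f) p K (RtoC 0)) as [r [h [c1 [c2 [Hr [Hc [Hh [He HH]]]]]]]]; auto.
  { apply closure_incl; auto. } { intros b z Hz. apply HI, Hz. } { lra. }
  { intros z z' Hz Hz' v. split; apply HAR; auto. }
  assert (SR : spectral_radius D (LL_op f p) = r).
  { rewrite LL_op_wco. apply (wco_spectral_radius D _ (LL_weight f) _ p r h c1 c2 (RtoC 0)); auto.
    - split; auto. apply closure_incl; auto.
    - split; [|split; [|split]]; auto.
      + intros b z Hz. apply (LL_coef_analytic D); auto.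
      + intros b z Hz. apply (LL_coef_Cmod D); auto. apply HL.
      + intros b z [Hz Rz]. rewrite (real_point_RtoC z Rz) in *.
        destruct (LL_real D f _ OD HA HR (proj2 HL) TM Hz) as [B1 [B2 [_ [_ [_ CO]]]]].
        split; auto. destruct b; [rewrite B1|rewrite B2]; reflexivity.
    - split; auto. }
  rewrite SR. split; auto. exists (fun x => h (RtoC x)). split.
  - intros x Ix. assert (Dx := HD x Ix). assert (Cx := closure_incl _ _ Dx).
    split. destruct (Hh _ Cx); lra.
    destruct (local_distortion D _ _ _ OD BD HI Dx) as [rr [A0 [Hrr [HA0 [HDr DIS]]]]].
    assert (Hc2 : 0 < c2) by (destruct (Hh _ Cx); lra).
    assert (EXC : forall e, 0 < e -> exists d, 0 < d /\ forall t, Rabs t < d -> exp t < 1 + e).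
    { intros e He0. destruct (derivable_continuous_pt exp 0 (derivable_pt_exp 0) e He0) as [d [Hd Kd]].
      exists d. split; auto. intros t Ht. destruct (Req_dec t 0) as [->|N]. rewrite exp_0; lra.
      assert (Kt := Kd t). simpl in Kt. unfold R_dist in Kt. rewrite Rminus_0_r, exp_0 in Kt.
      assert (Rabs (exp t - 1) < e). { apply Kt. split; auto. split; auto. exact I. }
      apply Rabs_def2 in H. lra. }
    intros e He0. destruct (EXC (e / c2)) as [d [Hd Kd]]. apply Rdiv_lt_0_compat; auto.
    exists (Rmin rr (d / (3 * p * A0 + 1))).
    assert (PA : 0 <= 3 * p * A0) by (apply Rmult_le_pos; lra).
    split. { apply Rmin_pos; auto. apply Rdiv_lt_0_compat; lra. }
    intros y [_ Hy]. simpl in Hy. unfold R_dist in Hy. simpl. unfold R_dist.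
    assert (Y1 := Rlt_le_trans _ _ _ Hy (Rmin_l _ _)). assert (Y2 := Rlt_le_trans _ _ _ Hy (Rmin_r _ _)).
    assert (CY : Cmod (RtoC y - RtoC x) = Rabs (y - x)) by (rewrite <- RtoC_minus, Cmod_R; auto).
    assert (YB : Cmod (RtoC y - RtoC x) < rr) by lra.
    assert (XB : Cmod (RtoC x - RtoC x) < rr) by (rewrite Cmod_sub_diag; auto).
    assert (Cy : closure D (RtoC y)) by (apply closure_incl, HDr; auto).
    set (c := exp (A0 * Rabs (y - x))). assert (Hc0 : 0 < c) by apply exp_pos.
    assert (CL1 : weight_close (LL_branch f) (LL_weight f) c (RtoC x) (RtoC y)).
    { intros v. unfold c. rewrite <- CY. split. rewrite Cmod_sub_sym. apply DIS; auto. apply DIS; auto. }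
    assert (CL2 : weight_close (LL_branch f) (LL_weight f) c (RtoC y) (RtoC x)).
    { intros v. destruct (CL1 v). split; auto. }
    assert (RP : Rpower c (3 * p) < 1 + e / c2).
    { unfold c, Rpower. rewrite ln_exp. apply Kd. pose proof (Rabs_pos (y - x)).
      rewrite Rabs_pos_eq by (apply Rmult_le_pos; [lra|apply Rmult_le_pos; lra]).
      apply Rle_lt_trans with ((3 * p * A0 + 1) * Rabs (y - x)).
      - replace (3 * p * (A0 * Rabs (y - x))) with (3 * p * A0 * Rabs (y - x)) by ring. apply Rmult_le_compat_r; lra.
      - apply Rmult_lt_reg_r with (/ (3 * p * A0 + 1)). apply Rinv_0_lt_compat; lra.
        replace ((3 * p * A0 + 1) * Rabs (y - x) * / (3 * p * A0 + 1)) with (Rabs (y - x)) by (field; lra). exact Y2. }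
    pose proof (HH _ _ c Cx Cy Hc0 CL1) as H1. pose proof (HH _ _ c Cy Cx Hc0 CL2) as H2.
    destruct (Hh _ Cx) as [hx1 hx2]. destruct (Hh _ Cy) as [hy1 hy2].
    assert (EQ : e / c2 * c2 = e) by (field; lra).
    assert (0 < e / c2) by (apply Rdiv_lt_0_compat; auto).
    apply Rabs_def1; nra.
  - intros x Ix. assert (Cx := closure_incl _ _ (HD x Ix)). specialize (He _ Cx).
    destruct (LL_real D f x OD HA HR (proj2 HL) TM Cx) as [B1 [B2 [_ [NG [W1 _]]]]]. fold l in B1, B2, W1, NG.
    unfold transfer in He. rewrite B1, B2, W1, Cmod_R in He. unfold rtransfer. rewrite <- He.
    unfold LL_weight. fold l. rewrite Cmod_R, Rabs_inv, (Rabs_left l) by lra.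
    rewrite (Rabs_pos_eq (trace (C_derive f) (trace f (l * x)) / l)). auto.
    replace (trace (C_derive f) (trace f (l * x)) / l) with ((- trace (C_derive f) (trace f (l * x))) / - l) by (field; lra).
    left; apply Rdiv_lt_0_compat; lra.
Qed.

Lemma analytic_at_R_derivable f x0 : analytic_at_R f x0 -> ex_derive f x0.
Proof.
  intros [a [r [Hr H]]].
  assert (CR : Rbar_lt 0 (CV_radius a)).
  { apply Rbar_not_le_lt. intros L.
    assert (O : Rbar_lt (CV_radius a) (Rabs (r/2))).
    { eapply Rbar_le_lt_trans; [apply L|]. rewrite Rabs_pos_eq by lra. simpl. lra. }
    apply CV_disk_outside in O. apply O. apply ex_series_lim_0.
    exists (f (x0 + r/2)). apply is_pseries_R. replace (r/2) with ((x0 + r/2) - x0) at 1 by ring. apply H.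
    replace (x0 + r/2 - x0) with (r/2) by ring. rewrite Rabs_pos_eq; lra. }
  exists (PSeries (PS_derive a) 0).
  apply (is_derive_ext_loc (fun x => PSeries a (x - x0))).
  { exists (mkposreal r Hr). intros y Hy. apply is_pseries_unique, H, Hy. }
  replace (PSeries (PS_derive a) 0) with (scal 1 (PSeries (PS_derive a) 0)) by (unfold scal; simpl; unfold mult; simpl; ring).
  apply (is_derive_comp (PSeries a) (fun x => x - x0)).
  - replace (x0 - x0) with 0 by ring. apply is_derive_PSeries. rewrite Rabs_R0. auto.
  - auto_derive; auto.
Qed.

Lemma slope_lim f x0 d u : derivable_pt_lim f x0 d -> is_lim_seq u x0 -> (forall n, u n <> x0) ->
  is_lim_seq (fun n => (f (u n) - f x0) / (u n - x0)) d.
Proof.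
  intros H L N. apply is_lim_seq_spec. intros eps. destruct (H eps (cond_pos eps)) as [del K].
  apply is_lim_seq_spec in L. destruct (L del) as [M HM]. exists M. intros n Hn.
  specialize (HM n Hn). specialize (N n). specialize (K (u n - x0) ltac:(lra) HM).
  replace (x0 + (u n - x0)) with (u n) in K by ring. auto.
Qed.

(** Comparing the leading coefficients in [g (g (lam x)) = lam g x] at the
    critical point. *)
Lemma fixed_point_multiplier k D g : (1 <= k)%nat -> doubling_fixed_point k D g ->
  lamC g ^ (2 * k) * (/ lamC g * Derive (trace g) 1) = 1.
Proof.
  intros Hk [GP [FP [[phi [PA [PN PE]]] [_ [_ [HA [OD [_ [BD [HD _]]]]]]]]]].
  destruct GP as [_ HP]. destruct (class_P_lam D g OD HA HD HP) as [HL _]. change (lam (trace g)) with (lamC g) in HL.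
  set (F := trace g) in *. set (l := lamC g) in *.
  assert (F0 : F 0 = 1) by apply HP. assert (F1 : F 1 = l) by reflexivity.
  assert (D1 : derivable_pt_lim F 1 (Derive F 1)).
  { apply is_derive_Reals, Derive_correct. eexists. apply (trace_derive D g 1); auto. apply HD, in_I_1. }
  assert (Dp : derivable_pt_lim phi 0 (Derive phi 0)).
  { apply is_derive_Reals, Derive_correct, analytic_at_R_derivable, PA. lra. }
  assert (Z2k : forall x, x ^ (2 * k) = 0 -> x = 0).
  { intros x Hx. destruct (Req_dec x 0); auto. exfalso. apply (pow_nonzero x (2 * k)); auto. }
  assert (Z0 : 0 ^ (2 * k) = 0) by (apply pow_i; lia).
  assert (P0 : phi 0 = 1). { rewrite <- F0, (PE 0 in_I_0), Z0. auto. }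
  set (x := fun n => / (INR n + 2)).
  assert (Hx : forall n, 0 < x n <= 1).
  { intros n. unfold x. pose proof (pos_INR n). split. apply Rinv_0_lt_compat; lra.
    rewrite <- Rinv_1. apply Rinv_le_contravar; lra. }
  assert (Lx : is_lim_seq x 0).
  { unfold x. apply is_lim_seq_ext with (fun n => / INR (n + 2)). intros n; rewrite plus_INR; auto.
    apply (is_lim_seq_incr_n (fun n => / INR n) 2). replace (Finite 0) with (Rbar_inv p_infty) by auto.
    apply is_lim_seq_inv; [apply is_lim_seq_INR|discriminate]. }
  assert (Lpow : forall u : nat -> R, is_lim_seq u 0 -> is_lim_seq (fun n => u n ^ (2 * k)) 0).
  { intros u Lu. rewrite <- Z0. apply (is_lim_seq_continuous (fun y => y ^ (2 * k))); auto.
    apply derivable_continuous_pt, derivable_pt_pow. }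
  assert (Llx : is_lim_seq (fun n => l * x n) 0).
  { replace (Finite 0) with (Finite (l * 0)) by (f_equal; ring). apply is_lim_seq_mult'; auto. apply is_lim_seq_const. }
  assert (Ilx : forall n, in_I (x n) /\ in_I (l * x n)) by (intros n; specialize (Hx n); unfold in_I; split; nra).
  assert (A1 := slope_lim phi 0 _ _ Dp (Lpow x Lx)).
  assert (A2 := slope_lim phi 0 _ _ Dp (Lpow _ Llx)). cbv beta in A1, A2.
  assert (A3 : is_lim_seq (fun n => (F (F (l * x n)) - F 1) / (F (l * x n) - 1)) (Derive F 1)).
  { apply (slope_lim F 1 _ (fun n => F (l * x n)) D1).
    - rewrite <- F0. apply (is_lim_seq_continuous F); auto.
      apply derivable_continuous_pt. exists (trace (C_derive g) 0). apply is_derive_Reals. apply (trace_derive D g 0); auto. apply HD, in_I_0.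
    - intros n. specialize (Hx n). destruct (class_P_range D g (x n) OD HA HD HP) as [_ Rg]. apply Ilx.
      assert (Q : F (l * x n) < 1) by (apply Rg; lra). lra. }
  assert (N1 : forall n, x n ^ (2 * k) <> 0) by (intros n E; apply Z2k in E; specialize (Hx n); lra).
  assert (N2 : forall n, (l * x n) ^ (2 * k) <> 0).
  { intros n E; apply Z2k in E; specialize (Hx n). apply Rmult_integral in E. destruct E; lra. }
  specialize (A1 N1). specialize (A2 N2).
  assert (LIM1 : is_lim_seq (fun n => l * ((phi (x n ^ (2 * k)) - phi 0) / (x n ^ (2 * k) - 0))) (l * Derive phi 0)).
  { apply is_lim_seq_mult'; auto. apply is_lim_seq_const. }
  assert (LIM2 : is_lim_seq (fun n => l * ((phi (x n ^ (2 * k)) - phi 0) / (x n ^ (2 * k) - 0))) (l ^ (2 * k) * (Derive phi 0 * Derive F 1))).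
  { apply is_lim_seq_ext with (fun n => l ^ (2 * k) * (((phi ((l * x n) ^ (2 * k)) - phi 0) / ((l * x n) ^ (2 * k) - 0)) * ((F (F (l * x n)) - F 1) / (F (l * x n) - 1)))).
    2:{ apply is_lim_seq_mult'; [apply is_lim_seq_const|]. apply is_lim_seq_mult'; auto. }
    intros n. destruct (Ilx n) as [I1 I2]. rewrite <- !PE by auto. fold F. rewrite P0.
    assert (FX : F (F (l * x n)) = l * F (x n)).
    { specialize (FP (x n) I1). unfold doubling in FP. change (lam F) with l in FP. rewrite <- FP. field. lra. }
    rewrite FX, F1. rewrite Rpow_mult_distr. specialize (N1 n).
    assert (F (l * x n) - 1 <> 0).
    { specialize (Hx n). destruct (class_P_range D g (x n) OD HA HD HP) as [_ Rg]. apply Ilx.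
      assert (Q : F (l * x n) < 1) by (apply Rg; lra). lra. }
    field. repeat split; auto. intros E. apply Z2k in E. lra. }
  apply is_lim_seq_unique in LIM1, LIM2. rewrite LIM1 in LIM2. apply (f_equal real) in LIM2.
  change (l * Derive phi 0 = l ^ (2 * k) * (Derive phi 0 * Derive F 1)) in LIM2.
  assert (E2 : l ^ (2 * k) * Derive F 1 = l).
  { apply Rmult_eq_reg_r with (Derive phi 0); auto. lra. }
  replace (l ^ (2 * k) * (/ l * Derive F 1)) with (l ^ (2 * k) * Derive F 1 / l) by (field; lra).
  rewrite E2. field. lra.
Qed.

Theorem theorem4p5 :
  forall (k : nat) (D : C -> Prop) (g : C -> C) (omega : R),
    (1 <= k)%nat -> doubling_fixed_point k D g -> 0 < omega < 1 ->
    exists eps : R, 0 < eps /\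
    forall f : C -> C,
      stable_manifold k D g omega f ->
      sup_norm (closure D) (fun z => f z - g z)%C < eps ->
      let rho := fun p : R => spectral_radius D (LL_op f p) in
      let lf := lamC f in
      let a := / lf * Derive (trace f) 1 in
      (* (S1); the strict upper bound fails at p = 0, where rho 0 = 2 *)
      (forall p, 0 <= p ->
         Rpower a p < rho p <= Rpower a p + Rpower (- lf) (- p)) /\
      (forall p, 0 < p -> rho p < Rpower a p + Rpower (- lf) (- p)) /\
      (eq_on (closure D) f g ->
         (forall p, 0 <= p ->
            1 < Rpower (lf ^ (2 * k)) p * rho p
              <= 1 + Rpower (- lf) ((2 * INR k - 1) * p)) /\
         (forall p, 0 < p ->
            Rpower (lf ^ (2 * k)) p * rho p
              < 1 + Rpower (- lf) ((2 * INR k - 1) * p))) /\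
      (* (S2) *)
      (forall p q, 0 <= p -> p < q -> rho p < rho q) /\
      (forall p q t, 0 <= p -> p < q -> 0 < t < 1 ->
         ln (rho (t * p + (1 - t) * q))
           < t * ln (rho p) + (1 - t) * ln (rho q)) /\
      (* (S3) *)
      (forall p q, 0 < p -> p < q -> ln (rho q) / q < ln (rho p) / p).
Proof.
  intros k D g omega Hk HG _.
  destruct (near_fixed_point_tame k D g HG) as [eps [Heps NEAR]]. exists eps. split; auto.
  intros f [Fn [EF [FGP _]]] CL rho lf a.
  assert (GPf : in_GP D k f) by (rewrite <- EF; apply FGP).
  assert (HG' := HG).
  destruct HG' as [GP [_ [_ [_ [_ [_ [OD [CD [BD [HD _]]]]]]]]]].
  destruct (in_GP_facts D k g OD BD GP) as [gA [_ [_ [Mg [_ BMg]]]]].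
  destruct (in_GP_facts D k f OD BD GPf) as [fA [fR [fP [Mf [_ BMf]]]]].
  assert (TM : tame D f).
  { apply NEAR; auto. intros z Hz. left. eapply Rle_lt_trans; [|apply CL].
    apply (sup_norm_ge _ (fun z => f z - g z)%C (Mf + Mg)); auto.
    intros w Hw. eapply Rle_trans; [apply Cmod_sub_upper|]. specialize (BMf w Hw). specialize (BMg w Hw). lra. }
  clear CL NEAR EF FGP Fn Heps eps.
  destruct (class_P_lam D f OD fA HD fP) as [HL [HB _]]. change (lam (trace f)) with lf in HL, HB.
  assert (SP := fun p Hp => LL_spectral_radius D f p OD CD BD HD fA fR fP TM Hp). cbv zeta in SP. fold lf in SP.
  set (t1 := fun x => lf * x) in *. set (t2 := fun x => trace f (lf * x)) in *.
  set (w1 := fun x => trace (C_derive f) (trace f (lf * x)) / lf) in *.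
  set (w2 := / - lf) in *.
  assert (S1 : stays t1). { intros x Hx; unfold t1, in_I in *; nra. }
  assert (S2 : stays t2). { intros x Hx. apply fP. apply S1, Hx. }
  assert (F0 : trace f 0 = 1) by apply fP.
  assert (T20 : t2 0 = 1) by (unfold t2; rewrite Rmult_0_r; auto).
  assert (SLOPE : forall y, bpt (trace f) <= y <= 1 -> trace (C_derive f) y < -1 /\ trace (C_derive (C_derive f)) y < 0) by apply TM.
  assert (W2 : 1 < w2). { unfold w2. rewrite <- Rinv_1. apply Rinv_lt_contravar; lra. }
  assert (WW : forall y, y / lf = - y * w2) by (intros; unfold w2; field; lra).
  assert (RG : forall x, in_I x -> bpt (trace f) <= t2 x <= 1 /\ (x <> 0 -> t2 x < 1)).
  { intros x Hx. apply (class_P_range D f x OD fA HD fP Hx). }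
  assert (W1 : forall x, in_I x -> w2 < w1 x).
  { intros x Hx. unfold w1. rewrite WW. destruct (SLOPE (t2 x)) as [Q _]. apply RG; auto. unfold t2 in Q. nra. }
  assert (Wa : w1 0 = a).
  { unfold w1, a. rewrite Rmult_0_r, F0, (Derive_trace D) by (auto; apply HD, in_I_1). unfold Rdiv; ring. }
  assert (W1a : forall x, in_I x -> x <> 0 -> w1 x < a).
  { intros x Hx N. destruct (RG x Hx) as [R1 R2]. specialize (R2 N).
    rewrite <- Wa. unfold w1. rewrite Rmult_0_r, F0, !WW. apply Rmult_lt_compat_r; [lra|]. apply Ropp_lt_contravar.
    fold (t2 x).
    destruct (trace_MVT D (C_derive f) (t2 x) 1 OD) as [c [Hc E]]; auto.
    { intros z Dz. apply analytic_C_derive, fA, Dz. } { intros u Hu. apply HD. unfold in_I; lra. }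
    destruct (SLOPE c) as [_ Q]; [lra|]. nra. }
  assert (Ha : w2 < a) by (rewrite <- Wa; apply W1, in_I_0).
  assert (PW : forall x, in_I x -> 0 < w1 x) by (intros x Hx; specialize (W1 x Hx); lra).
  assert (RW : forall p, Rpower (- lf) (- p) = Rpower w2 p) by (intros; apply Rpower_neg; lra).
  assert (LOW : forall p, 0 <= p -> Rpower a p < rho p).
  { intros p Hp. destruct (SP p Hp) as [_ [h Eh]]. apply (eig_lower lf t2 w1 (fun _ => w2) a p _ h S2 Wa Eh). }
  assert (UPP : forall p, 0 <= p -> rho p <= Rpower a p + Rpower w2 p /\ (0 < p -> rho p < Rpower a p + Rpower w2 p)).
  { intros p Hp. destruct (SP p Hp) as [_ [h Eh]]. apply (eig_upper lf t2 w1 w2 a p _ h); auto. lra. }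
  split; [|split; [|split; [|split; [|split]]]].
  - intros p Hp. rewrite RW. split. apply LOW; auto. apply UPP; auto.
  - intros p Hp. rewrite RW. apply UPP; lra.
  - intros EQ.
    assert (EL : lf = lamC g). { unfold lf, lamC, lam, trace. rewrite EQ; auto. apply closure_incl, HD, in_I_1. }
    assert (ED : Derive (trace f) 1 = Derive (trace g) 1).
    { apply Derive_ext_loc. generalize (open_real_nearby D 1 OD (HD 1 in_I_1)). apply filter_imp.
      intros y Dy. unfold trace. rewrite EQ; auto. apply closure_incl, Dy. }
    assert (MU := fixed_point_multiplier k D g Hk HG). rewrite <- EL, <- ED in MU. fold a in MU.
    assert (PL : 0 < lf ^ (2 * k)).
    { rewrite pow_mult. apply pow_lt. apply pow2_gt_0. lra. }
    assert (M1 : forall p, Rpower (lf ^ (2 * k)) p * Rpower a p = 1).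
    { intros p. rewrite Rpower_mult_distr by (auto; lra). rewrite MU. unfold Rpower. rewrite ln_1, Rmult_0_r. apply exp_0. }
    assert (M2 : forall p, Rpower (lf ^ (2 * k)) p * Rpower w2 p = Rpower (- lf) ((2 * INR k - 1) * p)).
    { intros p. rewrite <- RW. replace (lf ^ (2 * k)) with (Rpower (- lf) (INR (2 * k))).
      rewrite Rpower_mult, <- Rpower_plus. f_equal. rewrite mult_INR. simpl (INR 2). ring.
      rewrite Rpower_pow by lra. rewrite !pow_mult. f_equal. ring. }
    split; intros p Hp.
    + assert (PP := Rpower_pos (lf ^ (2 * k)) p). specialize (LOW p Hp). destruct (UPP p Hp) as [U _].
      rewrite <- M2. rewrite <- (M1 p), <- Rmult_plus_distr_l. split.
      apply Rmult_lt_compat_l; auto. apply Rmult_le_compat_l; auto. lra.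
    + assert (PP := Rpower_pos (lf ^ (2 * k)) p). destruct (UPP p) as [_ U]; [lra|]. specialize (U Hp).
      rewrite <- M2. rewrite <- (M1 p), <- Rmult_plus_distr_l. apply Rmult_lt_compat_l; auto.
  - intros p q Hp Hpq. destruct (SP p Hp) as [_ [hp Ep]]. destruct (SP q) as [_ [hq Eq]]; [lra|].
    apply (eig_increasing t1 t2 w1 (fun _ => w2) p q _ _ hp hq); auto. intros x Hx. specialize (W1 x Hx). lra.
  - intros p q t Hp Hpq Ht. destruct (SP p Hp) as [Rp [hp Ep]]. destruct (SP q) as [Rq [hq Eq]]; [lra|].
    destruct (SP (t * p + (1 - t) * q)) as [Rm [hm Em]]. { apply Rplus_le_le_0_compat; apply Rmult_le_pos; lra. }
    apply (eig_log_convex lf t2 w1 w2 a p q t _ _ _ hp hq hm); auto. lra.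
  - intros p q Hp Hpq. destruct (SP p) as [Rp [hp Ep]]; [lra|]. destruct (SP q) as [Rq [hq Eq]]; [lra|].
    apply (eig_ratio t1 t2 w1 (fun _ => w2) p q _ _ hp hq); auto. intros x Hx. split; auto. lra.
Qed.
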